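(* Let $N\in[1,\infty)$, let $(X,d,\mathfrak m)$ be an $\mathsf{RCD}(0,N)$ space and let $x_0\in X$. Write $d_{x_0}=d(x_0,\cdot)$. Suppose that $$-\int_X\langle Dd_{x_0}^2,Df\rangle\,d\mathfrak m=2N\int_Xf\,d\mathfrak m$$ for every $f\in\mathcal D(\mathcal E)\cap L^1(\mathfrak m)$ with $d_{x_0}f,\ d_{x_0}|Df|\in L^1(\mathfrak m)$. For $t>0$ let $\hat\mu_t=\hat\rho_t\mathfrak m$ with $\hat\rho_t=Z(t)^{-1}\exp(-d_{x_0}^2/(4t))$, where $Z(t)=\int_X\exp(-d_{x_0}^2/(4t))\,d\mathfrak m$, and let $\hat\mu_0=\delta_{x_0}$. Then $(\hat\mu_{t^2/(2N)})_{t\ge0}$ is a unit-speed minimal geodesic in $(\mathcal P_2(X),W_2)$, i.e. $W_2(\hat\mu_{s^2/(2N)},\hat\mu_{t^2/(2N)})=|t-s|$ for all $s,t\ge0$.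
   Context: A metric measure space $(X,d,\mathfrak m)$ is a complete separable geodesic metric space $(X,d)$ (any $x_0,x_1\in X$ are joined by some $\gamma:[0,1]\to X$ with $\gamma_i=x_i$ for $i=0,1$ and $d(\gamma_s,\gamma_t)=|s-t|d(x_0,x_1)$) with a $\sigma$-finite Borel measure $\mathfrak m$ such that $0<\mathfrak m(B_r(x))<\infty$ for every metric ball. Cheeger energy: for Lipschitz $f$ let $\mathrm{lip}(f)(x)=\limsup_{y\to x}|f(y)-f(x)|/d(x,y)$. For $f\in L^2(\mathfrak m)$, $\mathsf{Ch}(f)=\frac12\inf\{\liminf_n\int_X\mathrm{lip}(f_n)^2\,d\mathfrak m: f_n \text{ Lipschitz},\ f_n\in L^2(\mathfrak m),\ f_n\to f\text{ in }L^2(\mathfrak m)\}$, and $\mathcal D(\mathsf{Ch})=\{f\in L^2(\mathfrak m):\mathsf{Ch}(f)<\infty\}$. For $f\in\mathcal D(\mathsf{Ch})$, $|Df|$ denotes its minimal weak upper gradient (equivalently, minimal relaxed gradient: the element of minimal $L^2$-norm among $G\in L^2(\mathfrak m)$ with $G\ge\tilde G$ for some weak $L^2$-limit $\tilde G$ of $\mathrm{lip}(f_n)$, with $f_n\in L^2(\mathfrak m)$ Lipschitz and $f_n\to f$ in $L^2(\mathfrak m)$); $\mathsf{Ch}(f)=\frac12\int|Df|^2d\mathfrak m$. The space is infinitesimally Hilbertian if $\mathsf{Ch}$ is a quadratic form; then $\langle Df,Dg\rangle=\frac14(|D(f+g)|^2-|D(f-g)|^2)$ and $\mathcal E(f,g)=\int\langle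 Df,Dg\rangle d\mathfrak m$ with $\mathcal D(\mathcal E)=\mathcal D(\mathsf{Ch})$. These notions are local ($|Df|=|Dg|$ a.e. on $\{f=g\}$), and $\langle Dd_{x_0}^2,Df\rangle$ is understood in the extended sense: on each ball $B_R(x_0)$ it is computed with $d_{x_0}^2$ replaced by any function in $\mathcal D(\mathcal E)$ coinciding with it on $B_R(x_0)$. $\mathcal P_2(X)$ is the set of Borel probability measures with finite second moment, with the $L^2$-Wasserstein distance $W_2$. $\mathsf{RCD}(0,N)$ means: infinitesimally Hilbertian and satisfying $\mathsf{CD}(0,N)$, i.e. for all $\mu_i=\rho_i\mathfrak m\in\mathcal P_2(X)$ ($i=0,1$) with bounded support there are an optimal coupling $q$ and a $W_2$-geodesic $\mu_t=\rho_t\mathfrak m$ joining them such that $\int\rho_t^{-1/N'}d\mu_t\ge\int[(1-t)\rho_0(x_0)^{-1/N'}+t\rho_1(x_1)^{-1/N'}]\,q(dx_0dx_1)$ for all $t\in[0,1]$, $N'\ge N$. On such a space $Z(t)<\infty$ and $\hat\mu_t\in\mathcal P_2(X)$. *)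

(* Defs.v *)
From HB Require Import structures.
From mathcomp Require Import all_boot all_order all_algebra.
From mathcomp Require Import all_classical all_reals all_analysis.
From mathcomp Require Import measurable_realfun.

Set Implicit Arguments.
Unset Strict Implicit.
Unset Printing Implicit Defensive.
Import Order.TTheory GRing.Theory Num.Theory.
Import numFieldNormedType.Exports.

Local Open Scope classical_set_scope.
Local Open Scope ring_scope.

#[short(type="completeMetricType")]
HB.structure Definition CompleteMetric (R : numDomainType) :=
  {T of CompletePseudoMetric R T & Metric R T}.

Notation borel X := (g_sigma_algebraType (@open X)).

Notation borel_measure X R := {measure set (borel X) -> \bar R}.

Section metric_measure_space.
Context {R : realType} {X : completeMetricType R}.
Implicit Types (m : borel_measure X R) (x y : X).

Definition separable := exists2 D : set X, countable D & dense D.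

Definition geodesic_space := forall x y : X, exists gamma : R -> X,
  [/\ gamma 0 = x, gamma 1 = y &
      forall s t : R, 0 <= s <= 1 -> 0 <= t <= 1 ->
        mdist (gamma s) (gamma t) = `|s - t| * mdist x y].

Definition metric_measure_space m :=
  [/\ separable, geodesic_space, sigma_finite setT m &
      forall x (r : R), 0 < r -> (0 < m (ball x r) < +oo)%E].

End metric_measure_space.

Section cheeger.
Context {R : realType} {X : completeMetricType R}.
Variable m : borel_measure X R.
Implicit Types (f g h G phi : X -> R) (fn : nat -> X -> R).

(* Functions are Borel representatives of their m-a.e. classes. *)
Local Notation L2 := (Lfun m 2%:E).

Definition lipschitz_fun f :=
  exists L : R, forall x y : X, `|f x - f y| <= L * mdist x y.

(* The limsup may be taken over full neighborhoods of x: at y = x the quotient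
   is 0 / 0 = 0, which is harmless (all quotients are nonnegative) and gives
   lip f x = 0 at isolated points. For Lipschitz f the limsup is finite, so
   that fine loses nothing. *)
Definition lip f (x : X) : R :=
  fine (limf_esup (fun y : X => (`|f y - f x| / mdist x y)%:E) (nbhs x)).

Definition lipschitz_approx fn f :=
  (forall n, lipschitz_fun (fn n) /\ fn n \in L2) /\
  'N[m]_2%:E[EFin \o (fn n \- f)%R]%E @[n --> \oo] --> 0%E.

Definition cheeger f : \bar R :=
  (2^-1%:E * ereal_inf
     [set limn_einf (fun n => \int[m]_x ((lip (fn n) x) ^+ 2)%:E)
     | fn in [set fn | lipschitz_approx fn f]])%E.

Definition dom_cheeger : set (X -> R) :=
  [set f | f \in L2 /\ (cheeger f < +oo)%E].

Definition weak_L2_cvg fn f :=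
  [/\ forall n, fn n \in L2, f \in L2 &
      forall h, h \in L2 ->
        (\int[m]_x (fn n x * h x)%:E)%E @[n --> \oo] -->
        (\int[m]_x (f x * h x)%:E)%E].

Definition relaxed_gradient f G :=
  G \in L2 /\ exists fn G',
    [/\ lipschitz_approx fn f, weak_L2_cvg (fun n => lip (fn n)) G' &
        {ae m, forall x, G' x <= G x}].

Definition is_minimal_gradient f G := relaxed_gradient f G /\
  forall G', relaxed_gradient f G' ->
    ('N[m]_2%:E[EFin \o G] <= 'N[m]_2%:E[EFin \o G'])%E.

(* |Df|, defined for f in dom_cheeger; a Borel representative is chosen. *)
Definition mgrad f : X -> R := xget (fun=> 0) (is_minimal_gradient f).

Definition infinitesimally_hilbertian :=
  exists B : (X -> R) -> (X -> R) -> R,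
    [/\ forall f g, dom_cheeger f -> dom_cheeger g -> B f g = B g f,
        forall (a : R) f1 f2 g,
          dom_cheeger f1 -> dom_cheeger f2 -> dom_cheeger g ->
          B (fun x => a * f1 x + f2 x) g = a * B f1 g + B f2 g &
        forall f, dom_cheeger f -> cheeger f = (B f f)%:E].

Definition grad_inner f g (x : X) : R :=
  4^-1 * (mgrad (f \+ g) x ^+ 2 - mgrad (f \- g) x ^+ 2).

(* <D phi, D f> when phi is only locally in dom_cheeger: on every ball around
   x0 it agrees with <D g, D f> for each g in dom_cheeger that coincides with
   phi on that ball. *)
Definition is_local_grad_inner (x0 : X) phi f h :=
  measurable_fun [set: borel X] h /\
  forall (r : R) g, 0 < r -> dom_cheeger g ->
    {ae m, forall x, ball x0 r x -> g x = phi x} ->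
    {ae m, forall x, ball x0 r x -> h x = grad_inner g f x}.

Definition local_grad_inner (x0 : X) phi f : X -> R :=
  xget (fun=> 0) (is_local_grad_inner x0 phi f).

End cheeger.

Section wasserstein.
Context {R : realType} {X : completeMetricType R}.
Implicit Types mu nu : borel_measure X R.
Implicit Types q : {measure set (borel X * borel X)%type -> \bar R}.

Definition P2 mu := mu setT = 1%E /\
  exists x0 : X, (\int[mu]_x (mdist x0 x ^+ 2)%:E < +oo)%E.

Definition coupling mu nu q := forall A : set (borel X), measurable A ->
  q (A `*` setT) = mu A /\ q (setT `*` A) = nu A.

Definition transport_cost q : \bar R :=
  (\int[q]_z (mdist (z.1 : X) (z.2 : X) ^+ 2)%:E)%E.

Definition W2 mu nu : \bar R :=
  poweR (ereal_inf [set transport_cost q | q in coupling mu nu]) 2^-1.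

Definition optimal_coupling mu nu q := coupling mu nu q /\
  forall q', coupling mu nu q' -> (transport_cost q <= transport_cost q')%E.

Definition W2_geodesic mu nu (mut : R -> borel_measure X R) :=
  [/\ forall t : R, 0 <= t <= 1 -> P2 (mut t),
      forall A : set (borel X), measurable A -> mut 0 A = mu A,
      forall A : set (borel X), measurable A -> mut 1 A = nu A &
      forall s t : R, 0 <= s <= 1 -> 0 <= t <= 1 ->
        W2 (mut s) (mut t) = (`|s - t|%:E * W2 mu nu)%E].

Definition msupport mu : set X :=
  [set x | forall r : R, 0 < r -> (0 < mu (ball x r))%E].

Definition bounded_support mu := exists (x : X) (r : R),
  msupport mu `<=` ball x r.

Definition has_density (m mu : borel_measure X R) (rho : X -> R) :=
  [/\ measurable_fun [set: borel X] rho, forall x, 0 <= rho x &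
      forall A : set (borel X), measurable A ->
        mu A = (\int[m]_(x in A) (rho x)%:E)%E].

(* Where a density vanishes powR returns 0 instead of +oo; this only concerns
   null sets of mut t and q. *)
Definition CD0 (N : R) (m : borel_measure X R) :=
  forall (mu0 mu1 : borel_measure X R) (rho0 rho1 : X -> R),
  P2 mu0 -> P2 mu1 -> bounded_support mu0 -> bounded_support mu1 ->
  has_density m mu0 rho0 -> has_density m mu1 rho1 ->
  exists q (mut : R -> borel_measure X R) (rhot : R -> X -> R),
    [/\ optimal_coupling mu0 mu1 q,
        W2_geodesic mu0 mu1 mut,
        forall t : R, 0 <= t <= 1 -> has_density m (mut t) (rhot t) &
        forall t N' : R, 0 <= t <= 1 -> N <= N' ->
          (\int[q]_z ((1 - t) * rho0 z.1 `^ (- N'^-1) +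
                      t * rho1 z.2 `^ (- N'^-1))%:E <=
           \int[mut t]_x (rhot t x `^ (- N'^-1))%:E)%E].

Definition RCD0 (N : R) (m : borel_measure X R) :=
  infinitesimally_hilbertian m /\ CD0 N m.

End wasserstein.

Section gaussian.
Context {R : realType} {X : completeMetricType R}.
Variables (m : borel_measure X R) (x0 : X) (t : R).

Definition gauss_weight (x : X) : R := expR (- (mdist x0 x ^+ 2 / (4 * t))).

(* Z(t); it is finite when CD(0,N) holds and t > 0, so fine is harmless. *)
Definition partition_fun : R := fine (\int[m]_x (gauss_weight x)%:E)%E.

Definition gauss_density (x : X) : R := partition_fun^-1 * gauss_weight x.

Definition gauss_measure (A : set (borel X)) : \bar R :=
  (\int[m]_(x in A) (gauss_density x)%:E)%E.

Lemma open_ltr_mdist (r : R) : open [set x : X | mdist x0 x < r].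
Proof.
rewrite openE => x /= xr.
apply/nbhs_ballP; exists (r - mdist x0 x); first by rewrite /= subr_gt0.
move=> y; rewrite ballEmdist/= ltrBrDl; apply: le_lt_trans.
exact: metric_triangle.
Qed.

Lemma measurable_mdist :
  measurable_fun [set: borel X] (mdist x0 : borel X -> R).
Proof.
apply: (measurability _ (RGenInftyO.measurableE R)) => _ [_ [r ->] <-].
rewrite setTI; apply: sub_sigma_algebra.
suff -> : mdist x0 @^-1` `]-oo, r[%classic = [set x : X | mdist x0 x < r].
  exact: open_ltr_mdist.
by apply/seteqP; split => x /=; rewrite in_itv.
Qed.

Lemma gauss_density_ge0 x : 0 <= gauss_density x.
Proof.
rewrite mulr_ge0 ?expR_ge0// invr_ge0 fine_ge0// integral_ge0// => y _.
by rewrite lee_fin expR_ge0.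
Qed.

Lemma measurable_gauss_density : measurable_fun [set: borel X] gauss_density.
Proof.
apply: measurable_funM => //; apply: measurableT_comp => //.
apply: measurable_funN; apply: measurable_funM => //.
exact: measurable_funX measurable_mdist.
Qed.

Lemma gauss_measure0 : gauss_measure set0 = 0%E.
Proof. by rewrite /gauss_measure integral_set0. Qed.

Lemma gauss_measure_ge0 A : (0 <= gauss_measure A)%E.
Proof. by apply: integral_ge0 => x _; rewrite lee_fin gauss_density_ge0. Qed.

Lemma gauss_measure_sigma_additive : semi_sigma_additive gauss_measure.
Proof.
move=> /= F mF tF mUF; rewrite /gauss_measure; apply: cvg_toP.
  apply: ereal_nondecreasing_is_cvgn => k n kn.
  apply: lee_sum_nneg_natr => // i _ _; apply: integral_ge0 => x _.
  by rewrite lee_fin gauss_density_ge0.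
rewrite ge0_integral_bigcup//=.
- apply/measurable_funTS/measurableT_comp => //.
  exact: measurable_gauss_density.
- by move=> x _; rewrite lee_fin gauss_density_ge0.
Qed.

HB.instance Definition _ := isMeasure.Build _ _ _
  gauss_measure gauss_measure0 gauss_measure_ge0 gauss_measure_sigma_additive.

(* Used for t >= 0 only. *)
Definition mu_hat : borel_measure X R :=
  if 0 < t then gauss_measure : borel_measure X R else \d_(x0 : borel X).

End gaussian.

(* Main.v *)
(* Write d for the distance to x0 and V(r) for the volume of the ball of radius r.

   Testing the hypothesis on f = (r^2 - d^2)_+ and using locality of minimal
   gradients together with |D d^2| <= 2 d gives, for I(r) the integral of f,
   the inequality (N + 2) I(r) <= 2 r^2 V(r). Transporting the uniform measure of a
   small ball around x0 to that of a set A, CD(0,N) shows that the set of approximate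
   l-intermediate points between x0 and A has measure at least l^N m(A); for balls
   this is Bishop-Gromov, V(l r) >= l^N V(r). Integrating the latter bounds I from
   below by the same quantity, so that equality holds everywhere: V(r) = V(1) r^N.
   Hence Gaussian integrals are explicit and mu_hat(t^2/2N) has second moment t^2
   around x0, whence W2 >= |t - s|.

   Conversely, let s < t and l = s/t. By the layer cake formula, the lower bound on
   intermediate points becomes mu_t(A) <= mu_s(A_l) for the Gaussian measures, where
   A_l is the set of approximate l-intermediate points. This is Hall's condition for
   the relation between y and its approximate l-intermediate points x, so Strassen's
   theorem, applied to finite partitions, yields almost optimal couplings supported on
   pairs with d(x,y) close to (1 - l) d(y), of cost close to (1 - l)^2 t^2 = (t - s)^2. *)

Require Import Defs.
From HB Require Import structures.
From mathcomp Require Import all_boot all_order all_algebra.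
From mathcomp Require Import all_classical all_reals all_analysis.
From mathcomp Require Import measurable_realfun.
From mathcomp Require Import ring lra.

Set Implicit Arguments.
Unset Strict Implicit.
Unset Printing Implicit Defensive.
Import Order.TTheory GRing.Theory Num.Theory.
Import numFieldNormedType.Exports.

Local Open Scope classical_set_scope.
Local Open Scope ring_scope.

(** * Square-integrable functions *)

(** The minimal gradient is accessible only as a minimizer of an L2 norm, so locality and the bound
    of |Du| by the local slope are both read off one first variation: a recovery sequence of [u] is
    mixed with one of [v] by a Lipschitz cutoff. The sharp constant survives in the test with f =
    (r^2 - d^2)_+ because, inside the ball, d^2 - f = 2 d^2 - r^2 has slope at most 4 d, and a
    quarter of its square, 4 d^2, is the Euclidean value of -<Dd^2, Df>. Wasserstein geodesics enter
    through costs alone. Nearly optimal plans are composed through the cells of a fine partition,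
    with a small mismatch at the middle point; hence the tolerance [dl] in the notion of
    intermediate point, which also makes sets of such points open, whatever the target set. Volume
    and Gaussian identities are obtained from difference inequalities on intervals [u, u th] with th
    close to 1, where powers only lose a factor close to 1, in place of derivatives. *)

Section almost_everywhere_implications.
Context {d : measure_display} {T : measurableType d} {R : realType}.
Variable mu : {measure set T -> \bar R}.
Implicit Types P Q S : T -> Prop.

Lemma ae_imp P Q : (forall x, P x -> Q x) ->
  {ae mu, forall x, P x} -> {ae mu, forall x, Q x}.
Proof. exact: filterS. Qed.

Lemma ae_imp2 P Q S : (forall x, P x -> Q x -> S x) ->
  {ae mu, forall x, P x} -> {ae mu, forall x, Q x} -> {ae mu, forall x, S x}.
Proof. exact: filterS2. Qed.

End almost_everywhere_implications.

Section square_integrable.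
Context {d : measure_display} {T : measurableType d} {R : realType}.
Variable mu : {measure set T -> \bar R}.
Implicit Types f g h : T -> R.

Local Notation L2 := (Lfun mu 2%:E).

Lemma powR2 (x : R) : `|x| `^ 2 = x ^+ 2.
Proof. by rewrite powR_mulrn// real_normK// num_real. Qed.

Lemma L2P f : f \in L2 <->
  measurable_fun setT f /\ (\int[mu]_x (f x ^+ 2)%:E < +oo)%E.
Proof.
split.
- move=> f2; split.
    by move: f2; rewrite inE => /andP[/[!inE]].
  have /integrableP[_] := Lfun2_integrable_sqr f2.
  by under eq_integral do rewrite /= ger0_norm ?sqr_ge0//.
- move=> [mf fi]; rewrite inE; apply/andP; split; rewrite inE//=.
  rewrite /finite_norm unlock/= poweR_lty//.
  by under eq_integral do rewrite powR2.
Qed.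

Lemma L2_measurable f : f \in L2 -> measurable_fun setT f.
Proof. by move=> /L2P[]. Qed.

Lemma L2_le f g : measurable_fun setT f -> g \in L2 ->
  (forall x, `|f x| <= `|g x|) -> f \in L2.
Proof.
move=> mf /L2P[mg gi] fg; apply/L2P; split=> //.
apply: le_lt_trans gi; apply: ge0_le_integral => //.
- by move=> x _; rewrite lee_fin sqr_ge0.
- by apply/measurable_EFinP; exact: measurable_funX.
- by apply/measurable_EFinP; exact: measurable_funX.
- move=> x _; rewrite lee_fin -[leLHS]real_normK ?num_real//.
  by rewrite -[leRHS]real_normK ?num_real// lerXn2r ?nnegrE.
Qed.

Lemma integrable_L2M f g : f \in L2 -> g \in L2 ->
  mu.-integrable setT (EFin \o (fun x => f x * g x)).
Proof. by move=> f2 g2; apply/Lfun1_integrable; exact: Lfun2_mul_Lfun1. Qed.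

Lemma L2_lin (a b : R) f g : f \in L2 -> g \in L2 ->
  (fun x => a * f x + b * g x) \in L2.
Proof.
move=> f2 g2; have mf := L2_measurable f2; have mg := L2_measurable g2.
apply/L2P; split.
  by apply: measurable_funD; apply: measurable_funM.
have i h : h \in L2 -> mu.-integrable setT (EFin \o (fun x => h x ^+ 2)).
  exact: Lfun2_integrable_sqr.
have iA : mu.-integrable setT
   (fun x => (2 * a ^+ 2)%:E * (f x ^+ 2)%:E + (2 * b ^+ 2)%:E * (g x ^+ 2)%:E)%E.
  by apply: integrableD => //; apply: integrableZl => //; apply: i.
apply: le_lt_trans (integrable_lty measurableT iA); apply: ge0_le_integral => //.
- by move=> x _; rewrite lee_fin sqr_ge0.
- apply/measurable_EFinP; apply: measurable_funX.
  by apply: measurable_funD; apply: measurable_funM.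
- by case/integrableP: iA.
- move=> x _; rewrite -!EFinM -EFinD lee_fin.
  by have := sqr_ge0 (a * f x - b * g x); nra.
Qed.

Lemma L2D f g : f \in L2 -> g \in L2 -> (fun x => f x + g x) \in L2.
Proof.
move=> f2 g2; rewrite (_ : (fun _ => _) = (fun x => 1 * f x + 1 * g x)).
  exact: L2_lin.
by apply/funext => x; rewrite !mul1r.
Qed.

Lemma L2B f g : f \in L2 -> g \in L2 -> (fun x => f x - g x) \in L2.
Proof.
move=> f2 g2; rewrite (_ : (fun _ => _) = (fun x => 1 * f x + (-1) * g x)).
  exact: L2_lin.
by apply/funext => x; rewrite !mul1r mulN1r.
Qed.

Lemma L2_bndM f g (M : R) : measurable_fun setT g -> (forall x, `|g x| <= M) ->
  f \in L2 -> (fun x => g x * f x) \in L2.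
Proof.
move=> mg gM f2; have mf := L2_measurable f2.
apply: (@L2_le _ (fun x => M * f x + 0 * f x)).
- exact: measurable_funM.
- exact: L2_lin.
- move=> x; rewrite mul0r addr0 !normrM ler_wpM2r//.
  by rewrite (le_trans (gM x))// ler_norm.
Qed.

Definition ip f g : R := \int[mu]_x (f x * g x).

(** The squared L2 norm. Staying with squares keeps the estimates polynomial in norms and scalar
    products. *)
Definition nrm2 f : R := ip f f.

Lemma ip_EFin f g : f \in L2 -> g \in L2 ->
  ((ip f g)%:E = \int[mu]_x (f x * g x)%:E)%E.
Proof.
move=> f2 g2; rewrite /ip /Rintegral fineK//.
exact: (integrable_fin_num _ (integrable_L2M f2 g2)).
Qed.

Lemma nrm2_EFin f : f \in L2 -> ((nrm2 f)%:E = \int[mu]_x (f x ^+ 2)%:E)%E.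
Proof. by move=> f2; rewrite /nrm2 ip_EFin. Qed.

Lemma ipC f g : ip f g = ip g f.
Proof. by apply: eq_Rintegral => x _; rewrite mulrC. Qed.

Lemma ip_linl (a b : R) f g h : f \in L2 -> g \in L2 -> h \in L2 ->
  ip (fun x => a * f x + b * g x) h = a * ip f h + b * ip g h.
Proof.
move=> f2 g2 h2; have ifh := integrable_L2M f2 h2.
have igh := integrable_L2M g2 h2.
rewrite /ip -!RintegralZl// -RintegralD//.
- by apply: eq_Rintegral => x _; rewrite mulrDl !mulrA.
- by have := integrableZl (measurableT) a ifh; apply: eq_integrable.
- by have := integrableZl (measurableT) b igh; apply: eq_integrable.
Qed.

Lemma ipDl f g h : f \in L2 -> g \in L2 -> h \in L2 ->
  ip (fun x => f x + g x) h = ip f h + ip g h.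
Proof.
move=> f2 g2 h2; rewrite (_ : (fun _ => _) = (fun x => 1 * f x + 1 * g x)).
  by rewrite ip_linl// !mul1r.
by apply/funext => x; rewrite !mul1r.
Qed.

Lemma ipBl f g h : f \in L2 -> g \in L2 -> h \in L2 ->
  ip (fun x => f x - g x) h = ip f h - ip g h.
Proof.
move=> f2 g2 h2; rewrite (_ : (fun _ => _) = (fun x => 1 * f x + (-1) * g x)).
  by rewrite ip_linl// mul1r mulN1r.
by apply/funext => x; rewrite mul1r mulN1r.
Qed.

Lemma nrm2_lin (a b : R) f g : f \in L2 -> g \in L2 ->
  nrm2 (fun x => a * f x + b * g x) =
  a ^+ 2 * nrm2 f + 2 * a * b * ip f g + b ^+ 2 * nrm2 g.
Proof.
move=> f2 g2; have h2 := L2_lin a b f2 g2.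
rewrite /nrm2 ip_linl// (ipC f (fun _ => _)) (ipC g (fun _ => _)) !ip_linl//.
by rewrite (ipC g f); ring.
Qed.

Lemma nrm2D f g : f \in L2 -> g \in L2 ->
  nrm2 (fun x => f x + g x) = nrm2 f + 2 * ip f g + nrm2 g.
Proof.
move=> f2 g2; rewrite (_ : (fun _ => _) = (fun x => 1 * f x + 1 * g x)).
  by rewrite nrm2_lin//; ring.
by apply/funext => x; rewrite !mul1r.
Qed.

Lemma nrm2B f g : f \in L2 -> g \in L2 ->
  nrm2 (fun x => f x - g x) = nrm2 f - 2 * ip f g + nrm2 g.
Proof.
move=> f2 g2; rewrite (_ : (fun _ => _) = (fun x => 1 * f x + (-1) * g x)).
  by rewrite nrm2_lin//; ring.
by apply/funext => x; rewrite mul1r mulN1r.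
Qed.

Lemma nrm2_ge0 f : 0 <= nrm2 f.
Proof. by apply: Rintegral_ge0 => x _; rewrite -expr2 sqr_ge0. Qed.

Lemma ler_ip f g h : f \in L2 -> g \in L2 -> h \in L2 ->
  {ae mu, forall x, f x * h x <= g x * h x} -> ip f h <= ip g h.
Proof.
move=> f2 g2 h2 fg; have gf2 := L2B g2 f2.
rewrite -subr_ge0 -ipBl//.
have : (0 <= \int[mu]_x ((g x - f x) * h x)%:E)%E.
  rewrite (_ : (\int[mu]_x ((g x - f x) * h x)%:E)%E =
               (\int[mu]_x `|((g x - f x) * h x)%:E|)%E).
    by apply: integral_ge0 => x _.
  apply: ae_eq_integral => //.
  - by case/integrableP: (integrable_L2M gf2 h2).
  - by apply: measurableT_comp => //; case/integrableP: (integrable_L2M gf2 h2).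
  - apply: filterS fg => x fgx _ /=.
    by rewrite ger0_norm// mulrBl subr_ge0.
by rewrite -ip_EFin.
Qed.

Lemma ler_nrm2 f g : f \in L2 -> g \in L2 ->
  {ae mu, forall x, f x ^+ 2 <= g x ^+ 2} -> nrm2 f <= nrm2 g.
Proof.
move=> f2 g2 fg; rewrite -lee_fin !nrm2_EFin//.
have mf := L2_measurable f2; have mg := L2_measurable g2.
apply: ae_ge0_le_integral => //.
- by move=> x _; rewrite lee_fin sqr_ge0.
- by apply/measurable_EFinP; exact: measurable_funX.
- by move=> x _; rewrite lee_fin sqr_ge0.
- by apply/measurable_EFinP; exact: measurable_funX.
- by apply: filterS fg => x /=; rewrite lee_fin.
Qed.

Lemma nrm2_eq0 f : f \in L2 -> nrm2 f <= 0 -> {ae mu, forall x, f x = 0}.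
Proof.
move=> f2 f0; have mf := L2_measurable f2.
have : (\int[mu]_x `|(f x ^+ 2)%:E| = 0)%E.
  under eq_integral do rewrite /= ger0_norm ?sqr_ge0//.
  by rewrite -nrm2_EFin//; congr EFin; apply/eqP; rewrite eq_le f0 nrm2_ge0.
move/ae_eq_integral_abs => H.
have := H measurableT (ltac:(apply/measurable_EFinP; exact: measurable_funX)).
apply: filterS => x /(_ Logic.I) /= [] /eqP.
by rewrite sqrf_eq0 => /eqP.
Qed.

(** Cauchy-Schwarz, from the nonnegativity of the quadratic form nrm2 (a f + b g) at a = nrm2 g, b =
    - ip f g. *)
Lemma ip_sqr_le f g : f \in L2 -> g \in L2 -> ip f g ^+ 2 <= nrm2 f * nrm2 g.
Proof.
move=> f2 g2; have H a b : 0 <= a ^+ 2 * nrm2 f + 2 * a * b * ip f g + b ^+ 2 * nrm2 g.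
  by rewrite -nrm2_lin// nrm2_ge0.
have [g0|g0] := eqVneq (nrm2 g) 0; last first.
  have gp : 0 < nrm2 g by rewrite lt_neqAle eq_sym g0 nrm2_ge0.
  have := H (nrm2 g) (- ip f g).
  rewrite (_ : _ + _ = nrm2 g * (nrm2 f * nrm2 g - ip f g ^+ 2)); last by ring.
  by rewrite pmulr_rge0// subr_ge0.
rewrite g0 mulr0; have [->|i0] := eqVneq (ip f g) 0; first by rewrite expr0n.
(* With nrm2 g = 0 the form is affine in [b]; if the scalar product were nonzero, this [b] would
   give it the value -1. *)
have := H 1 (- (nrm2 f + 1) / (2 * ip f g)).
rewrite g0 (_ : _ + _ = -1); last by field.
lra.
Qed.

(** Young's inequality with a free weight; it plays the part of the triangle inequality when squared
    norms are estimated. *)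
Lemma ler_ip_nrm2 f g (k : R) : f \in L2 -> g \in L2 -> 0 < k ->
  `|2 * ip f g| <= k * nrm2 f + k^-1 * nrm2 g.
Proof.
move=> f2 g2 k0; have k1 : k * k^-1 = 1 by rewrite divff// gt_eqF.
have ki : 0 < k^-1 by rewrite invr_gt0.
have nf := nrm2_ge0 f; have ng := nrm2_ge0 g.
rewrite -ler_sqr ?nnegrE//; last by rewrite addr_ge0// mulr_ge0// ltW.
rewrite real_normK ?num_real//.
have := ip_sqr_le f2 g2; have := sqr_ge0 (k * nrm2 f - k^-1 * nrm2 g).
have -> : (k * nrm2 f - k^-1 * nrm2 g) ^+ 2 =
  (k * nrm2 f + k^-1 * nrm2 g) ^+ 2 - 4 * (k * k^-1) * (nrm2 f * nrm2 g) by ring.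
rewrite k1; nra.
Qed.

Lemma Lnorm2 f : f \in L2 -> ('N[mu]_2%:E[EFin \o f] = (Num.sqrt (nrm2 f))%:E)%E.
Proof.
move=> f2; rewrite unlock/=.
under eq_integral do rewrite powR2.
by rewrite -nrm2_EFin// poweR_EFin -powR12_sqrt// nrm2_ge0.
Qed.

End square_integrable.

Lemma limn_einf_ge0 (R : realType) (u : nat -> \bar R) :
  (forall n, 0 <= u n)%E -> (0 <= limn_einf u)%E.
Proof.
move=> u0; rewrite limn_einf_lim; apply: lime_ge; first exact: is_cvg_einfs.
by apply: nearW => n; apply: le_ereal_inf_tmp => _ [k _ <-].
Qed.

(** * Completeness of L2 and continuity of norms and scalar products *)

Section L2_complete.
Context {d : measure_display} {T : measurableType d} {R : realType}.
Variable mu : {measure set T -> \bar R}.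

Local Notation L2 := (Lfun mu 2%:E).

(** The squared increments a_k^2 are weighted by 2^k: their integrals are then bounded by a
    geometric series of ratio 1/2, so the weighted sum is finite a.e., and |a_k| <= 2^k a_k^2 + 2^-k
    gives absolute convergence of the increments. *)
Lemma ae_cvg_of_fast_cauchy (g : nat -> T -> R) :
  (forall k, g k \in L2) ->
  (forall k, nrm2 mu (fun x => g k.+1 x - g k x) <= (4^-1) ^+ k) ->
  {ae mu, forall x, cvgn (fun k => g k x)}.
Proof.
move=> g2 gq; pose u k x := (2 ^+ k * (g k.+1 x - g k x) ^+ 2)%:E.
have u0 k x : (0 <= u k x)%E.
  by rewrite lee_fin mulr_ge0 ?sqr_ge0 ?exprn_ge0.
have gB k := L2B (g2 k.+1) (g2 k).
have mu_ k : measurable_fun setT (u k).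
  apply/measurable_EFinP; apply: measurable_funM => //; apply: measurable_funX.
  exact: L2_measurable (gB k).
have Su : (\int[mu]_x \sum_(k <oo) u k x < +oo)%E.
  rewrite integral_nneseries//.
  apply: (@le_lt_trans _ _ (\sum_(k <oo) (2 / (2 ^ (k + 1))%:R)%:E)%E); last first.
    have := @cvg_geometric_eseries_half R 2 0.
    by move=> /cvg_lim; rewrite /eseries /= => -> //; rewrite ltry.
  apply: lee_nneseries => [k _ _|k _]; first exact: integral_ge0.
  rewrite /u; under eq_integral do rewrite EFinM.
  rewrite ge0_integralZl_EFin//; last 2 first.
    by move=> x _; rewrite lee_fin sqr_ge0.
    by apply/measurable_EFinP/measurable_funX; exact: L2_measurable (gB k).
  rewrite -nrm2_EFin// -EFinM lee_fin.
  apply: (@le_trans _ _ (2 ^+ k * 4^-1 ^+ k)); first by rewrite ler_wpM2l ?exprn_ge0.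
  rewrite -exprMn natrX addn1 exprS invfM mulrA divff// mul1r -exprVn.
  by rewrite (_ : 2 * 4^-1 = 2^-1 :> R)//; field.
have iS : mu.-integrable setT (fun x => \sum_(k <oo) u k x)%E.
  apply/integrableP; split; first exact: ge0_emeasurable_sum.
  by under eq_integral do rewrite gee0_abs ?nneseries_ge0//.
have := integrable_ae measurableT iS.
apply: filterS => x /(_ Logic.I) Sfin.
pose a k := g k.+1 x - g k x.
have -> : (fun k => g k x) = (fun k => g 0%N x + series a k).
  apply/funext => k; rewrite (_ : a = telescope (fun k => g k x))//.
  by rewrite telescopeK/= addrC subrK.
apply: is_cvgD; first exact: is_cvg_cst.
apply: normed_cvg; apply: nondecreasing_is_cvgn.
  by apply: nondecreasing_series => n _ _; rewrite normr_ge0.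
exists (fine (\sum_(k <oo) u k x)%E + 2) => _ [n _ <-].
apply: (@le_trans _ _ (\sum_(0 <= k < n) (2 ^+ k * a k ^+ 2) + \sum_(0 <= k < n) 2^-1 ^+ k)).
  rewrite -big_split/=; apply: ler_sum => k _.
  have p0 : 0 < 2 ^+ k :> R by rewrite exprn_gt0.
  rewrite exprVn -(ler_pM2l p0) mulrDr divff ?gt_eqF// mulrA -expr2.
  have -> : 2 ^+ k ^+ 2 * a k ^+ 2 = (2 ^+ k * `|a k|) ^+ 2.
    by rewrite exprMn real_normK ?num_real.
  set z := _ * `|_|; have : 0 <= z by rewrite mulr_ge0// ltW.
  by have := sqr_ge0 (z - 1); nra.
apply: lerD.
  rewrite -lee_fin fineK// -sumEFin.
  exact: (@nneseries_lim_ge _ (fun k => u k x) xpredT 0 n).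
have := @geometric_le_lim R n 1 2^-1 ler01.
rewrite invr_gt0 ltr0n ger0_norm ?invr_ge0// => /(_ isT).
rewrite (_ : 1 * (1 - 2^-1)^-1 = 2 :> R); last by field.
move=> /(_ ltac:(lra)); apply: le_trans; rewrite /series/=.
by apply: ler_sum => k _; rewrite mul1r.
Qed.

(** Riesz-Fischer. A fast subsequence converges a.e.; its upper limit is a measurable representative
    of the limit, to which Fatou's lemma carries the Cauchy estimate. *)
Lemma L2_complete (f : nat -> T -> R) : (forall n, f n \in L2) ->
  (forall e, 0 < e -> exists N, forall n m, (N <= n)%N -> (N <= m)%N ->
     nrm2 mu (fun x => f n x - f m x) <= e) ->
  exists2 F, F \in L2 & nrm2 mu (fun x => f n x - F x) @[n --> \oo] --> 0.
Proof.
move=> f2 fC.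
have /choice[phi phiP] : forall k, exists N, forall n m,
    (N <= n)%N -> (N <= m)%N ->
    nrm2 mu (fun x => f n x - f m x) <= (4^-1) ^+ k.
  by move=> k; apply: fC; rewrite exprn_gt0// invr_gt0.
(* The summand [k] makes [psi] tend to infinity; the partial sums keep it above [phi]. *)
pose psi k := (k + \sum_(i < k.+1) phi i)%N.
have phipsi k : (phi k <= psi k)%N by rewrite /psi big_ord_recr/= addnA leq_addl.
have psiS k : (psi k <= psi k.+1)%N by rewrite /psi [in leqRHS]big_ord_recr/= leq_add// leq_addr.
pose g k := f (psi k).
have cg : {ae mu, forall x, cvgn (fun k => g k x)}.
  apply: ae_cvg_of_fast_cauchy => [k|k]; first exact: f2.
  by apply: phiP => //; rewrite (leq_trans (phipsi k)).
pose F x := fine (limn_esup (fun k => (g k x)%:E)).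
have mf n := L2_measurable (f2 n).
have mF : measurable_fun setT F.
  apply: measurableT_comp => //; apply: measurable_fun_limn_esup => k.
  by apply/measurable_EFinP; exact: mf.
have FE : {ae mu, forall x, (fun k => g k x) @ \oo --> F x}.
  apply: filterS cg => x /cvg_ex[l gl].
  rewrite /F (cvg_limn_einf_sup (_ : _ @ \oo --> l%:E)).2//.
  by apply: cvg_EFin => //; exact: nearW.
have bnd e : 0 < e -> exists N, forall n, (N <= n)%N ->
    (\int[mu]_x ((f n x - F x) ^+ 2)%:E <= e%:E)%E.
  move=> e0; have [N NP] := fC e e0; exists N => n Nn.
  apply: (@le_trans _ _
      (\int[mu]_x limn_einf (fun k => ((f n x - g k x) ^+ 2)%:E))%E).
    apply: ae_ge0_le_integral => //.
    - by move=> x _; rewrite lee_fin sqr_ge0.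
    - by apply/measurable_EFinP/measurable_funX/measurable_funB.
    - move=> x _; apply: limn_einf_ge0 => k.
      by rewrite lee_fin sqr_ge0.
    - rewrite /limn_einf; apply: measurableT_comp => //; apply: measurable_fun_limn_esup => k.
      apply: measurableT_comp => //.
      by apply/measurable_EFinP/measurable_funX/measurable_funB => //; exact: mf.
    - apply: filterS FE => x gF _.
      rewrite (cvg_limn_einf_sup (_ : _ @ \oo --> ((f n x - F x) ^+ 2)%:E)).1//.
      apply: cvg_EFin; first exact: nearW.
      by apply: cvgM; apply: cvgB => //; exact: cvg_cst.
  apply: le_trans (fatou _ _ _ _) _ => //.
  - move=> k; apply/measurable_EFinP/measurable_funX/measurable_funB => //.
    exact: mf.
  - by move=> k x _; rewrite lee_fin sqr_ge0.
  rewrite limn_einf_lim; apply: lime_le; first exact: is_cvg_einfs.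
  apply: nearW => k; apply: ge_ereal_inf => /=.
  have kN : (N <= psi (maxn k N))%N.
    by rewrite (leq_trans (leq_maxr k N))// leq_addr.
  eexists; first by exists (maxn k N); [rewrite /= leq_maxl|reflexivity].
  rewrite -nrm2_EFin ?lee_fin; last by apply: L2B; exact: f2.
  exact: NP.
have BL2 n e : (\int[mu]_x ((f n x - F x) ^+ 2)%:E <= e%:E)%E ->
    (fun x => f n x - F x) \in L2.
  move=> fFe; apply/L2P; split; first exact: measurable_funB.
  by rewrite (le_lt_trans fFe)// ltry.
have F2 : F \in L2.
  have [N /(_ N (leqnn _)) /BL2 FN2] := bnd 1 ltr01.
  rewrite (_ : F = fun x => f N x - (f N x - F x)); first exact: L2B.
  by apply/funext => x; rewrite subKr.
exists F => //; apply/cvgrPdist_le => e e0.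
have [N NP] := bnd e e0; exists N => // n /= Nn.
rewrite sub0r normrN ger0_norm ?nrm2_ge0// -lee_fin nrm2_EFin; first exact: NP.
exact: L2B.
Qed.

Lemma cvg_nrm2 (f : nat -> T -> R) F : (forall n, f n \in L2) -> F \in L2 ->
  nrm2 mu (fun x => f n x - F x) @[n --> \oo] --> 0 ->
  nrm2 mu (f n) @[n --> \oo] --> nrm2 mu F.
Proof.
move=> f2 F2 fF; apply/cvgrPdist_le => e e0.
pose k := e / (2 * (nrm2 mu F + 1)).
have nF : 0 <= nrm2 mu F := nrm2_ge0 _ _.
have k0 : 0 < k by rewrite divr_gt0// mulr_gt0// ltr_wpDl.
have d0 : 0 < e / (2 * (1 + k^-1)).
  by rewrite divr_gt0// mulr_gt0// addr_gt0// invr_gt0.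
move/cvgrPdist_le : fF => /(_ _ d0); apply: filterS => n.
rewrite sub0r normrN ger0_norm ?nrm2_ge0// => H.
have B2 := L2B (f2 n) F2.
have -> : f n = fun x => F x + (f n x - F x) by apply/funext => x; rewrite subrKC.
rewrite nrm2D//; set q := nrm2 mu (fun x => _) in H *.
have q0 : 0 <= q := nrm2_ge0 _ _.
have := ler_ip_nrm2 F2 B2 k0; rewrite -/q => I.
have -> : nrm2 mu F - (nrm2 mu F + 2 * ip mu F (fun x => f n x - F x) + q) =
  - (2 * ip mu F (fun x => f n x - F x)) - q by ring.
rewrite (le_trans (ler_normB _ _))// normrN (ger0_norm q0).
have : (1 + k^-1) * q <= e / 2.
  have p0 : 0 < 1 + k^-1 by rewrite addr_gt0// invr_gt0.
  move: H; rewrite ler_pdivlMr ?mulr_gt0//; set p := 1 + _; lra.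
have : k * nrm2 mu F <= e / 2.
  rewrite /k invfM mulrA -mulrA ler_piMr//; first by rewrite divr_ge0// ltW.
  by rewrite mulrC ler_pdivrMr ?mul1r ?lerDl// ltr_wpDl.
rewrite mulrDl mul1r; lra.
Qed.

(** By polarization a scalar product is a combination of three squared norms, whose convergence is
    [cvg_nrm2]. *)
Lemma cvg_ip (f : nat -> T -> R) F h : (forall n, f n \in L2) -> F \in L2 ->
  h \in L2 ->
  nrm2 mu (fun x => f n x - F x) @[n --> \oo] --> 0 ->
  ip mu (f n) h @[n --> \oo] --> ip mu F h.
Proof.
move=> f2 F2 h2 fF.
have H : nrm2 mu (fun x => (f n x + h x) - (F x + h x)) @[n --> \oo] --> 0.
  apply: cvg_trans fF; apply: near_eq_cvg; apply: nearW => n.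
  by congr nrm2; apply/funext => x; rewrite opprD addrACA subrr addr0.
have C1 := cvg_nrm2 (fun n => L2D (f2 n) h2) (L2D F2 h2) H.
have C2 := cvg_nrm2 f2 F2 fF.
have E g : g \in L2 ->
    2^-1 * (nrm2 mu (fun x => g x + h x) - nrm2 mu g - nrm2 mu h) = ip mu g h.
  by move=> g2; rewrite nrm2D//; field.
rewrite -(E F)//; under eq_cvg do rewrite -E//.
apply: cvgM; first exact: cvg_cst.
by apply: cvgB; [exact: cvgB|exact: cvg_cst].
Qed.

Lemma L2_cvg_weak (f : nat -> T -> R) F : (forall n, f n \in L2) -> F \in L2 ->
  nrm2 mu (fun x => f n x - F x) @[n --> \oo] --> 0 ->
  forall h, h \in L2 ->
  (\int[mu]_x (f n x * h x)%:E @[n --> \oo] --> \int[mu]_x (F x * h x)%:E)%E.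
Proof.
move=> f2 F2 fF h h2; rewrite -ip_EFin//.
under eq_fun do rewrite -ip_EFin//.
by apply: cvg_EFin; [exact: nearW|exact: cvg_ip].
Qed.

End L2_complete.

(** * Local slopes and minimal relaxed gradients *)

Section local_slope.
Context {R : realType} {X : completeMetricType R}.
Implicit Types (f g u v chi : X -> R) (x y : X).

(** The epsilon-delta form of [lip f x <= a]. Local estimates are made on it, away from the upper
    limit and the [fine] in [lip]; for Lipschitz [f] the two agree by [lip_slope_bound] and
    [lip_le]. *)
Definition slope_bound f (a : R) x := forall e, 0 < e -> exists2 dl, 0 < dl &
  forall y, mdist x y < dl -> `|f y - f x| <= (a + e) * mdist x y.

Lemma limf_esup_slope_ge0 f x :
  (0 <= limf_esup (fun y : X => (`|f y - f x| / mdist x y)%:E) (nbhs x))%E.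
Proof.
apply: le_ereal_inf_tmp => _ [V Vx <-]; apply: ereal_sup_ubound => /=.
exists x; first exact: nbhs_singleton.
by rewrite subrr normr0 mul0r.
Qed.

Lemma lip_ge0 f x : 0 <= lip f x.
Proof. by rewrite fine_ge0// limf_esup_slope_ge0. Qed.

Lemma limf_esup_slope_le f (a : R) x : 0 <= a -> slope_bound f a x ->
  (limf_esup (fun y : X => (`|f y - f x| / mdist x y)%:E) (nbhs x) <= a%:E)%E.
Proof.
move=> a0 fa; apply/lee_addgt0Pr => e e0; have [dl dl0 H] := fa e e0.
apply: ge_ereal_inf; exists (ereal_sup [set (`|f y - f x| / mdist x y)%:E | y in ball x dl]).
  by exists (ball x dl) => //; exact: nbhsx_ballx.
apply: ge_ereal_sup => _ [y xy <-]; rewrite -EFinD lee_fin.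
rewrite ballEmdist/= in xy.
have [->|yx] := eqVneq x y.
  by rewrite subrr normr0 mul0r addr_ge0// ltW.
by rewrite ler_pdivrMr ?mdist_gt0//; exact: H.
Qed.

Lemma lip_le f (a : R) x : 0 <= a -> slope_bound f a x -> lip f x <= a.
Proof.
move=> a0 fa; have := limf_esup_slope_le a0 fa.
have := limf_esup_slope_ge0 f x; rewrite /lip.
by case: limf_esup => //= r; rewrite !lee_fin.
Qed.

Lemma lipschitz_slope_bound f (L : R) x :
  (forall y, `|f y - f x| <= L * mdist x y) -> slope_bound f L x.
Proof.
move=> fL e e0; exists 1 => // y _; rewrite (le_trans (fL y))//.
by rewrite ler_wpM2r ?mdist_ge0// lerDl ltW.
Qed.

Lemma lipschitz_funP f : lipschitz_fun f <->
  exists2 L, 0 < L & forall x y, `|f y - f x| <= L * mdist x y.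
Proof.
split=> [[L fL]|[L L0 fL]]; last by exists L => x y; rewrite metric_sym.
exists (`|L| + 1) => [|x y]; first by rewrite ltr_wpDl.
rewrite metric_sym (le_trans (fL y x))// ler_wpM2r ?mdist_ge0//.
by rewrite (le_trans (ler_norm _))// lerDl.
Qed.

Lemma lip_slope_bound f x : lipschitz_fun f -> slope_bound f (lip f x) x.
Proof.
move=> /lipschitz_funP[L L0 fL] e e0.
have sL : (limf_esup (fun y : X => (`|f y - f x| / mdist x y)%:E) (nbhs x) <= L%:E)%E.
  by apply: limf_esup_slope_le; [exact: ltW|exact: lipschitz_slope_bound].
have s0 := limf_esup_slope_ge0 f x.
have sE : (lip f x)%:E = limf_esup (fun y : X => (`|f y - f x| / mdist x y)%:E) (nbhs x).
  by rewrite /lip fineK// ge0_fin_numE// (le_lt_trans sL)// ltry.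
have : (limf_esup (fun y : X => (`|f y - f x| / mdist x y)%:E) (nbhs x) <
    (lip f x + e)%:E)%E by rewrite -sE lte_fin ltrDl.
move=> /ereal_inf_lt[_ [V /nbhs_ballP[dl /= dl0 xV] <-]] Ve.
exists dl => // y xy; have [<-|yx] := eqVneq x y.
  by rewrite subrr normr0 mdistxx mulr0.
rewrite -ler_pdivrMr ?mdist_gt0// -lee_fin ltW// (le_lt_trans _ Ve)//.
apply: ereal_sup_ubound; exists y => //; apply: xV.
by rewrite ballEmdist.
Qed.

Lemma lip_le_lipschitz f (L : R) x : 0 <= L ->
  (forall x y, `|f y - f x| <= L * mdist x y) -> lip f x <= L.
Proof. by move=> L0 fL; apply: lip_le => //; exact: lipschitz_slope_bound. Qed.

Lemma slope_bound_lin f g (s t a b : R) x : slope_bound f a x ->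
  slope_bound g b x ->
  slope_bound (fun y => s * f y + t * g y) (`|s| * a + `|t| * b) x.
Proof.
move=> fa gb e e0; pose k := `|s| + `|t| + 1.
have k0 : 0 < k by rewrite ltr_wpDl// addr_ge0.
have ek0 : 0 < e / k by rewrite divr_gt0.
have [d1 d10 H1] := fa _ ek0; have [d2 d20 H2] := gb _ ek0.
exists (Num.min d1 d2) => [|y]; first by rewrite lt_min d10.
rewrite lt_min => /andP[/H1 {}H1 /H2 {}H2].
rewrite (_ : _ - _ = s * (f y - f x) + t * (g y - g x)); last by ring.
rewrite (le_trans (ler_normD _ _))// !normrM.
apply: (@le_trans _ _ (`|s| * ((a + e / k) * mdist x y) +
    `|t| * ((b + e / k) * mdist x y))); first by rewrite lerD// ler_wpM2l.
rewrite !mulrA -mulrDl ler_wpM2r ?mdist_ge0//.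
have : (`|s| + `|t|) * (e / k) <= e.
  by rewrite mulrCA ler_piMr ?(ltW e0)// ler_pdivrMr// mul1r lerDl.
rewrite mulrDl; lra.
Qed.

Lemma lipschitz_lin f g (s t : R) : lipschitz_fun f -> lipschitz_fun g ->
  lipschitz_fun (fun y => s * f y + t * g y).
Proof.
move=> /lipschitz_funP[L L0 fL] /lipschitz_funP[K K0 gK].
exists (`|s| * L + `|t| * K) => x y.
rewrite (_ : _ - _ = s * (f x - f y) + t * (g x - g y)); last by ring.
rewrite (le_trans (ler_normD _ _))// !normrM metric_sym mulrDl -!mulrA.
by rewrite lerD// ler_wpM2l.
Qed.

Lemma lip_lin f g (s t : R) x : lipschitz_fun f -> lipschitz_fun g ->
  lip (fun y => s * f y + t * g y) x <= `|s| * lip f x + `|t| * lip g x.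
Proof.
move=> fL gL; apply: lip_le; first by rewrite addr_ge0// mulr_ge0 ?lip_ge0.
by apply: slope_bound_lin; exact: lip_slope_bound.
Qed.

(* [w y - w x] is [chi y (v y - v x) + (1 - chi y) (u y - u x)
   + (chi y - chi x) (v x - u x)], and [chi y] tends to [chi x]. *)
Lemma lip_cutoff chi u v x : lipschitz_fun chi -> lipschitz_fun u ->
  lipschitz_fun v -> (forall y, 0 <= chi y <= 1) ->
  lip (fun y => chi y * v y + (1 - chi y) * u y) x <=
  chi x * lip v x + (1 - chi x) * lip u x + lip chi x * `|v x - u x|.
Proof.
move=> cL uL vL c01.
have c0 y : 0 <= chi y by have /andP[] := c01 y.
have c1 y : 0 <= 1 - chi y by have /andP[] := c01 y; rewrite subr_ge0.
have lv0 := lip_ge0 v x; have lu0 := lip_ge0 u x; have lc0 := lip_ge0 chi x.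
apply: lip_le; first by rewrite !addr_ge0// mulr_ge0.
move=> e' e'0; have /lipschitz_funP[L L0 cL'] := cL.
pose D := `|v x - u x|; have D0 : 0 <= D by exact: normr_ge0.
pose e := e' / (2 * (1 + D)).
have e0 : 0 < e by rewrite divr_gt0// mulr_gt0// ltr_pwDl.
have ee : 2 * (e * (1 + D)) = e' by rewrite /e; field; apply/eqP; lra.
have [d1 d10 H1] := lip_slope_bound x vL e0.
have [d2 d20 H2] := lip_slope_bound x uL e0.
have [d3 d30 H3] := lip_slope_bound x cL e0.
pose q := L * (lip v x + lip u x + 2 * e) + 1.
have q0 : 0 < q by rewrite ltr_wpDl// mulr_ge0 ?(ltW L0)//; lra.
exists (Num.min (Num.min d1 d2) (Num.min d3 (e' / (2 * q)))).
  by rewrite !lt_min d10 d20 d30 divr_gt0// mulr_gt0.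
move=> y; rewrite !lt_min => /andP[/andP[/H1 {}H1 /H2 {}H2] /andP[/H3 {}H3 yq]].
rewrite (_ : _ - _ = chi y * (v y - v x) + (1 - chi y) * (u y - u x)
   + (chi y - chi x) * (v x - u x)); last by ring.
set r := mdist x y in H1 H2 H3 yq *; have r0 : 0 <= r := mdist_ge0 _ _.
have cyx : `|chi y - chi x| <= L * r by exact: cL'.
have /andP[cy1 cy2] : (chi x - L * r <= chi y) && (chi y <= chi x + L * r).
  by move: cyx; rewrite ler_norml; lra.
apply: (@le_trans _ _ (chi y * ((lip v x + e) * r) + (1 - chi y) * ((lip u x + e) * r) +
   (lip chi x + e) * r * D)).
  rewrite (le_trans (ler_normD _ _))// lerD//; last first.
    by rewrite normrM ler_wpM2r.
  rewrite (le_trans (ler_normD _ _))// !normrM (ger0_norm (c0 y)) (ger0_norm (c1 y)).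
  by rewrite lerD// ler_wpM2l.
have -> : chi y * ((lip v x + e) * r) + (1 - chi y) * ((lip u x + e) * r) +
   (lip chi x + e) * r * D = (chi y * (lip v x + e) + (1 - chi y) * (lip u x + e) +
   (lip chi x + e) * D) * r by ring.
rewrite ler_wpM2r//.
apply: (@le_trans _ _ ((chi x + L * r) * (lip v x + e) + (1 - chi x + L * r) * (lip u x + e) +
   (lip chi x + e) * D)).
  by rewrite lerD2r lerD// ler_wpM2r//; lra.
have rq : r * (L * (lip v x + lip u x + 2 * e)) <= e' / 2.
  move: yq; rewrite ltr_pdivlMr ?mulr_gt0// => yq.
  have : r * (L * (lip v x + lip u x + 2 * e)) <= r * q by rewrite ler_wpM2l// /q lerDl.
  lra.
have -> : (chi x + L * r) * (lip v x + e) + (1 - chi x + L * r) * (lip u x + e) +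
   (lip chi x + e) * D = chi x * lip v x + (1 - chi x) * lip u x + lip chi x * D +
   (e * (1 + D) + r * (L * (lip v x + lip u x + 2 * e))) by ring.
by rewrite lerD2l; lra.
Qed.

(** The difference v - u may be unbounded, but it is bounded on the ball of radius [A] that carries
    [chi], which makes its product with [chi] Lipschitz. *)
Lemma lipschitz_cutoff chi u v (x0 : X) (A : R) : lipschitz_fun chi ->
  lipschitz_fun u -> lipschitz_fun v -> (forall y, 0 <= chi y <= 1) ->
  (forall y, chi y != 0 -> mdist x0 y <= A) ->
  lipschitz_fun (fun y => chi y * v y + (1 - chi y) * u y).
Proof.
move=> /lipschitz_funP[L L0 cL] uL vL c01 cA.
have /lipschitz_funP[K K0 DK] := lipschitz_lin 1 (-1) vL uL.
pose D y := v y - u y.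
have {}DK x y : `|D y - D x| <= K * mdist x y.
  by have := DK x y; rewrite /D !mul1r !mulN1r.
have cDL : lipschitz_fun (fun y => chi y * D y).
  pose M := `|D x0| + K * `|A|.
  have M0 : 0 <= M by rewrite addr_ge0// mulr_ge0// ltW.
  have DM y : chi y != 0 -> `|D y| <= M.
    move=> /cA yA; rewrite -(subrK (D x0) (D y)) (le_trans (ler_normD _ _))//.
    rewrite addrC lerD2l (le_trans (DK _ _))// ler_pM2l//.
    by rewrite (le_trans yA)// ler_norm.
  exists (K + L * M) => x y.
  (* The increment of the product is then arranged so that the factor [D] is evaluated at [x] only,
     where [chi] does not vanish and [D] is bounded. *)
  wlog cx0 : x y / chi x != 0.
    move=> H; have [cx|] := eqVneq (chi x) 0; last exact: H.
    have [cy|cy] := eqVneq (chi y) 0; last first.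
      by rewrite distrC metric_sym; exact: H.
    rewrite cx cy !mul0r subrr normr0 mulr_ge0 ?mdist_ge0//.
    by rewrite addr_ge0 ?(ltW K0)// mulr_ge0// ltW.
  rewrite (_ : _ - _ = chi y * (D x - D y) + (chi x - chi y) * D x); last by ring.
  rewrite (le_trans (ler_normD _ _))// !normrM mulrDl lerD//.
    have /andP[cy0 cy1] := c01 y.
    rewrite ger0_norm// -[leRHS]mul1r ler_pM// distrC; exact: DK.
  rewrite -mulrA [in leRHS](mulrC M) mulrA ler_pM//; last exact: DM.
  by rewrite distrC; exact: cL.
have := lipschitz_lin 1 1 cDL uL.
by congr lipschitz_fun; apply/funext => y; rewrite /D; ring.
Qed.

Lemma open_slope_gt f (a r : R) : lipschitz_fun f -> 0 <= a ->
  open [set x : X | exists2 y, mdist x y < r & a * mdist x y < `|f y - f x|].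
Proof.
move=> /lipschitz_funP[L L0 fL] a0; rewrite openE => x /= [y yr ya].
apply/nbhs_ballP.
pose dl := Num.min (r - mdist x y) ((`|f y - f x| - a * mdist x y) / (L + a)).
exists dl; first by rewrite /= lt_min subr_gt0 yr divr_gt0 ?subr_gt0// ltr_pwDl.
move=> z; rewrite ballEmdist/= lt_min => /andP[z1].
rewrite ltr_pdivlMr => [z2|]; last by lra.
have tr : mdist z y <= mdist x z + mdist x y.
  by rewrite (metric_sym x z); exact: metric_triangle.
exists y; first by rewrite (le_lt_trans tr)//; lra.
have fzx := fL x z.
have : `|f y - f x| <= `|f y - f z| + `|f z - f x|.
  by rewrite -{1}(subrK (f z) (f y)) -addrA ler_normD.
have : a * mdist z y <= a * mdist x z + a * mdist x y by rewrite -mulrDr ler_wpM2l.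
by rewrite mulrC mulrDl in z2; lra.
Qed.

(** The slope at x is less than c iff, for some n and k, all difference quotients at distance less
    than 1/(n+1) are at most c - 1/(k+1), with c - 1/(k+1) nonnegative; the negation of the bound on
    the quotients is an open condition on x. *)
Lemma measurable_lip f : lipschitz_fun f ->
  measurable_fun [set: borel X] (lip f : borel X -> R).
Proof.
move=> fL; apply: (measurability _ (RGenInftyO.measurableE R)) => _ [_ [c ->] <-].
rewrite setTI.
pose B n k : set (borel X) := if 0 <= c - k.+1%:R^-1 then
  ~` [set x : X | exists2 y, mdist x y < n.+1%:R^-1 &
      (c - k.+1%:R^-1) * mdist x y < `|f y - f x|] else set0.
suff -> : lip f @^-1` `]-oo, c[%classic = \bigcup_n \bigcup_k B n k.
  apply: bigcup_measurable => n _; apply: bigcup_measurable => k _.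
  rewrite /B; case: ifPn => [a0|_] //.
  by apply: measurableC; apply: sub_sigma_algebra; exact: open_slope_gt.
apply/seteqP; split => [x /=|x [n _ [k _]]].
  rewrite in_itv/= => fc.
  have cf0 : 0 < (c - lip f x) / 2 by rewrite divr_gt0// subr_gt0.
  have [dl dl0 H] := lip_slope_bound x fL cf0.
  have [n nd] : exists n, n.+1%:R^-1 < dl.
    have [n _ /(_ n (leqnn _))] := near_infty_natSinv_lt (PosNum dl0).
    by exists n.
  have [k kd] : exists k, k.+1%:R^-1 < (c - lip f x) / 2.
    have [k _ /(_ k (leqnn _))] := near_infty_natSinv_lt (PosNum cf0).
    by exists k.
  exists n => //; exists k => //; rewrite /B; have f0 := lip_ge0 f x.
  rewrite ifT; last by move: kd; set k' := _^-1; lra.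
  move=> [y yn]; apply/negP; rewrite -leNgt.
  rewrite (le_trans (H y _)) ?(lt_trans yn)// ler_wpM2r ?mdist_ge0//.
  by move: kd; set k' := _^-1; lra.
rewrite /B; case: ifPn => // a0 H /=; rewrite in_itv/=.
have k0 : 0 < k.+1%:R^-1 :> R by rewrite invr_gt0.
apply: (@le_lt_trans _ _ (c - k.+1%:R^-1)); last by rewrite ltrBlDr ltrDl.
apply: lip_le => // e e0; exists n.+1%:R^-1 => [|y yn]; first by rewrite invr_gt0.
rewrite (@le_trans _ _ ((c - k.+1%:R^-1) * mdist x y))//.
  rewrite leNgt; apply/negP => ya; apply: H; by exists y.
by rewrite ler_wpM2r ?mdist_ge0// lerDl ltW.
Qed.

Lemma lipschitz_measurable f : lipschitz_fun f ->
  measurable_fun [set: borel X] (f : borel X -> R).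
Proof.
move=> /lipschitz_funP[L L0 fL].
apply: (measurability _ (RGenInftyO.measurableE R)) => _ [_ [c ->] <-].
rewrite setTI; apply: sub_sigma_algebra; rewrite openE => x /=.
rewrite in_itv/= => xc; apply/nbhs_ballP; exists ((c - f x) / L).
  by rewrite /= divr_gt0// subr_gt0.
move=> y; rewrite ballEmdist/= ltr_pdivlMr// => yc.
rewrite in_itv/=; have := fL x y; rewrite ler_norml => /andP[_].
lra.
Qed.

Lemma lipschitz_mdist (x0 : X) (phi : R -> R) (L : R) : 0 <= L ->
  (forall a b, 0 <= a -> 0 <= b -> `|phi b - phi a| <= L * `|b - a|) ->
  forall x y, `|phi (mdist x0 y) - phi (mdist x0 x)| <= L * mdist x y.
Proof.
move=> L0 phiL x y; rewrite (le_trans (phiL _ _ _ _)) ?mdist_ge0//.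
rewrite ler_wpM2l// ler_norml.
have := metric_triangle x0 x y; have := metric_triangle x0 y x.
by rewrite (metric_sym y x); lra.
Qed.

End local_slope.

(** * First variation of the minimal gradient; locality *)

Section minimal_gradient.
Context {R : realType} {X : completeMetricType R}.
Variable m : borel_measure X R.
Implicit Types (f g u v w chi G H K : X -> R).

Local Notation L2 := (Lfun m 2%:E).
Local Notation ip := (ip m).
Local Notation nrm2 := (nrm2 m).

Lemma cvg_Lnorm2P (f : nat -> X -> R) F : (forall n, f n \in L2) -> F \in L2 ->
  ('N[m]_2%:E[EFin \o (f n \- F)%R]%E @[n --> \oo] --> 0%E) <->
  (nrm2 (fun x => f n x - F x) @[n --> \oo] --> 0).
Proof.
move=> f2 F2; have fF2 n : (fun x => f n x - F x) \in L2 by exact: L2B.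
have E n : 'N[m]_2%:E[EFin \o (f n \- F)%R]%E =
    (Num.sqrt (nrm2 (fun x => f n x - F x)))%:E by exact: (Lnorm2 (fF2 n)).
under eq_cvg do rewrite E; split=> H.
  have H1 : Num.sqrt (nrm2 (fun x => f n x - F x)) @[n --> \oo] --> 0.
    exact: (fine_cvg H).
  pose q n := Num.sqrt (nrm2 (fun x => f n x - F x)).
  have H3 : (fun n => q n * q n) @ \oo --> (0 * 0 : R) by apply: cvgM; exact: H1.
  rewrite mulr0 in H3; apply: cvg_trans H3; apply: near_eq_cvg; apply: nearW => n /=.
  by rewrite /q -expr2 sqr_sqrtr// nrm2_ge0.
apply: cvg_EFin; first exact: nearW.
by rewrite -(sqrtr0 R); apply: continuous_cvg H; exact: sqrt_continuous.
Qed.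

(** For such functions the constant sequence is already a recovery sequence of finite energy. *)
Definition admissible w := [/\ lipschitz_fun w, w \in L2 & lip w \in L2].

Definition approximant (eps : R) u w :=
  admissible w /\ nrm2 (fun x => w x - u x) <= eps.

(** The supremum over positive [eps] is twice the Cheeger energy; fixing [eps] turns the relaxation
    into a convex minimization over slopes. *)
Definition inf_energy eps u := inf [set nrm2 (lip w) | w in approximant eps u].

Lemma approximant_self eps u : 0 <= eps -> admissible u -> approximant eps u u.
Proof.
move=> eps0 ua; split=> //; rewrite (_ : (fun _ => _) = cst 0).
  by rewrite /nrm2 /ip /Rintegral; under eq_integral do rewrite mulr0; rewrite integral0.
by apply/funext => x; rewrite subrr.
Qed.

Lemma approximantS eps eps' u : eps <= eps' ->
  approximant eps u `<=` approximant eps' u.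
Proof. by move=> ee w [wa we]; split=> //; exact: le_trans ee. Qed.

Lemma inf_energy_le eps u w : approximant eps u w ->
  inf_energy eps u <= nrm2 (lip w).
Proof.
move=> uw; apply: ge_inf; last by exists w.
by exists 0 => _ [v _ <-]; exact: nrm2_ge0.
Qed.

Lemma admissible_conv u v (s : R) : admissible u -> admissible v -> 0 <= s <= 1 ->
  admissible (fun x => (1 - s) * u x + s * v x) /\
  forall x, lip (fun x => (1 - s) * u x + s * v x) x <=
            (1 - s) * lip u x + s * lip v x.
Proof.
move=> [uL u2 lu2] [vL v2 lv2] /andP[s0 s1].
have s1' : 0 <= 1 - s by rewrite subr_ge0.
have H x : lip (fun x => (1 - s) * u x + s * v x) x <=
            (1 - s) * lip u x + s * lip v x.
  by have := lip_lin (1 - s) s x uL vL; rewrite !ger0_norm.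
split=> //; split; [exact: lipschitz_lin|exact: L2_lin|].
apply: (L2_le _ (L2_lin (1 - s) s lu2 lv2)).
  by apply: measurable_lip; exact: lipschitz_lin.
move=> x; rewrite ger0_norm ?lip_ge0// (le_trans (H x))// ler_norm//.
Qed.

Lemma approximant_conv eps u w w' (s : R) : u \in L2 ->
  approximant eps u w -> approximant eps u w' -> 0 <= s <= 1 ->
  approximant eps u (fun x => (1 - s) * w x + s * w' x).
Proof.
move=> u2 [wa we] [wa' we'] s01; have [? _] := admissible_conv wa wa' s01.
split=> //; move: s01 => /andP[s0 s1].
have [_ w2 _] := wa; have [_ w2' _] := wa'.
have a2 := L2B w2 u2; have b2 := L2B w2' u2.
rewrite (_ : (fun _ => _) = (fun x => (1 - s) * (w x - u x) + s * (w' x - u x))).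
  rewrite nrm2_lin//; set a := nrm2 _ in we *; set b := nrm2 _ in we' *.
  have := ler_ip_nrm2 a2 b2 ltr01; rewrite -/a -/b invr1 !mul1r ler_norml.
  move=> /andP[_]; set c := ip _ _ => cab.
  have : s * (1 - s) * (2 * c) <= s * (1 - s) * (a + b).
    by rewrite ler_wpM2l// mulr_ge0// subr_ge0.
  have : (1 - s) * a <= (1 - s) * eps by rewrite ler_wpM2l// subr_ge0.
  have : s * b <= s * eps by rewrite ler_wpM2l.
  nra.
by apply/funext => x; ring.
Qed.

(** Parallelogram law: midpoints of near-minimizers are competitors and the slope is convex, so the
    slopes of near-minimizers form a Cauchy sequence. The radii [eps] may be constant or tend to 0;
    both cases are used. *)
Lemma minimizing_sequence (eps : nat -> R) u : admissible u ->
  (forall n, 0 <= eps n) -> (forall n k, (n <= k)%N -> eps k <= eps n) ->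
  exists (w : nat -> X -> R) F, [/\ forall n, approximant (eps n) u (w n),
    forall n, nrm2 (lip (w n)) <= inf_energy (eps n) u + n.+1%:R^-1,
    F \in L2 & nrm2 (fun x => lip (w n) x - F x) @[n --> \oo] --> 0].
Proof.
move=> ua e0 ei; pose I n := inf_energy (eps n) u.
have neI n : [set nrm2 (lip w) | w in approximant (eps n) u] !=set0.
  by exists (nrm2 (lip u)); exists u => //; exact: approximant_self.
have lbI n : has_inf [set nrm2 (lip w) | w in approximant (eps n) u].
  by split=> //; exists 0 => _ [v _ <-]; exact: nrm2_ge0.
have Imono n k : (n <= k)%N -> I n <= I k.
  move=> nk; apply: lb_le_inf => // _ [w wa <-]; apply: inf_energy_le.
  by apply: approximantS wa; exact: ei.
have Iub n : I n <= nrm2 (lip u) by apply: inf_energy_le; exact: approximant_self.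
have /choice[w wP] : forall n, exists w, approximant (eps n) u w /\
    nrm2 (lip w) <= I n + n.+1%:R^-1.
  move=> n; have k0 : 0 < n.+1%:R^-1 :> R by rewrite invr_gt0.
  have [_ [w wa <-] wI] := inf_adherent k0 (lbI n).
  by exists w; split=> //; exact: ltW.
have lw2 n : lip (w n) \in L2 by have [[[]]] := wP n.
have [_ u2 _] := ua.
have mid n k : (n <= k)%N -> nrm2 (fun x => lip (w n) x - lip (w k) x) <=
    2 * (I k - I n) + 4 * n.+1%:R^-1.
  move=> nk; have [wan wIn] := wP n; have [wak wIk] := wP k.
  have wak' := approximantS (ei _ _ nk) wak.
  have h01 : 0 <= (2^-1 : R) <= 1 by lra.
  have wc := approximant_conv u2 wan wak' h01.
  have [_ lwc] := admissible_conv wan.1 wak.1 h01.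
  have lwc2 : lip (fun x => (1 - 2^-1) * w n x + 2^-1 * w k x) \in L2.
    by case: wc => -[].
  have : I n <= nrm2 (fun x => (1 - 2^-1) * lip (w n) x + 2^-1 * lip (w k) x).
    rewrite (le_trans (inf_energy_le wc))// ler_nrm2//; first exact: L2_lin.
    by apply: aeW => x; rewrite lerXn2r ?nnegrE ?lip_ge0// (le_trans _ (lwc x))// lip_ge0.
  rewrite nrm2_lin// nrm2B//.
  have : k.+1%:R^-1 <= n.+1%:R^-1 :> R by rewrite lef_pV2 ?posrE// ler_nat.
  move: wIn wIk; set a := nrm2 _; set b := nrm2 _; set c := ip _ _.
  set kk := k.+1%:R^-1; set nn := n.+1%:R^-1; lra.
have [F F2 wF] : exists2 F, F \in L2 &
    nrm2 (fun x => lip (w n) x - F x) @[n --> \oo] --> 0.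
  apply: L2_complete => // e e0'.
  have hsI : has_sup (range I).
    by split; [exists (I 0%N); exists 0%N|exists (nrm2 (lip u)) => _ [n _ <-]].
  have e4 : 0 < e / 4 by rewrite divr_gt0.
  have [_ [N1 _ <-] N1P] := sup_adherent e4 hsI.
  have e8 : 0 < e / 8 by rewrite divr_gt0.
  have [N2 _ N2P] := near_infty_natSinv_lt (PosNum e8).
  exists (maxn N1 N2) => n k; rewrite !geq_max => /andP[n1 n2] /andP[k1 k2].
  wlog nk : n k n1 n2 k1 k2 / (n <= k)%N.
    move=> Hw; have [nk|/ltnW kn] := leqP n k; first exact: Hw.
    rewrite (_ : nrm2 _ = nrm2 (fun x => lip (w k) x - lip (w n) x)); first exact: Hw.
    by apply: eq_Rintegral => x _; rewrite -(opprB (lip (w k) x)) mulrNN.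
  rewrite (le_trans (mid _ _ nk))//.
  have := N2P n n2; have := Imono _ _ n1.
  have : I k <= sup (range I) by apply: sup_upper_bound => //; exists k.
  by move=> /=; set nn := n.+1%:R^-1; lra.
by exists w, F; split=> // n; have [] := wP n.
Qed.

(** The form in which first-order conditions are extracted: [A] is the derivative at 0 along a
    segment, [s * B] the remainder after division by [s]. *)
Lemma ler_small (A B : R) : (forall s, 0 < s <= 1 -> 0 <= A + s * B) -> 0 <= A.
Proof.
move=> H; rewrite leNgt; apply/negP => A0.
pose s := Num.min 1 (- A / (2 * (`|B| + 1))).
have q0 : 0 < 2 * (`|B| + 1) by rewrite mulr_gt0// ltr_wpDl.
have s0 : 0 < s by rewrite lt_min ltr01 divr_gt0// oppr_gt0.
have := H s; rewrite s0 ge_min lexx => /(_ isT).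
have : s * B <= s * (`|B| + 1).
  by rewrite ler_pM2l// (le_trans (ler_norm _))// lerDl.
have : s <= - A / (2 * (`|B| + 1)) by rewrite ge_min lexx orbT.
rewrite ler_pdivlMr//; lra.
Qed.

(* Mazur's lemma in disguise: the projection [P] of 0 onto the closed convex
   hull of the slopes of [approximant eps u] satisfies [ip P (H n) >= nrm2 P],
   an inequality that passes to weak limits. *)
Lemma inf_energy_le_weak_limit u (w H : nat -> X -> R) K eps : admissible u ->
  0 < eps ->
  (forall n, admissible (w n)) ->
  nrm2 (fun x => w n x - u x) @[n --> \oo] --> 0 ->
  (forall n, H n \in L2) -> (forall n x, lip (w n) x <= H n x) -> K \in L2 ->
  (forall h, h \in L2 -> ip (H n) h @[n --> \oo] --> ip K h) ->
  inf_energy eps u <= nrm2 K.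
Proof.
move=> ua e0 wa wu H2 wH K2 HK; have [_ u2 _] := ua.
have [z [P [za zI P2 zP]]] := @minimizing_sequence (fun=> eps) u ua
  (fun=> ltW e0) (fun _ _ _ => lexx _).
set I := inf_energy eps u in zI *.
have lz2 n : lip (z n) \in L2 by have [[]] := za n.
have zn := cvg_nrm2 lz2 P2 zP.
have PI : nrm2 P = I.
  apply: (cvg_unique _ zn) => //; apply: (@squeeze_cvgr _ _ _ _ (cst I) (fun n => I + n.+1%:R^-1)).
  - by apply: nearW => n; rewrite zI andbT inf_energy_le.
  - exact: cvg_cst.
  - by rewrite -[X in _ --> X]addr0; apply: cvgD; [exact: cvg_cst|exact: cvg_harmonic].
have PH : \forall n \near \oo, I <= ip P (H n).
  move/cvgrPdist_le : wu => /(_ _ e0); apply: filterS => n.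
  rewrite sub0r normrN ger0_norm ?nrm2_ge0// => wn.
  have wan : approximant eps u (w n) by [].
  rewrite -subr_ge0 -(@pmulr_rge0 _ 2)//; apply: (@ler_small _ (I - 2 * ip P (H n) + nrm2 (H n))) => s s01.
  have s01' : 0 <= s <= 1 by lra.
  have s0 : 0 < s by lra.
  have Q j : I <= (1 - s) ^+ 2 * nrm2 (lip (z j)) +
      2 * (1 - s) * s * ip (lip (z j)) (H n) + s ^+ 2 * nrm2 (H n).
    rewrite -nrm2_lin//.
    have wc := approximant_conv u2 (za j) wan s01'.
    have [_ lwc] := admissible_conv (za j).1 wan.1 s01'.
    rewrite (le_trans (inf_energy_le wc))// ler_nrm2//.
    - by case: wc => -[].
    - exact: L2_lin.
    - apply: aeW => x; rewrite lerXn2r ?nnegrE ?lip_ge0//.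
        by rewrite addr_ge0// mulr_ge0 ?subr_ge0 ?lip_ge0//; lra || rewrite (le_trans _ (wH _ _))// lip_ge0.
      rewrite (le_trans (lwc x))// lerD2l ler_wpM2l ?(ltW s0)//; exact: wH.
  have : I <= (1 - s) ^+ 2 * I + 2 * (1 - s) * s * ip P (H n) + s ^+ 2 * nrm2 (H n).
    apply: (@ler_cvg_to _ \oo _ _ (cst I) _ _ _ (cvg_cst _)); last by apply: nearW; exact: Q.
    rewrite -[in X in _ --> X]PI.
    apply: cvgD; last exact: cvg_cst.
    apply: cvgD; apply: cvgM; (try exact: cvg_cst) => //.
    exact: cvg_ip.
  by move=> IQ; rewrite -(pmulr_rge0 _ s0); lra.
have IP : I <= ip P K.
  apply: (@ler_cvg_to _ \oo _ _ (cst I) _ _ _ (cvg_cst _)); last exact: PH.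
  by rewrite ipC; under eq_cvg do rewrite ipC; exact: HK.
have := ler_ip_nrm2 P2 K2 ltr01; rewrite invr1 !mul1r ler_norml => /andP[_].
rewrite PI; lra.
Qed.

(** The new information is that a weak limit of slopes is nonnegative a.e.: tested against its own
    negative part [h], it gives nrm2 h <= 0. Pointwise bounds between gradients can then be
    squared. *)
Lemma relaxed_gradientP u K : u \in L2 -> relaxed_gradient m u K ->
  K \in L2 /\ exists (w : nat -> X -> R) K', [/\ forall n, admissible (w n),
    nrm2 (fun x => w n x - u x) @[n --> \oo] --> 0,
    K' \in L2,
    forall h, h \in L2 -> ip (lip (w n)) h @[n --> \oo] --> ip K' h &
    {ae m, forall x, 0 <= K' x <= K x}].
Proof.
move=> u2 [K2 [w [K' [[wL wu] [lw2 K'2 wK'] K'K]]]]; split=> //.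
exists w, K'; split=> //.
- by move=> n; have [? ?] := wL n; split.
- by apply/cvg_Lnorm2P => // n; have [] := wL n.
- move=> h h2; have := wK' h h2; rewrite -ip_EFin// => H.
  exact: (fine_cvg H).
pose h x := Num.min (K' x) 0.
have mh : measurable_fun [set: borel X] (h : borel X -> R).
  exact: measurable_minr (L2_measurable K'2) (measurable_cst _).
have h2 : h \in L2.
  apply: (L2_le mh K'2) => x; rewrite /h minEle; case: ifPn => // _.
  by rewrite normr0.
have h0 : nrm2 h <= 0.
  rewrite (_ : nrm2 h = ip K' h); last first.
    by apply: eq_Rintegral => x _; rewrite /h minEle; case: ifPn => // _; rewrite !mulr0.
  have wh : ip (lip (w n)) h @[n --> \oo] --> ip K' h.
    have := wK' h h2; rewrite -ip_EFin// => H.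
    exact: (fine_cvg H).
  apply: (@ler_cvg_to _ \oo _ _ _ (cst 0) _ _ wh (cvg_cst _)).
  apply: nearW => n; rewrite -oppr_ge0 /ip -[leRHS]mulN1r -RintegralZl//; last exact: integrable_L2M.
  apply: Rintegral_ge0 => x _; rewrite mulN1r -mulrN mulr_ge0 ?lip_ge0//.
  by rewrite oppr_ge0 /h ge_min lexx orbT.
apply: ae_imp2 K'K (nrm2_eq0 h2 h0) => x K'K; rewrite /h K'K andbT.
by rewrite minEle; case: ifPn => [_ -> //|]; rewrite -ltNge => /ltW.
Qed.

Lemma inf_energy_le_relaxed u K eps : admissible u -> 0 < eps ->
  relaxed_gradient m u K -> inf_energy eps u <= nrm2 K.
Proof.
move=> ua e0 /relaxed_gradientP[|K2]; first by case: ua.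
move=> [w [K' [wa wu K'2 wK' K'K]]].
apply: (@le_trans _ _ (nrm2 K')).
  apply: (@inf_energy_le_weak_limit u w (fun n => lip (w n))) => //.
  by move=> n; have [] := wa n.
apply: ler_nrm2 => //; apply: ae_imp K'K => x /andP[K'0 K'K].
by rewrite lerXn2r// nnegrE// (le_trans K'0).
Qed.

(** The slopes of near-minimizers at squared distance 1/(n+1) from [u] converge strongly, so their
    limit is a relaxed gradient whose norm is controlled by the infimal energies;
    [inf_energy_le_relaxed] shows that no relaxed gradient does better. *)
Lemma relaxed_gradient_exists u : admissible u -> exists2 F,
  relaxed_gradient m u F &
  forall c, (forall eps, 0 < eps -> inf_energy eps u <= c) -> nrm2 F <= c.
Proof.
move=> ua; have [_ u2 _] := ua.
have [||w [F [wa wI F2 wF]]] := @minimizing_sequence (fun n => n.+1%:R^-1) u ua.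
- by move=> n; rewrite invr_ge0.
- by move=> n k nk; rewrite lef_pV2 ?posrE// ler_nat.
have lw2 n : lip (w n) \in L2 by have [[]] := wa n.
have w2 n : w n \in L2 by have [[]] := wa n.
exists F.
  split=> //; exists w, F; split.
  - split; first by move=> n; have [[]] := wa n.
    apply/cvg_Lnorm2P => //.
    apply: (@squeeze_cvgr _ _ _ _ (cst 0) (fun n => n.+1%:R^-1)).
    + by apply: nearW => n; rewrite nrm2_ge0/=; have [] := wa n.
    + exact: cvg_cst.
    + exact: cvg_harmonic.
  - split=> // h h2; exact: (L2_cvg_weak lw2 F2 wF h2).
  - exact: aeW.
move=> c cP.
apply: (@ler_cvg_to _ \oo _ _ _ (fun n => c + n.+1%:R^-1) _ _ (cvg_nrm2 lw2 F2 wF)).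
  by rewrite -[X in _ --> X]addr0; apply: cvgD; [exact: cvg_cst|exact: cvg_harmonic].
apply: nearW => n; rewrite (le_trans (wI n))// lerD2r cP// invr_gt0//.
Qed.

(** The minimum is attained, so [xget] returns a minimal gradient and not its default value. The
    second part is the way to bound the norm from above: it is enough to exhibit competitors near
    [u]. *)
Lemma mgradP u : admissible u -> relaxed_gradient m u (mgrad m u) /\
  forall c, (forall eps, 0 < eps -> inf_energy eps u <= c) -> nrm2 (mgrad m u) <= c.
Proof.
move=> ua; have [_ u2 _] := ua; have [F uF Fc] := relaxed_gradient_exists ua.
have Fle K : relaxed_gradient m u K -> nrm2 F <= nrm2 K.
  by move=> uK; apply: Fc => eps e0; exact: inf_energy_le_relaxed.
have [uG Gmin] : is_minimal_gradient m u (mgrad m u).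
  apply: xgetPex; exists F; split=> // K uK.
  have [K2 _] := relaxed_gradientP u2 uK; have [F2 _] := relaxed_gradientP u2 uF.
  by rewrite !Lnorm2// lee_fin ler_wsqrtr// Fle.
split=> // c cP; apply: le_trans (Fc _ cP).
have [G2 _] := relaxed_gradientP u2 uG; have [F2 _] := relaxed_gradientP u2 uF.
by have := Gmin _ uF; rewrite !Lnorm2// lee_fin ler_sqrt// nrm2_ge0.
Qed.

Lemma mgrad_L2 u : admissible u -> mgrad m u \in L2.
Proof. by move=> ua; have [[]] := mgradP ua. Qed.

Lemma relaxed_gradient_lip u : admissible u -> relaxed_gradient m u (lip u).
Proof.
move=> ua; have [uL u2 lu2] := ua; split=> //; exists (fun=> u), (lip u); split.
- split=> //; apply/cvg_Lnorm2P => //.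
  have [_] := approximant_self (lexx 0) ua => H.
  rewrite (_ : (fun _ => _) = cst 0); first exact: cvg_cst.
  by apply/funext => n; apply/eqP; rewrite eq_le H nrm2_ge0.
- by split=> // h h2; exact: cvg_cst.
- exact: aeW.
Qed.

(* Interpolating recovery sequences of [v] and [u] with a Lipschitz cutoff
   gives a competitor for the minimality of [mgrad m u]. *)
Lemma nrm2_mgrad_le_cutoff u v K chi (x0 : X) (A : R) : admissible u ->
  admissible v -> relaxed_gradient m v K ->
  lipschitz_fun chi -> (forall y, 0 <= chi y <= 1) ->
  (forall y, chi y != 0 -> mdist x0 y <= A) ->
  (forall y, chi y * (v y - u y) = 0) ->
  (forall y, lip chi y * (v y - u y) = 0) ->
  nrm2 (mgrad m u) <= nrm2 (fun x => chi x * K x + (1 - chi x) * mgrad m u x).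
Proof.
move=> ua va vK cL c01 cA cuv lcuv.
have [uG Gc] := mgradP ua; have [uL u2 lu2] := ua; have [vL v2 lv2] := va.
have [G2 [wu [G' [wua wuu G'2 wuG' G'G]]]] := relaxed_gradientP u2 uG.
have [K2 [wv [K' [wva wvv K'2 wvK' K'K]]]] := relaxed_gradientP v2 vK.
have c0 y : 0 <= chi y by have /andP[] := c01 y.
have c1 y : 0 <= 1 - chi y by have /andP[] := c01 y; rewrite subr_ge0.
have cn y : `|chi y| <= 1 by rewrite ger0_norm//; have /andP[] := c01 y.
have cn1 y : `|1 - chi y| <= 1 by rewrite ger0_norm// gerBl.
have mc := lipschitz_measurable cL.
have mc1 : measurable_fun [set: borel X] (fun y : borel X => 1 - chi y).
  exact: measurable_funB.
have [L L0 cLL] := (lipschitz_funP chi).1 cL.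
have lcL y : `|lip chi y| <= L.
  by rewrite ger0_norm ?lip_ge0//; apply: lip_le_lipschitz => //; exact: ltW.
have mlc := measurable_lip cL.
have mix f g : f \in L2 -> g \in L2 -> (fun x => chi x * f x + (1 - chi x) * g x) \in L2.
  by move=> f2 g2; apply: L2D; [exact: L2_bndM mc cn f2|exact: L2_bndM mc1 cn1 g2].
have wu2 n : wu n \in L2 by have [] := wua n.
have wv2 n : wv n \in L2 by have [] := wva n.
have lwu2 n : lip (wu n) \in L2 by have [] := wua n.
have lwv2 n : lip (wv n) \in L2 by have [] := wva n.
pose w n x := chi x * wv n x + (1 - chi x) * wu n x.
pose E n x := lip chi x * `|wv n x - wu n x|.
have E2 n : E n \in L2.
  apply: (L2_bndM mlc lcL); apply: (L2_le _ (L2B (wv2 n) (wu2 n))).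
    by apply: measurableT_comp => //; exact: L2_measurable (L2B (wv2 n) (wu2 n)).
  by move=> x; rewrite normr_id.
pose H n x := (chi x * lip (wv n) x + (1 - chi x) * lip (wu n) x) + E n x.
have H2 n : H n \in L2 by apply: L2D => //; exact: mix.
have wH n x : lip (w n) x <= H n x.
  by apply: lip_cutoff => //; [have [] := wua n|have [] := wva n].
have wL n : lipschitz_fun (w n).
  by apply: (@lipschitz_cutoff _ _ _ _ _ x0 A) => //; [have [] := wua n|have [] := wva n].
have w2 n : w n \in L2 by exact: mix.
have wa n : admissible (w n).
  split=> //; apply: (L2_le _ (H2 n)); first exact: measurable_lip.
  by move=> x; rewrite ger0_norm ?lip_ge0// (le_trans (wH n x))// ler_norm.
have dn2 n : nrm2 (fun x => w n x - u x) <=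
    2 * nrm2 (fun x => wv n x - v x) + 2 * nrm2 (fun x => wu n x - u x).
  have a2 := L2B (wv2 n) v2; have b2 := L2B (wu2 n) u2.
  have ca2 := L2_bndM mc cn a2; have cb2 := L2_bndM mc1 cn1 b2.
  rewrite (_ : (fun x => w n x - u x) = (fun x => chi x * (wv n x - v x) + (1 - chi x) * (wu n x - u x))); last first.
    apply/funext => x; rewrite /w.
    have -> : chi x * wv n x + (1 - chi x) * wu n x - u x =
      chi x * (wv n x - v x) + (1 - chi x) * (wu n x - u x) + chi x * (v x - u x) by ring.
    by rewrite cuv addr0.
  rewrite (nrm2D ca2 cb2).
  have := ler_ip_nrm2 ca2 cb2 ltr01; rewrite invr1 !mul1r ler_norml => /andP[_].
  have : nrm2 (fun x => chi x * (wv n x - v x)) <= nrm2 (fun x => wv n x - v x).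
    apply: ler_nrm2 => //; apply: aeW => x; rewrite exprMn ler_piMl ?sqr_ge0//.
    by rewrite exprn_ile1//; have /andP[] := c01 x.
  have : nrm2 (fun x => (1 - chi x) * (wu n x - u x)) <= nrm2 (fun x => wu n x - u x).
    apply: ler_nrm2 => //; apply: aeW => x; rewrite exprMn ler_piMl ?sqr_ge0//.
    by rewrite exprn_ile1// (le_trans (ler_norm _)).
  lra.
have wu0 : nrm2 (fun x => w n x - u x) @[n --> \oo] --> 0.
  apply: (@squeeze_cvgr _ _ _ _ (cst 0) (fun n => 2 * nrm2 (fun x => wv n x - v x) + 2 * nrm2 (fun x => wu n x - u x))).
  - by apply: nearW => n; rewrite nrm2_ge0 dn2.
  - exact: cvg_cst.
  - rewrite (_ : 0 = 2 * 0 + 2 * 0 :> R); last by ring.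
    by apply: cvgD; apply: cvgM => //; exact: cvg_cst.
have En n : nrm2 (E n) <= L ^+ 2 * (2 * nrm2 (fun x => wv n x - v x) + 2 * nrm2 (fun x => wu n x - u x)).
  have a2 := L2B (wv2 n) v2; have b2 := L2B (wu2 n) u2.
  apply: (@le_trans _ _ (nrm2 (fun x => L * ((wv n x - v x) - (wu n x - u x))))).
    apply: ler_nrm2 => //.
      rewrite (_ : (fun _ => _) =
          (fun x => L * (wv n x - v x) + (- L) * (wu n x - u x))).
        exact: L2_lin.
      by apply/funext => x; ring.
    apply: aeW => x.
    have lc0 := lip_ge0 chi x.
    have -> : E n x = lip chi x * `|wv n x - v x - (wu n x - u x)|.
      rewrite /E; have := lcuv x => /eqP; rewrite mulf_eq0 => /orP[/eqP ->|].
        by rewrite !mul0r.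
      rewrite subr_eq0 => /eqP ->; congr (_ * `| _ |); ring.
    rewrite !exprMn real_normK ?num_real// ler_wpM2r ?sqr_ge0//.
    rewrite lerXn2r ?nnegrE ?(ltW L0)//.
    by have := lcL x; rewrite ger0_norm.
  have -> : (fun x => L * ((wv n x - v x) - (wu n x - u x))) =
      (fun x => L * (wv n x - v x) + (- L) * (wu n x - u x)).
    by apply/funext => x; ring.
  rewrite nrm2_lin//.
  have := ler_ip_nrm2 a2 b2 ltr01; rewrite invr1 !mul1r ler_norml => /andP[+ _].
  set a := nrm2 _; set b := nrm2 _; set c := ip _ _ => abc.
  have : L ^+ 2 * (- (2 * c)) <= L ^+ 2 * (a + b).
    by rewrite ler_wpM2l ?sqr_ge0//; lra.
  lra.
have E0 : nrm2 (E n) @[n --> \oo] --> 0.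
  apply: (@squeeze_cvgr _ _ _ _ (cst 0) (fun n => L ^+ 2 * (2 * nrm2 (fun x => wv n x - v x) + 2 * nrm2 (fun x => wu n x - u x)))).
  - by apply: nearW => n; rewrite nrm2_ge0 En.
  - exact: cvg_cst.
  - rewrite (_ : 0 = L ^+ 2 * (2 * 0 + 2 * 0) :> R); last by ring.
    apply: cvgM; first exact: cvg_cst.
    by apply: cvgD; apply: cvgM => //; exact: cvg_cst.
have O2 : (cst 0 : X -> R) \in L2.
  rewrite (_ : cst 0 = (fun x => 0 * u x + 0 * u x)); first exact: L2_lin.
  by apply/funext => x; rewrite !mul0r addr0.
have EO h : h \in L2 -> ip (E n) h @[n --> \oo] --> 0.
  move=> h2; rewrite (_ : 0 = ip (cst 0) h).
    apply: cvg_ip => //; apply: cvg_trans E0; apply: near_eq_cvg; apply: nearW => n.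
    by congr nrm2; apply/funext => x; rewrite subr0.
  by rewrite /ip /Rintegral; under eq_integral do rewrite mul0r; rewrite integral0.
pose M x := chi x * K' x + (1 - chi x) * G' x.
have M2 : M \in L2 by exact: mix.
have ipmix f g h : f \in L2 -> g \in L2 -> h \in L2 ->
    ip (fun x => chi x * f x + (1 - chi x) * g x) h =
    ip f (fun x => chi x * h x) + ip g (fun x => (1 - chi x) * h x).
  move=> f2 g2 h2; rewrite ipDl//; [|exact: L2_bndM mc cn f2|exact: L2_bndM mc1 cn1 g2].
  by congr (_ + _); apply: eq_Rintegral => x _; ring.
have HM h : h \in L2 -> ip (H n) h @[n --> \oo] --> ip M h.
  move=> h2; rewrite ipmix// -[ip K' _ + _]addr0.
  have F n : ip (H n) h = (ip (lip (wv n)) (fun x => chi x * h x) +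
      ip (lip (wu n)) (fun x => (1 - chi x) * h x)) + ip (E n) h.
    by rewrite /H ipDl ?ipmix//; exact: mix.
  under eq_cvg do rewrite F.
  apply: cvgD; last exact: EO.
  by apply: cvgD; [apply: wvK'; exact: L2_bndM mc cn h2|apply: wuG'; exact: L2_bndM mc1 cn1 h2].
apply: Gc => eps e0.
apply: (@le_trans _ _ (nrm2 M)).
  exact: (@inf_energy_le_weak_limit u w H M eps ua e0 wa wu0 H2 wH M2 HM).
apply: ler_nrm2 => //; first exact: mix.
apply: ae_imp2 K'K G'G => x /andP[k0 k1] /andP[g0 g1].
rewrite lerXn2r// ?nnegrE ?addr_ge0// ?mulr_ge0//.
- exact: le_trans k1.
- exact: le_trans g1.
- by rewrite lerD// ler_wpM2l.
Qed.

(** The cutoff is scaled by a small [s] in [nrm2_mgrad_le_cutoff] and the squared norm is expanded: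
    this is the derivative at s = 0 in the direction chi (K - |Du|). *)
Lemma mgrad_variation u v K chi (x0 : X) (A : R) : admissible u ->
  admissible v -> relaxed_gradient m v K ->
  lipschitz_fun chi -> (forall y, 0 <= chi y <= 1) ->
  (forall y, chi y != 0 -> mdist x0 y <= A) ->
  (forall y, chi y * (v y - u y) = 0) ->
  (forall y, lip chi y * (v y - u y) = 0) ->
  0 <= ip (mgrad m u) (fun x => chi x * (K x - mgrad m u x)).
Proof.
move=> ua va vK cL c01 cA cuv lcuv.
have G2 := mgrad_L2 ua; have [_ v2 _] := va.
have [K2 _] := relaxed_gradientP v2 vK.
have cn y : `|chi y| <= 1 by rewrite ger0_norm; have /andP[] := c01 y.
have D2 := L2_bndM (lipschitz_measurable cL) cn (L2B K2 G2).
rewrite -(@pmulr_rge0 _ 2)//.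
apply: (@ler_small _ (nrm2 (fun x => chi x * (K x - mgrad m u x)))) => s /andP[s0 s1].
have scL : lipschitz_fun (fun x => s * chi x + 0 * chi x) by exact: lipschitz_lin.
have lsc y : lip (fun x => s * chi x + 0 * chi x) y * (v y - u y) = 0.
  have := lcuv y => /eqP; rewrite mulf_eq0 => /orP[/eqP l0|/eqP ->]; last by rewrite mulr0.
  have := lip_lin s 0 y cL cL; rewrite l0 !mulr0 addr0 => l0'.
  by rewrite (_ : lip _ y = 0) ?mul0r//; apply/eqP; rewrite eq_le l0' lip_ge0.
have := @nrm2_mgrad_le_cutoff u v K (fun x => s * chi x + 0 * chi x) x0 A ua va vK scL.
have -> : (fun x => (s * chi x + 0 * chi x) * K x + (1 - (s * chi x + 0 * chi x)) * mgrad m u x) =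
    (fun x => 1 * mgrad m u x + s * (chi x * (K x - mgrad m u x))).
  by apply/funext => x; ring.
rewrite nrm2_lin// => H.
have : nrm2 (mgrad m u) <= 1 ^+ 2 * nrm2 (mgrad m u) +
      2 * 1 * s * ip (mgrad m u) (fun x => chi x * (K x - mgrad m u x)) +
      s ^+ 2 * nrm2 (fun x => chi x * (K x - mgrad m u x)).
  apply: H => [y|y|y|//].
  - have /andP[y0 y1] := c01 y; rewrite mul0r addr0 mulr_ge0 ?(ltW s0)//=.
    by rewrite -[leRHS]mulr1 ler_pM// ltW.
  - by rewrite mul0r addr0 mulf_eq0 negb_or => /andP[_]; exact: cA.
  - by rewrite mul0r addr0 -mulrA cuv mulr0.
move=> H1; rewrite -(pmulr_rge0 _ s0); lra.
Qed.

(** The first variations for (u, v) and (v, u) add up to ip D (chi D) <= 0 for the difference [D] of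
    the two gradients; since chi^2 <= chi, the product chi D vanishes a.e. *)
Lemma mgrad_local u v chi (x0 : X) (A : R) : admissible u -> admissible v ->
  lipschitz_fun chi -> (forall y, 0 <= chi y <= 1) ->
  (forall y, chi y != 0 -> mdist x0 y <= A) ->
  (forall y, chi y * (v y - u y) = 0) ->
  (forall y, lip chi y * (v y - u y) = 0) ->
  {ae m, forall x, chi x != 0 -> mgrad m u x = mgrad m v x}.
Proof.
move=> ua va cL c01 cA cuv lcuv.
have [uG _] := mgradP ua; have [vG _] := mgradP va.
have G2 := mgrad_L2 ua; have K2 := mgrad_L2 va.
have H1 := mgrad_variation ua va vG cL c01 cA cuv lcuv.
have H2 : 0 <= ip (mgrad m v) (fun x => chi x * (mgrad m u x - mgrad m v x)).
  apply: (@mgrad_variation v u _ chi x0 A va ua uG cL c01 cA) => y.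
  - by rewrite -opprB mulrN cuv oppr0.
  - by rewrite -opprB mulrN lcuv oppr0.
have cn y : `|chi y| <= 1 by rewrite ger0_norm; have /andP[] := c01 y.
have mc := lipschitz_measurable cL.
set D := fun x => mgrad m u x - mgrad m v x.
have D2 : D \in L2 := L2B G2 K2.
have cD2 := L2_bndM mc cn D2.
have DD : ip D (fun x => chi x * D x) <= 0.
  rewrite ipBl//.
  have -> : ip (mgrad m u) (fun x => chi x * D x) =
      - ip (mgrad m u) (fun x => chi x * (mgrad m v x - mgrad m u x)).
    have KG2 := L2_bndM mc cn (L2B K2 G2).
    rewrite -mulN1r -RintegralZl//; last exact: integrable_L2M.
    by apply: eq_Rintegral => x _; rewrite /D; ring.
  by rewrite subr_le0 (le_trans _ H2)// oppr_le0.
have c2D2 : nrm2 (fun x => chi x * D x) <= 0.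
  apply: le_trans DD; apply: ler_ip => //.
  apply: aeW => x; rewrite -subr_ge0.
  rewrite (_ : _ - _ = chi x * (1 - chi x) * D x ^+ 2); last by ring.
  by have /andP[c0 c1] := c01 x; rewrite mulr_ge0 ?sqr_ge0// mulr_ge0// subr_ge0.
apply: ae_imp (nrm2_eq0 cD2 c2D2) => x /eqP; rewrite mulf_eq0 => /orP[->//|].
by rewrite subr_eq0 => /eqP.
Qed.

(** First variation with v = u and K = lip u, combined with the pointwise inequality G (l - G) <=
    (l^2 - G^2) / 2. *)
Lemma mgrad_le_lip u chi (x0 : X) (A : R) : admissible u ->
  lipschitz_fun chi -> (forall y, 0 <= chi y <= 1) ->
  (forall y, chi y != 0 -> mdist x0 y <= A) ->
  \int[m]_x (chi x * mgrad m u x ^+ 2) <= \int[m]_x (chi x * lip u x ^+ 2).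
Proof.
move=> ua cL c01 cA; have G2 := mgrad_L2 ua; have [_ _ lu2] := ua.
have := @mgrad_variation u u _ chi x0 A ua ua (relaxed_gradient_lip ua) cL c01 cA.
move=> /(_ (fun y => ltac:(rewrite subrr mulr0; reflexivity))).
move=> /(_ (fun y => ltac:(rewrite subrr mulr0; reflexivity))).
have cn y : `|chi y| <= 1 by rewrite ger0_norm; have /andP[] := c01 y.
have mc := lipschitz_measurable cL.
have cG2 := L2_bndM mc cn G2; have cl2 := L2_bndM mc cn lu2.
have iG : m.-integrable setT (EFin \o (fun x => chi x * mgrad m u x ^+ 2)).
  by apply: eq_integrable (integrable_L2M cG2 G2) => // x _ /=; rewrite mulrA.
have il : m.-integrable setT (EFin \o (fun x => chi x * lip u x ^+ 2)).
  by apply: eq_integrable (integrable_L2M cl2 lu2) => // x _ /=; rewrite mulrA.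
rewrite -subr_ge0 -RintegralB// => H.
rewrite -(@pmulr_rge0 _ 2^-1)//.
apply: (le_trans H); rewrite -RintegralZl//; last first.
  by apply: eq_integrable (integrableB measurableT il iG).
apply: le_Rintegral => //.
- by apply: integrable_L2M => //; exact: L2_bndM mc cn (L2B lu2 G2).
- apply: eq_integrable (integrableZl measurableT 2^-1 (integrableB measurableT il iG)) => //.
move=> x _; rewrite -mulrBr mulrCA [leRHS]mulrCA ler_wpM2l//.
  by have /andP[] := c01 x.
by have := sqr_ge0 (lip u x - mgrad m u x); nra.
Qed.

End minimal_gradient.

(** * Laplacian comparison *)

Lemma measurable_metric_ball (R : realType) (X : completeMetricType R) (x : X) (r : R) :
  measurable (ball x r : set (borel X)).
Proof. by apply: sub_sigma_algebra; rewrite ballEmdist; exact: open_ltr_mdist. Qed.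

(** * Functions of the distance to a point; cutoffs and localized gradient bounds *)

Section radial_functions.
Context {R : realType} {X : completeMetricType R}.
Variables (m : borel_measure X R) (x0 : X).
Hypothesis ball_fin : forall r : R, 0 < r -> (m (ball x0 r) < +oo)%E.

Local Notation L2 := (Lfun m 2%:E).
Local Notation d := (mdist x0).

Definition radial (phi : R -> R) (x : X) : R := phi (d x).

Lemma measurable_closed_ball (r : R) : measurable [set x : borel X | d x <= r].
Proof.
rewrite (_ : [set x : borel X | d x <= r] = d @^-1` `]-oo, r]%classic); last first.
  by apply/seteqP; split => x /=; rewrite in_itv.
rewrite -[X in measurable X]setTI; exact: measurable_mdist.
Qed.

Lemma mdist_lip1 (x y : X) : `|d y - d x| <= mdist x y.
Proof.
have := @lipschitz_mdist R X x0 id 1 ler01 (fun a b _ _ => ltac:(rewrite mul1r; exact: lexx)).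
by move=> /(_ x y); rewrite mul1r.
Qed.

Lemma slope_bound_radial (phi : R -> R) (a : R) (x : X) : 0 <= a ->
  (forall e, 0 < e -> exists2 dl, 0 < dl & forall s, 0 <= s -> `|s - d x| < dl ->
     `|phi s - phi (d x)| <= (a + e) * `|s - d x|) ->
  slope_bound (radial phi) a x.
Proof.
move=> a0 H e e0; have [dl dl0 Hd] := H e e0; exists dl => // y xy.
have yx := mdist_lip1 x y.
rewrite (le_trans (Hd _ (mdist_ge0 _ _) (le_lt_trans yx xy)))// ler_wpM2l//.
by rewrite addr_ge0// ltW.
Qed.

Lemma lip_radial_eq0 (phi : R -> R) (x : X) (dl : R) : 0 < dl ->
  (forall s, 0 <= s -> `|s - d x| < dl -> phi s = phi (d x)) ->
  lip (radial phi) x = 0.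
Proof.
move=> dl0 H; apply/eqP; rewrite eq_le lip_ge0 andbT; apply: lip_le => //.
apply: slope_bound_radial => // e e0; exists dl => // s s0 sd.
by rewrite H// subrr normr0 mulr_ge0// add0r ltW.
Qed.

Lemma L2_bounded_support (f : X -> R) (M r : R) :
  measurable_fun [set: borel X] (f : borel X -> R) -> 0 < r ->
  (forall x, `|f x| <= M) -> (forall x, r <= d x -> f x = 0) -> f \in L2.
Proof.
move=> mf r0 fM fr; apply/L2P; split=> //.
have mB := measurable_metric_ball x0 r.
apply: (@le_lt_trans _ _ (\int[m]_(x in (ball x0 r : set (borel X))) (M ^+ 2)%:E)%E).
  rewrite [leRHS]integral_mkcond; apply: ge0_le_integral => //.
  - by move=> x _; rewrite lee_fin sqr_ge0.
  - by apply/measurable_EFinP; exact: measurable_funX.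
  - by apply/measurable_restrict => //; rewrite setTI; exact: measurable_cst.
  - move=> x _; rewrite patchE; case: ifPn => [_|].
      rewrite lee_fin -[leLHS]real_normK ?num_real// lerXn2r ?nnegrE//.
      exact: le_trans (fM x).
    by rewrite notin_setE ballEmdist/= => /negP; rewrite -leNgt => /fr ->; rewrite expr0n.
rewrite integral_cst// lte_mul_pinfty// ?lee_fin ?sqr_ge0//; exact: ball_fin.
Qed.

Lemma L1_bounded_support (f : X -> R) (r : R) : f \in L2 -> 0 < r ->
  {ae m, forall x, r <= d x -> f x = 0} -> f \in Lfun m 1%E.
Proof.
move=> f2 r0 fr; pose i (x : X) : R := \1_(ball x0 r : set (borel X)) x.
have mB := measurable_metric_ball x0 r.
have i2 : i \in L2.
  apply: (@L2_bounded_support i 1 r) => //.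
  - exact: measurable_indic.
  - by move=> x; rewrite /i indicE; case: (_ \in _); rewrite ?normr1 ?normr0.
  - move=> x; rewrite leNgt => dr; rewrite /i indicE memNset// ballEmdist/=.
    exact/negP.
have fi := integrable_L2M f2 i2.
have mf := L2_measurable f2.
apply/Lfun1_integrable/integrableP; split; first exact/measurable_EFinP.
have /integrableP[_] := fi; apply: le_lt_trans.
apply: ae_ge0_le_integral => //.
- by apply: measurableT_comp => //; exact/measurable_EFinP.
- by apply: measurableT_comp => //; have /integrableP[] := fi.
apply: ae_imp fr => x fr _ /=; have [rd|dr] := leP r (d x).
  by rewrite fr// normr0 lee_fin.
by rewrite /i indicE mem_set ?mulr1// ballEmdist.
Qed.

Lemma lipschitz_radial (phi : R -> R) (L : R) : 0 <= L ->
  (forall a b, 0 <= a -> 0 <= b -> `|phi b - phi a| <= L * `|b - a|) ->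
  lipschitz_fun (radial phi).
Proof.
move=> L0 phiL; exists L => x y; rewrite metric_sym.
exact: (lipschitz_mdist x0 L0 phiL y x).
Qed.

Lemma admissible_radial (phi : R -> R) (L A : R) : 0 <= L -> 0 <= A ->
  (forall a b, 0 <= a -> 0 <= b -> `|phi b - phi a| <= L * `|b - a|) ->
  (forall a, A <= a -> phi a = 0) -> admissible m (radial phi).
Proof.
move=> L0 A0 phiL phiA.
(* From distance [A + 1] on, the function vanishes on a whole neighbourhood of the point, so that
   its slope vanishes as well. *)
have A1 : 0 < A + 1 by rewrite ltr_wpDl.
have AS s : A + 1 <= s -> A <= s by apply: le_trans; rewrite lerDl.
split.
- exact: lipschitz_radial phiL.
- apply: (@L2_bounded_support _ (L * A) (A + 1)) => //.
  + by apply: lipschitz_measurable; exact: lipschitz_radial phiL.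
  + move=> x; rewrite /radial; have [/phiA ->|dA] := leP A (d x).
      by rewrite normr0 mulr_ge0.
    have := phiL A (d x) A0 (mdist_ge0 _ _); rewrite (phiA A (lexx _)) subr0.
    move=> /le_trans; apply.
    rewrite ler_wpM2l// ler0_norm ?subr_le0 ?(ltW dA)// opprB.
    by rewrite gerBl mdist_ge0.
  + by move=> x /AS /phiA.
- apply: (@L2_bounded_support _ L (A + 1)) => //.
  + by apply: measurable_lip; exact: lipschitz_radial phiL.
  + move=> x; rewrite ger0_norm ?lip_ge0//; apply: lip_le_lipschitz => //.
    exact: lipschitz_mdist.
  + move=> x dA; apply: (@lip_radial_eq0 _ _ 1) => // s s0.
    rewrite ltr_norml => /andP[sd _]; rewrite !phiA//; first exact: AS.
    by lra.
Qed.

Lemma admissible_dom_cheeger (u : X -> R) : admissible m u -> dom_cheeger m u.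
Proof.
move=> ua; have [uL u2 lu2] := ua; split=> //.
rewrite /cheeger.
have : (ereal_inf [set limn_einf (fun n => \int[m]_x ((lip (fn n) x) ^+ 2)%:E)
     | fn in [set fn | lipschitz_approx m fn u]] <= (nrm2 m (lip u))%:E)%E.
  apply: ge_ereal_inf; exists (nrm2 m (lip u))%:E => //=.
  exists (fun=> u).
    split=> //; apply/cvg_Lnorm2P => //.
    have [_] := approximant_self (lexx 0) ua => H.
    rewrite (_ : (fun _ => _) = cst 0); first exact: cvg_cst.
    by apply/funext => n; apply/eqP; rewrite eq_le H nrm2_ge0.
  rewrite nrm2_EFin//.
  by apply: (cvg_limn_einf_sup (cvg_cst _)).1.
move=> H; apply: (@le_lt_trans _ _ (2^-1%:E * (nrm2 m (lip u))%:E)%E).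
  by apply: lee_wpmul2l => //; rewrite lee_fin invr_ge0.
by rewrite -EFinM ltry.
Qed.

Lemma clip01_lipschitz (a b : R) :
  `|Num.max 0 (Num.min 1 b) - Num.max 0 (Num.min 1 a)| <= `|b - a|.
Proof.
rewrite /Num.max /Num.min; repeat case: ifPn; rewrite -?leNgt;
  do ?[move=> ?]; rewrite ?subrr ?normr0 ?normr_ge0//; 
  rewrite ler_norml; have := ler_norm (b - a); have := ler_norm (a - b); rewrite distrC; lra.
Qed.

Lemma min_lipschitz (p q p' q' M : R) : `|p - p'| <= M -> `|q - q'| <= M ->
  `|Num.min p q - Num.min p' q'| <= M.
Proof.
rewrite !ler_norml => /andP[p1 p2] /andP[q1 q2].
by rewrite /Num.min; case: ifPn; case: ifPn; rewrite -?leNgt; move=> ? ?; lra.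
Qed.

(** Positive exactly for [r < s < k]. The outer radius is there because [mgrad_local] takes cutoffs
    of bounded support; the exterior of a ball is exhausted by letting [k] run through the
    integers. *)
Definition outer_cutoff (r k s : R) : R := Num.max 0 (Num.min 1 (Num.min (s - r) (k - s))).

Lemma outer_cutoff_lip (r k a b : R) :
  `|outer_cutoff r k b - outer_cutoff r k a| <= 1 * `|b - a|.
Proof.
rewrite mul1r (le_trans (clip01_lipschitz _ _))//; apply: min_lipschitz.
- by rewrite opprB addrA subrK.
- by rewrite opprB addrC addrA subrK distrC.
Qed.

Lemma outer_cutoff_eq0 (r k s : R) : s <= r \/ k <= s -> outer_cutoff r k s = 0.
Proof.
move=> H; rewrite /outer_cutoff; apply/eqP; rewrite eq_le le_max lexx andbT ge_max lexx/=.
by rewrite !ge_min; case: H => H; apply/orP; right; apply/orP; [left|right]; lra.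
Qed.

Lemma outer_cutoff_neq0 (r k s : R) : r < s < k -> outer_cutoff r k s != 0.
Proof.
by move=> H; rewrite gt_eqF// lt_max !lt_min ltr01 !subr_gt0 andbC/= orbC andbC H.
Qed.

Lemma clip01 (a : R) : 0 <= Num.max 0 (Num.min 1 a) <= 1.
Proof. by rewrite le_max lexx/= ge_max ler01 ge_min lexx. Qed.

Lemma mgrad_outer (phi psi : R -> R) (r : R) : admissible m (radial phi) ->
  admissible m (radial psi) -> (forall s, r <= s -> phi s = psi s) ->
  {ae m, forall x, r < d x -> mgrad m (radial phi) x = mgrad m (radial psi) x}.
Proof.
move=> phia psia E.
have H (n : nat) : {ae m, forall x, r < d x < n%:R ->
    mgrad m (radial phi) x = mgrad m (radial psi) x}.
  have cL := lipschitz_radial ler01 (fun a b _ _ => outer_cutoff_lip r n%:R a b).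
  have := @mgrad_local _ _ m _ _ _ x0 n%:R phia psia cL => /(_ (fun y => clip01 _)) H.
  apply: ae_imp (H _ _ _).
  - by move=> x cx rn; apply: cx; rewrite /radial outer_cutoff_neq0.
  - move=> y; apply: contraNT; rewrite -ltNge => /ltW ny.
    by rewrite /radial outer_cutoff_eq0//; right.
  - move=> y; have [ry|yr] := leP r (d y); first by rewrite /radial E// subrr mulr0.
    by rewrite /radial outer_cutoff_eq0 ?mul0r//; left; exact: ltW.
  - move=> y; have [ry|yr] := leP r (d y); first by rewrite /radial E// subrr mulr0.
    rewrite (@lip_radial_eq0 _ _ (r - d y)) ?mul0r ?subr_gt0// => s s0.
    rewrite ltr_norml => /andP[_ sr]; rewrite !outer_cutoff_eq0//; left; lra.
apply: ae_imp (ae_foralln H) => x Hx rx.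
have [n dn] : exists n : nat, d x < n%:R.
  by exists (Num.bound (d x)); rewrite archi_boundP// mdist_ge0.
by apply: (Hx n); rewrite rx.
Qed.

(** The comparison in [mgrad_le_lip] is against a Lipschitz cutoff, here 1 up to [r] and 0 from
    [r + dl] on; hence the margin between the two balls. *)
Lemma mgrad_inner (u : X -> R) (r dl c : R) : admissible m u -> 0 < r -> 0 < dl -> 0 <= c ->
  (forall x, d x < r + dl -> lip u x <= c * d x) ->
  (\int[m]_(x in [set x : borel X | (d x <= r)%R]) (mgrad m u x ^+ 2)%:E <=
   \int[m]_(x in ball x0 (r + dl) : set (borel X)) ((c * d x) ^+ 2)%:E)%E.
Proof.
move=> ua r0 dl0 c0 lu.
pose chi (s : R) : R := Num.max 0 (Num.min 1 (1 - (s - r) / dl)).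
have chiL a b : 0 <= a -> 0 <= b -> `|chi b - chi a| <= dl^-1 * `|b - a|.
  move=> _ _; rewrite (le_trans (clip01_lipschitz _ _))//.
  rewrite (_ : _ - _ = dl^-1 * (a - b)); last by ring.
  by rewrite normrM gtr0_norm ?invr_gt0// (distrC a).
have di0 : 0 <= dl^-1 by rewrite invr_ge0 ltW.
have cL := lipschitz_radial di0 chiL.
have chi1 s : s <= r -> chi s = 1.
  move=> sr; rewrite /chi minEle ifT; last first.
    by rewrite lerDl oppr_ge0 pmulr_lle0 ?invr_gt0// subr_le0.
  by rewrite maxEle ler01.
have chi0 s : r + dl <= s -> chi s = 0.
  move=> sr; rewrite /chi; apply/eqP; rewrite eq_le le_max lexx andbT ge_max lexx/= ge_min.
  by apply/orP; right; rewrite subr_le0 ler_pdivlMr// mul1r lerBrDl.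
have := @mgrad_le_lip _ _ m u (radial chi) x0 (r + dl) ua cL (fun y => clip01 _).
have -> : (forall y, radial chi y != 0 -> d y <= r + dl) = True.
  apply/propext; split=> // _ y; apply: contraNT; rewrite -ltNge => /ltW ny.
  by rewrite /radial chi0.
move=> /(_ Logic.I).
have G2 := mgrad_L2 ua; have [_ _ lu2] := ua.
have cn y : `|radial chi y| <= 1 by rewrite ger0_norm; have /andP[] := clip01 (1 - (d y - r) / dl).
have mc := lipschitz_measurable cL.
have cG2 := L2_bndM mc cn G2; have cl2 := L2_bndM mc cn lu2.
have iG : m.-integrable setT (EFin \o (fun x => radial chi x * mgrad m u x ^+ 2)).
  by apply: eq_integrable (integrable_L2M cG2 G2) => // x _ /=; rewrite mulrA.
have il : m.-integrable setT (EFin \o (fun x => radial chi x * lip u x ^+ 2)).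
  by apply: eq_integrable (integrable_L2M cl2 lu2) => // x _ /=; rewrite mulrA.
rewrite -lee_fin /Rintegral !fineK; last 2 first.
- exact: integrable_fin_num il.
- exact: integrable_fin_num iG.
have mB := measurable_metric_ball x0 (r + dl).
have mD : measurable [set x : borel X | d x <= r].
  exact: measurable_closed_ball.
have md := measurable_mdist x0.
have mG := L2_measurable G2.
move=> H; apply: le_trans (le_trans _ H) _.
  rewrite [leLHS]integral_mkcond; apply: ge0_le_integral => //.
  - by move=> x _; rewrite patchE; case: ifPn => // _; rewrite lee_fin sqr_ge0.
  - apply/(measurable_restrict _ _ _).1 => //; apply/measurable_EFinP/measurable_funX.
    by rewrite setTI; exact: measurable_funTS.
  - by case/integrableP: iG.
  - move=> x _; rewrite patchE; case: ifPn => [|_].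
      by rewrite inE/= => dr; rewrite lee_fin /radial chi1// mul1r.
    by rewrite lee_fin mulr_ge0 ?sqr_ge0//; have /andP[] := clip01 (1 - (d x - r) / dl).
rewrite [leRHS]integral_mkcond; apply: ge0_le_integral => //.
- move=> x _; rewrite lee_fin mulr_ge0 ?sqr_ge0//.
  by have /andP[] := clip01 (1 - (d x - r) / dl).
- by case/integrableP: il.
- apply/(measurable_restrict _ _ _).1 => //; apply/measurable_EFinP/measurable_funX.
  by rewrite setTI; apply: measurable_funTS; exact: measurable_funM.
- move=> x _; rewrite patchE; case: ifPn => [|].
    rewrite inE ballEmdist/= => dr; rewrite lee_fin.
    apply: (@le_trans _ _ (lip u x ^+ 2)).
      by rewrite ler_piMl ?sqr_ge0//; have /andP[] := clip01 (1 - (d x - r) / dl).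
    by rewrite lerXn2r ?nnegrE ?lip_ge0// ?mulr_ge0// ?mdist_ge0// lu.
  rewrite notin_setE ballEmdist/= => /negP; rewrite -leNgt => dr.
  by rewrite /radial chi0// mul0r.
Qed.

End radial_functions.

(** * Testing the Laplacian identity on a truncated paraboloid *)

Section laplacian_comparison.
Context {R : realType} {X : completeMetricType R}.
Variables (m : borel_measure X R) (x0 : X) (N : R).
Hypothesis ball_fin : forall r : R, 0 < r -> (m (ball x0 r) < +oo)%E.
Hypothesis N0 : 0 <= N.
Hypothesis laplacian : forall f : X -> R,
     dom_cheeger m f -> f \in Lfun m 1%E ->
     (fun x => mdist x0 x * f x) \in Lfun m 1%E ->
     (fun x => mdist x0 x * mgrad m f x) \in Lfun m 1%E ->
     (- (\int[m]_x
           (local_grad_inner m x0 (fun y => (mdist x0 y ^+ 2)%R) f x)%:E) =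
      (2 * N)%:E * \int[m]_x (f x)%:E)%E.

Local Notation d := (mdist x0).
Local Notation radial := (radial x0).

(** For nonnegative r and s this is (r^2 - s^2)_+. *)
Definition tent (r s : R) : R := r ^+ 2 - Num.min s r ^+ 2.

(** For k >= 0 and s >= 0: s^2 up to k, then the line k (2 k - s) down to 0 at 2 k. In the distance,
    it is a Lipschitz function of bounded support that may stand for d^2 on the ball of radius k. *)
Definition trunc_sqr (k s : R) : R :=
  Num.min (Num.min s (2 * k) ^+ 2) (k * (2 * k - Num.min s (2 * k))).

Lemma minr_lip (r a b : R) : `|Num.min b r - Num.min a r| <= `|b - a|.
Proof. by apply: min_lipschitz; rewrite ?subrr ?normr0. Qed.

Lemma tent_lip (r a b : R) : 0 <= r -> 0 <= a -> 0 <= b ->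
  `|tent r b - tent r a| <= 2 * r * `|b - a|.
Proof.
move=> r0 a0 b0; rewrite /tent.
have -> : r ^+ 2 - Num.min b r ^+ 2 - (r ^+ 2 - Num.min a r ^+ 2) =
  - ((Num.min b r + Num.min a r) * (Num.min b r - Num.min a r)) by ring.
rewrite normrN normrM ler_pM ?minr_lip// ger0_norm ?addr_ge0// ?le_min ?a0 ?b0//.
by rewrite mulr_natl mulr2n lerD// ge_min lexx orbT.
Qed.

Lemma trunc_sqr_lip (k a b : R) : 0 <= k -> 0 <= a -> 0 <= b ->
  `|trunc_sqr k b - trunc_sqr k a| <= 4 * k * `|b - a|.
Proof.
move=> k0 a0 b0; have k2 : 0 <= 2 * k by rewrite mulr_ge0.
apply: min_lipschitz.
  rewrite subr_sqr mulrC normrM ler_pM ?minr_lip// ger0_norm ?addr_ge0// ?le_min ?a0 ?b0//.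
  rewrite (_ : 4 * k = 2 * k + 2 * k); last by ring.
  by rewrite lerD// ge_min lexx orbT.
rewrite (_ : _ - _ = - (k * (Num.min b (2 * k) - Num.min a (2 * k)))); last by ring.
by rewrite normrN normrM (ger0_norm k0) ler_pM ?minr_lip//; lra.
Qed.

Lemma trunc_sqr_small (k s : R) : 0 <= s <= k -> trunc_sqr k s = s ^+ 2.
Proof.
move=> /andP[s0 sk]; have s2k : s <= 2 * k by lra.
rewrite /trunc_sqr (min_idPl s2k); apply/min_idPl.
by rewrite -subr_ge0 (_ : _ - _ = (k - s) * (2 * k + s)); [rewrite mulr_ge0; lra|ring].
Qed.

Lemma trunc_sqr_large (k s : R) : 0 <= k -> 2 * k <= s -> trunc_sqr k s = 0.
Proof.
move=> k0 sk; rewrite /trunc_sqr (min_idPr sk) subrr mulr0.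
by apply/min_idPr; rewrite sqr_ge0.
Qed.

Lemma tent_large (r s : R) : r <= s -> tent r s = 0.
Proof. by move=> rs; rewrite /tent (min_idPr rs) subrr. Qed.

Lemma tent_ge0 (r s : R) : 0 <= r -> 0 <= s -> 0 <= tent r s.
Proof.
move=> r0 s0; rewrite subr_ge0 lerXn2r ?nnegrE ?le_min ?s0//.
by rewrite ge_min lexx orbT.
Qed.

Lemma admissible_tent (r : R) : 0 <= r -> admissible m (radial (tent r)).
Proof.
move=> r0; apply: (@admissible_radial _ _ m x0 ball_fin _ (2 * r) r) => //.
- by rewrite mulr_ge0.
- by move=> a b a0 b0; exact: tent_lip.
- exact: tent_large.
Qed.

Lemma admissible_trunc_sqr (k : R) : 0 <= k -> admissible m (radial (trunc_sqr k)).
Proof.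
move=> k0; apply: (@admissible_radial _ _ m x0 ball_fin _ (4 * k) (2 * k)) => //.
- by rewrite mulr_ge0.
- by rewrite mulr_ge0.
- by move=> a b a0 b0; exact: trunc_sqr_lip.
- by move=> a; exact: trunc_sqr_large.
Qed.

(** For e = 1 and e = -1, the sum and the difference whose gradients enter the polarized product of
    [trunc_sqr] and [tent]. *)
Definition sumdiff (e r k s : R) : R := trunc_sqr k s + e * tent r s.

Lemma admissible_sumdiff (e r k : R) : `|e| <= 1 -> 0 <= r <= k ->
  admissible m (radial (sumdiff e r k)).
Proof.
move=> e1 /andP[r0 rk]; have k0 := le_trans r0 rk.
apply: (@admissible_radial _ _ m x0 ball_fin _ (4 * k + 2 * r) (2 * k)).
- by rewrite addr_ge0// mulr_ge0.
- by rewrite mulr_ge0.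
- move=> a b a0 b0; rewrite /sumdiff opprD addrACA -mulrBr.
  rewrite (le_trans (ler_normD _ _))// mulrDl lerD ?trunc_sqr_lip//.
  rewrite normrM; apply: le_trans (tent_lip r0 a0 b0).
  by rewrite ler_piMl.
- by move=> a ka; rewrite /sumdiff trunc_sqr_large// tent_large ?mulr0 ?addr0//; lra.
Qed.

Lemma sumdiffE (e r k : R) : radial (sumdiff e r k) =
  (fun x => radial (trunc_sqr k) x + e * radial (tent r) x).
Proof. by []. Qed.

(** Up to k the profile is s^2 + min(s, r)^2 - r^2, a sum of two squares whose slopes are at most 2
    s each. *)
Lemma lip_diff_le (r k dl : R) (x : X) : 0 < r -> 0 < dl -> r + dl < k ->
  d x < r + dl -> lip (radial (sumdiff (-1) r k)) x <= 4 * d x.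
Proof.
move=> r0 dl0 rk dx; have d0 : 0 <= d x := mdist_ge0 _ _.
apply: lip_le; first by rewrite mulr_ge0.
apply: slope_bound_radial => [|e e0]; first by rewrite mulr_ge0.
exists (Num.min (r + dl - d x) (e / 2)); first by rewrite lt_min subr_gt0 dx divr_gt0.
move=> s s0; rewrite lt_min => /andP[sd se].
have [sd1 sd2] : s < r + dl /\ s <= d x + e / 2.
  by move: sd se; rewrite !ltr_norml; lra.
rewrite /sumdiff !trunc_sqr_small ?s0 ?d0/= //; [|lra|lra].
rewrite /tent.
set a := Num.min s r; set b := Num.min (d x) r.
have ab := minr_lip r (d x) s; rewrite -/a -/b in ab.
have a0 : 0 <= a by rewrite le_min s0 ltW.
have b0 : 0 <= b by rewrite le_min d0 ltW.
have a1 : a <= s by rewrite ge_min lexx.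
have b1 : b <= d x by rewrite ge_min lexx.
have -> : s ^+ 2 + -1 * (r ^+ 2 - a ^+ 2) - (d x ^+ 2 + -1 * (r ^+ 2 - b ^+ 2)) =
  (s + d x) * (s - d x) + (a + b) * (a - b) by ring.
rewrite (le_trans (ler_normD _ _))// !normrM (ger0_norm (addr_ge0 s0 d0)) (ger0_norm (addr_ge0 a0 b0)).
apply: (@le_trans _ _ ((s + d x) * `|s - d x| + (a + b) * `|s - d x|)).
  by rewrite lerD2l ler_wpM2l// addr_ge0.
by rewrite -mulrDl ler_wpM2r//; lra.
Qed.

Lemma mgrad_cst0 : {ae m, forall x, mgrad m (cst 0) x = 0}.
Proof.
have r0 : 0 <= 0 :> R by [].
have E : (cst 0 : X -> R) = radial (tent 0).
  by apply/funext => x; rewrite /radial tent_large// mdist_ge0.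
have za : admissible m (cst 0 : X -> R) by rewrite E; exact: admissible_tent.
apply: (nrm2_eq0 (mgrad_L2 za)); have [_] := mgradP za; apply=> eps e0.
rewrite (le_trans (inf_energy_le (approximant_self (ltW e0) za)))//.
rewrite (_ : lip (cst 0) = cst 0).
  by rewrite /nrm2 /ip /Rintegral; under eq_integral do rewrite mulr0; rewrite integral0.
apply/funext => x; apply/eqP; rewrite eq_le lip_ge0 andbT.
apply: lip_le => // e e1; exists 1 => // y _; rewrite subrr normr0.
by rewrite mulr_ge0 ?mdist_ge0// add0r ltW.
Qed.

Lemma laplacian_tent (r : R) : 0 < r ->
  (- (\int[m]_x (local_grad_inner m x0 (fun y => (d y ^+ 2)%R) (radial (tent r)) x)%:E) =
   (2 * N)%:E * \int[m]_x (radial (tent r) x)%:E)%E.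
Proof.
move=> r0; have fa := admissible_tent (ltW r0).
have [fL f2 lf2] := fa.
have fr x : r <= d x -> radial (tent r) x = 0 by exact: tent_large.
(* A bounded replacement for the weight d: the test function vanishes outside the ball of radius
   [r], and so does its gradient a.e., by comparison with the zero function. *)
pose c (x : X) : R := d x * \1_[set x : borel X | d x <= r] x.
have mD := measurable_closed_ball x0 r.
have md := measurable_mdist x0.
have mc : measurable_fun [set: borel X] (c : borel X -> R).
  by apply: measurable_funM => //; exact: measurable_indic.
have cr x : `|c x| <= r.
  rewrite /c indicE; have [/set_mem/= dr|_] := boolP (x \in _).
    by rewrite mulr1 ger0_norm// mdist_ge0.
  by rewrite mulr0 normr0 ltW.
have r1 : 0 < r + 1 by rewrite addr_gt0.
apply: laplacian.
- exact: admissible_dom_cheeger.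
- by apply: (@L1_bounded_support _ _ _ x0 ball_fin _ r) => //; exact: aeW.
- rewrite (_ : (fun _ => _) = (fun x => c x * radial (tent r) x)).
    apply: (@L1_bounded_support _ _ _ x0 ball_fin _ r) => //.
      exact: L2_bndM mc cr f2.
    by apply: aeW => x /fr ->; rewrite mulr0.
  apply/funext => x; rewrite /c indicE; have [_|] := boolP (x \in _).
    by rewrite mulr1.
  by rewrite notin_setE/= => /negP; rewrite -ltNge => /ltW /fr ->; rewrite !mulr0.
- have G2 := mgrad_L2 fa.
  have Gr : {ae m, forall x, r < d x -> mgrad m (radial (tent r)) x = 0}.
    have E : (cst 0 : X -> R) = radial (tent 0).
      by apply/funext => x; rewrite /radial tent_large// mdist_ge0.
    have H : forall s, r <= s -> tent r s = tent 0 s.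
      by move=> s rs; rewrite !tent_large// (le_trans _ rs)// ltW.
    have := mgrad_outer fa (admissible_tent (lexx 0)) H; rewrite -E.
    by apply: (ae_imp2 _ mgrad_cst0) => x -> /[apply].
  have H1 : (fun x => c x * mgrad m (radial (tent r)) x) \in Lfun m 1%E.
    apply: (@L1_bounded_support _ _ _ x0 ball_fin _ (r + 1)) => //.
      exact: L2_bndM mc cr G2.
    apply: aeW => x rd; rewrite /c indicE memNset ?mulr0 ?mul0r//=.
    by apply/negP; rewrite -ltNge (lt_le_trans _ rd)// ltrDl.
  move/Lfun1_integrable/integrableP : H1 => [m1 i1].
  have mG := L2_measurable G2.
  have m2 : measurable_fun [set: borel X] (fun x : borel X => d x * mgrad m (radial (tent r)) x).
    exact: measurable_funM.
  apply/Lfun1_integrable/integrableP; split; first exact/measurable_EFinP.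
  apply: le_lt_trans i1; apply: ae_ge0_le_integral => //.
  + by apply: measurableT_comp => //; exact/measurable_EFinP.
  + exact: measurableT_comp.
  + apply: ae_imp Gr => x Gx _ /=; rewrite lee_fin /c indicE.
    have [_|] := boolP (x \in _); first by rewrite mulr1.
    rewrite notin_setE/= => /negP; rewrite -ltNge => /Gx ->.
    by rewrite !mulr0.
Qed.

(* With [u = g - f] and [v = g + f], where [f = (r^2 - d^2)_+] and [g = d^2]
   near the ball: [u] and [v] coincide outside the ball, so [<Dg, Df>] vanishes
   there; inside it [<Dg, Df> >= - |Du|^2 / 4 >= - 4 d^2]. *)
Lemma laplacian_ball_ineq (r dl : R) : 0 < r -> 0 < dl ->
  (N%:E * \int[m]_x (radial (tent r) x)%:E <=
   2%:E * \int[m]_(x in ball x0 (r + dl) : set (borel X)) (d x ^+ 2)%:E)%E.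
Proof.
move=> r0 dl0; have fa := admissible_tent (ltW r0).
have mB := measurable_metric_ball x0 (r + dl).
have mD := measurable_closed_ball x0 r.
have md := measurable_mdist x0.
have B0 : (0 <= \int[m]_(x in ball x0 (r + dl) : set (borel X)) (d x ^+ 2)%:E)%E.
  by apply: integral_ge0 => x _; rewrite lee_fin sqr_ge0.
set f := radial (tent r); set h := local_grad_inner m x0 (fun y => d y ^+ 2) f.
have hE : (- (\int[m]_x (h x)%:E) = (2 * N)%:E * \int[m]_x (f x)%:E)%E.
  exact: laplacian_tent.
suff hB : (- (\int[m]_x (h x)%:E) <=
    4%:E * \int[m]_(x in ball x0 (r + dl) : set (borel X)) (d x ^+ 2)%:E)%E.
  have := hB; rewrite hE => H.
  have := lee_wpmul2l (_ : (0 <= 2^-1%:E)%E) H; rewrite !muleA -!EFinM.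
  rewrite mulKf// (_ : 2^-1 * 4 = 2 :> R); last by field.
  by apply; rewrite lee_fin invr_ge0.
(* If no function represents the localized product, [xget] returns the zero function and the claim
   compares 0 with a nonnegative integral. *)
have [Hex|Hn] := pselect (exists h, is_local_grad_inner m x0 (fun y => d y ^+ 2) f h); last first.
  rewrite /h /local_grad_inner xgetPN; last by move=> h' Hh'; apply: Hn; exists h'.
  by rewrite integral0 oppe0 mule_ge0.
have [mh Hh] : is_local_grad_inner m x0 (fun y => d y ^+ 2) f h := xgetPex _ Hex.
clear hE Hex; clearbody h.
pose k := r + dl + 1.
have rk : r + dl < k by rewrite ltrDl.
have k0 : 0 < k by rewrite (lt_trans _ rk)// addr_gt0.
pose u := radial (sumdiff (-1) r k).
have hg (n : R) : r <= n -> {ae m, forall x, ball x0 n x ->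
    h x = 4^-1 * (mgrad m (radial (sumdiff 1 r n)) x ^+ 2 -
                  mgrad m (radial (sumdiff (-1) r n)) x ^+ 2)}.
  move=> rn; have n0 : 0 < n by exact: lt_le_trans rn.
  have := Hh n (radial (trunc_sqr n)) n0.
  move=> /(_ (admissible_dom_cheeger (admissible_trunc_sqr (ltW n0)))).
  have E1 : radial (trunc_sqr n) \+ f = radial (sumdiff 1 r n).
    by apply/funext => x /=; rewrite sumdiffE mul1r.
  have E2 : radial (trunc_sqr n) \- f = radial (sumdiff (-1) r n).
    by apply/funext => x /=; rewrite sumdiffE mulN1r.
  have gd : {ae m, forall x, ball x0 n x -> radial (trunc_sqr n) x = d x ^+ 2}.
    apply: aeW => x; rewrite ballEmdist/= => dn.
    by rewrite /radial trunc_sqr_small// mdist_ge0/= ltW.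
  move=> /(_ gd) H; apply: (ae_imp _ H) => x Hx xn.
  by rewrite (Hx xn) /grad_inner E1 E2.
have e1 : `|1 : R| <= 1 by rewrite normr1.
have eN1 : `|-1 : R| <= 1 by rewrite normrN normr1.
have hout : {ae m, forall x, r < d x -> h x = 0}.
  have H (n : nat) : {ae m, forall x, r < d x < n%:R -> h x = 0}.
    have [nr|rn] := leP n%:R r; first by apply: aeW => x; lra.
    have rn' : 0 <= r <= n%:R by rewrite !ltW.
    have S s : r <= s -> sumdiff 1 r n%:R s = sumdiff (-1) r n%:R s.
      by move=> rs; rewrite /sumdiff !tent_large// !mulr0.
    have := mgrad_outer (admissible_sumdiff e1 rn') (admissible_sumdiff eN1 rn') S.
    apply: ae_imp2 (hg n%:R (ltW rn)) => x hx E /andP[rx xn].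
    by rewrite hx ?ballEmdist// E// subrr mulr0.
  apply: ae_imp (ae_foralln H) => x Hx rx.
  have [n dn] : exists n : nat, d x < n%:R.
    by exists (Num.bound (d x)); rewrite archi_boundP// mdist_ge0.
  by apply: (Hx n); rewrite rx.
have rk' : 0 <= r <= k by rewrite ltW//=; lra.
have ua := admissible_sumdiff eN1 rk'.
have uG := mgrad_L2 ua; have mG := L2_measurable uG.
have inner := @mgrad_inner _ _ m x0 _ r dl 4 ua r0 dl0 (ltac:(by [])) (fun x => lip_diff_le r0 dl0 rk).
have hneg : (\int[m]_x ((EFin \o h)^\- x) <=
    \int[m]_(x in [set x : borel X | (d x <= r)%R]) (4^-1 * mgrad m u x ^+ 2)%:E)%E.
  rewrite [leRHS]integral_mkcond; apply: ae_ge0_le_integral => //.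
  - by apply: measurable_funeneg; exact/measurable_EFinP.
  - move=> x _; rewrite patchE; case: ifPn => // _.
    by rewrite lee_fin mulr_ge0 ?sqr_ge0.
  - apply/(measurable_restrict _ _ _).1 => //; apply/measurable_EFinP.
    by rewrite setTI; apply: measurable_funTS; apply: measurable_funM => //; exact: measurable_funX.
  - apply: ae_imp2 hout (hg k (ltac:(lra))) => x h0 hk _.
    rewrite patchE funenegE/= -EFin_max; case: ifPn => [|].
      rewrite inE/= => dr; rewrite hk; last by rewrite ballEmdist/=; lra.
      rewrite lee_fin ge_max; apply/andP; split; last by rewrite mulr_ge0 ?sqr_ge0.
      by have := sqr_ge0 (mgrad m (radial (sumdiff 1 r k)) x); rewrite /u; lra.
    rewrite notin_setE/= => /negP; rewrite -ltNge => /h0 ->.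
    by rewrite oppr0 maxxx.
(* Only the negative part of [h] has been bounded; an infinite integral of the positive part would
   only help, the claim being an upper bound for minus the integral of [h]. *)
apply: (@le_trans _ _ (\int[m]_x ((EFin \o h)^\- x))%E).
  by rewrite leeNl [leRHS]integralE -[leLHS]add0e leeD2r// integral_ge0.
apply: (le_trans hneg).
under eq_integral do rewrite EFinM.
rewrite ge0_integralZl_EFin//; last first.
- by apply/measurable_EFinP/measurable_funX; exact: measurable_funTS.
- by move=> x _; rewrite lee_fin sqr_ge0.
apply: (le_trans (lee_wpmul2l (_ : (0 <= 4^-1%:E)%E) inner)).
  by rewrite lee_fin invr_ge0.
under eq_integral do rewrite exprMn EFinM.
rewrite ge0_integralZl_EFin ?sqr_ge0//; last first.
- by apply/measurable_EFinP/measurable_funX; exact: measurable_funTS.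
- by move=> x _; rewrite lee_fin sqr_ge0.
rewrite muleA -EFinM (_ : 4^-1 * 4 ^+ 2 = 4 :> R)//; by field.
Qed.

End laplacian_comparison.

(** * Densities, layer cakes and gluing *)

Section measure_with_density.
Context {d : measure_display} {T : measurableType d} {R : realType}.
Variables (mu : {measure set T -> \bar R}) (w : T -> R).
Hypotheses (w0 : forall x, 0 <= w x) (mw : measurable_fun setT w).

(** The dummy [let] turns the section hypotheses into arguments of the definition, so that a measure
    instance can be attached to it. The packings of probability and sigma-finite measures below use
    the same device. *)
Definition density_measure (A : set T) : \bar R :=
  let _ := (w0, mw) in (\int[mu]_(x in A) (w x)%:E)%E.

Let density_measure0 : density_measure set0 = 0%E.
Proof. by rewrite /density_measure integral_set0. Qed.

Let density_measure_ge0 A : (0 <= density_measure A)%E.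
Proof. by apply: integral_ge0 => x _; rewrite lee_fin. Qed.

Let density_measure_sigma_additive : semi_sigma_additive density_measure.
Proof.
move=> /= F mF tF mUF; rewrite /density_measure; apply: cvg_toP.
  apply: ereal_nondecreasing_is_cvgn => k n kn.
  by apply: lee_sum_nneg_natr => // i _ _; apply: integral_ge0 => x _; rewrite lee_fin.
rewrite ge0_integral_bigcup//=.
- exact/measurable_funTS/measurable_EFinP.
- by move=> x _; rewrite lee_fin.
Qed.

HB.instance Definition _ := isMeasure.Build _ _ _ density_measure
  density_measure0 density_measure_ge0 density_measure_sigma_additive.

Definition density_measure_pack : {measure set T -> \bar R} := density_measure.

Variable nu : {measure set T -> \bar R}.
Hypothesis nuE : forall A, measurable A -> nu A = (\int[mu]_(x in A) (w x)%:E)%E.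

Import HBNNSimple.

Let integral_density_indic (E : set T) : measurable E ->
  (\int[nu]_x (\1_E x)%:E = \int[mu]_x ((\1_E x)%:E * (w x)%:E))%E.
Proof.
move=> mE; rewrite integral_indic// setIT nuE// [LHS]integral_mkcond.
apply: eq_integral => x _; rewrite patchE indicE.
by case: ifPn => _; rewrite ?mul1e ?mul0e.
Qed.

Let mwE : measurable_fun setT (fun x => (w x)%:E).
Proof. exact/measurable_EFinP. Qed.

Let integral_density_nnsfun (h : {nnsfun T >-> R}) :
  (\int[nu]_x (h x)%:E = \int[mu]_x ((h x)%:E * (w x)%:E))%E.
Proof.
under [LHS]eq_integral do rewrite fimfunE -fsumEFin//.
rewrite [LHS]ge0_integral_fsum//; last 2 first.
  - by move=> r; exact/measurable_EFinP/measurableT_comp.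
  - by move=> n x _; rewrite EFinM nnfun_muleindic_ge0.
under [RHS]eq_integral.
  move=> x _; rewrite fimfunE -fsumEFin// muleC ge0_mule_fsumr; last first.
    by move=> r; rewrite EFinM nnfun_muleindic_ge0.
  over.
rewrite [RHS]ge0_integral_fsum//; last 2 first.
  - move=> r; apply: emeasurable_funM => //.
    by apply/measurable_EFinP; apply/measurableT_comp => //.
  - by move=> n x _; rewrite mule_ge0// ?lee_fin// -lee_fin EFinM nnfun_muleindic_ge0.
apply: eq_fsbigr => r _.
have [r0|r0] := leP 0 r; last first.
  rewrite preimage_nnfun0//.
  by rewrite !integral0_eq// => x _; rewrite indic0 mulr0 ?mule0.
under eq_integral do rewrite EFinM.
under [RHS]eq_integral do rewrite EFinM muleCA.
have mE : measurable (h @^-1` [set r]) by [].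
have mi : measurable_fun setT (fun x => (\1_(h @^-1` [set r]) x)%:E : \bar R).
  by apply/measurable_EFinP; exact: measurable_indic.
rewrite ge0_integralZl_EFin//.
rewrite ge0_integralZl_EFin//; last 2 first.
- by move=> x _; rewrite mule_ge0// lee_fin.
- exact: emeasurable_funM.
by rewrite integral_density_indic//; under [in RHS]eq_integral do rewrite muleC.
Qed.

Lemma ge0_integral_density (f : T -> \bar R) : measurable_fun setT f ->
  (forall x, 0 <= f x)%E ->
  (\int[nu]_x f x = \int[mu]_x (f x * (w x)%:E))%E.
Proof.
move=> mf f0; pose f_ := nnsfun_approx measurableT mf.
transitivity (limn (fun n => \int[nu]_x (f_ n x)%:E)%E).
  rewrite -monotone_convergence//=.
  - apply: eq_integral => x _; apply/esym/cvg_lim => //=.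
    by apply: cvg_nnsfun_approx.
  - by move=> n; apply: measurableT_comp.
  - by move=> n x _; rewrite lee_fin.
  - by move=> x _ a b ab; rewrite lee_fin//; exact/lefP/nd_nnsfun_approx.
under eq_fun do rewrite integral_density_nnsfun.
rewrite -monotone_convergence//=.
- apply: eq_integral => x _; apply/cvg_lim => //=.
  by apply: cvgeZr => //; apply: cvg_nnsfun_approx.
- by move=> n; apply: emeasurable_funM => //; apply: measurableT_comp.
- by move=> n x _; rewrite mule_ge0// lee_fin.
- move=> x _ a b ab; rewrite lee_wpmul2r// ?lee_fin//.
  exact/lefP/nd_nnsfun_approx.
Qed.

End measure_with_density.

Section probability_pack.
Context {d : measure_display} {T : measurableType d} {R : realType}.
Variables (mu : {measure set T -> \bar R}) (mu1 : mu setT = 1%E).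
Definition probability_copy : set T -> \bar R := let _ := mu1 in mu.
HB.instance Definition _ := Measure.on probability_copy.
HB.instance Definition _ := Measure_isProbability.Build _ _ _ probability_copy mu1.
Definition probability_of : probability T R := probability_copy.
End probability_pack.

Section sigma_finite_pack.
Context {d : measure_display} {T : measurableType d} {R : realType}.
Variables (mu : {measure set T -> \bar R}) (mus : sigma_finite setT mu).
Definition sigma_finite_copy : set T -> \bar R := let _ := mus in mu.
HB.instance Definition _ := Measure.on sigma_finite_copy.
HB.instance Definition _ := Measure_isSigmaFinite.Build _ _ _ sigma_finite_copy mus.
Definition sigma_finite_of : {sigma_finite_measure set T -> \bar R} := sigma_finite_copy.
End sigma_finite_pack.

(** * Couplings with a density against the product measure *)

Section density_coupling.
Context {d1 d2 : measure_display} {T1 : measurableType d1} {T2 : measurableType d2}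
  {R : realType}.
Variables (P1 : {measure set T1 -> \bar R}) (P2 : {measure set T2 -> \bar R}).
Hypotheses (P1T : P1 setT = 1%E) (P2T : P2 setT = 1%E).
Variable w : T1 * T2 -> R.
Hypotheses (w0 : forall z, 0 <= w z) (mw : measurable_fun setT w).
Hypothesis w1 : {ae P1, forall x, (\int[P2]_y (w (x, y))%:E = 1)%E}.
Hypothesis w2 : {ae P2, forall y, (\int[P1]_x (w (x, y))%:E = 1)%E}.

Let p1 := probability_of P1T.
Let p2 := probability_of P2T.

(** By Tonelli, the two normalizations of [w] are exactly the two marginal conditions. The density 1
    gives product couplings; densities constant on the blocks of a partition give the gluing of
    plans and the couplings with prescribed block masses. *)
Lemma density_coupling : exists Q : {measure set (T1 * T2)%type -> \bar R},
  [/\ forall A, measurable A -> Q (A `*` setT) = P1 A,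
      forall B, measurable B -> Q (setT `*` B) = P2 B &
      forall g : T1 * T2 -> \bar R, measurable_fun setT g -> (forall z, 0 <= g z)%E ->
        (\int[Q]_z g z = \int[(p1 \x p2)%E]_z (g z * (w z)%:E))%E].
Proof.
exists (density_measure_pack (p1 \x p2)%E w0 mw); split.
- move=> A mA; rewrite /= /density_measure integral_mkcond.
  rewrite (eq_integral (fun z => (\1_A z.1)%:E * (w z)%:E))%E; last first.
    move=> [x y] _; rewrite patchE indicE.
    have -> : (x, y) \in A `*` setT = (x \in A) by rewrite in_setX in_setT andbT.
    by case: ifPn => _; rewrite ?mul1e ?mul0e.
  have mi : measurable_fun setT (fun z : T1 * T2 => (\1_A z.1)%:E : \bar R).
    have mA1 : measurable_fun setT (\1_A : T1 -> R) by exact: measurable_indic.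
    by apply/measurable_EFinP; exact: measurableT_comp mA1 measurable_fst.
  have mwE : measurable_fun setT (fun z => (w z)%:E) by exact/measurable_EFinP.
  rewrite fubini_tonelli1//; last 2 first.
  + exact: emeasurable_funM.
  + by move=> z; rewrite mule_ge0// lee_fin.
  transitivity (\int[P1]_x (\1_A x)%:E)%E; last by rewrite integral_indic// setIT.
  have mF := @measurable_fun_fubini_tonelli_F _ _ _ _ _ p2 (fun z => (\1_A z.1)%:E * (w z)%:E)%E.
  apply: ge0_ae_eq_integral => //.
  + apply: mF; first exact: emeasurable_funM.
    by move=> z; rewrite mule_ge0// lee_fin.
  + by apply/measurable_EFinP; exact: measurable_indic.
  + by move=> x _; apply: integral_ge0 => y _; rewrite mule_ge0// lee_fin.
  apply: ae_imp w1 => x wx _; rewrite /fubini_F/=.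
  rewrite ge0_integralZl_EFin//.
  + by rewrite -[X in (_ * X)%E]/(\int[P2]_y (w (x, y))%:E)%E wx mule1.
  + by move=> y _; rewrite lee_fin.
  + by apply/measurable_EFinP; exact: measurableT_comp.
- move=> A mA; rewrite /= /density_measure integral_mkcond.
  rewrite (eq_integral (fun z => (\1_A z.2)%:E * (w z)%:E))%E; last first.
    move=> [x y] _; rewrite patchE indicE.
    have -> : (x, y) \in setT `*` A = (y \in A) by rewrite in_setX in_setT.
    by case: ifPn => _; rewrite ?mul1e ?mul0e.
  have mi : measurable_fun setT (fun z : T1 * T2 => (\1_A z.2)%:E : \bar R).
    have mA2 : measurable_fun setT (\1_A : T2 -> R) by exact: measurable_indic.
    by apply/measurable_EFinP; exact: measurableT_comp mA2 measurable_snd.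
  have mwE : measurable_fun setT (fun z => (w z)%:E) by exact/measurable_EFinP.
  rewrite fubini_tonelli2//; last 2 first.
  + exact: emeasurable_funM.
  + by move=> z; rewrite mule_ge0// lee_fin.
  transitivity (\int[P2]_x (\1_A x)%:E)%E; last by rewrite integral_indic// setIT.
  have mF := @measurable_fun_fubini_tonelli_G _ _ _ _ _ p1 (fun z => (\1_A z.2)%:E * (w z)%:E)%E.
  apply: ge0_ae_eq_integral => //.
  + apply: mF; first exact: emeasurable_funM.
    by move=> z; rewrite mule_ge0// lee_fin.
  + by apply/measurable_EFinP; exact: measurable_indic.
  + by move=> x _; apply: integral_ge0 => y _; rewrite mule_ge0// lee_fin.
  apply: ae_imp w2 => y wy _; rewrite /fubini_G/=.
  rewrite ge0_integralZl_EFin//.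
  + by rewrite -[X in (_ * X)%E]/(\int[P1]_x (w (x, y))%:E)%E wy mule1.
  + by move=> x _; rewrite lee_fin.
  + by apply/measurable_EFinP; exact: measurableT_comp.
- by move=> g mg g0; apply: ge0_integral_density.
Qed.

End density_coupling.

(** * Integrals through superlevel sets *)

Section layer_cake.
Context {d : measure_display} {T : measurableType d} {R : realType}.
Variable m : {measure set T -> \bar R}.
Hypothesis ms : sigma_finite setT m.

Lemma measurable_superlevel (f : T -> R) (c : R) : measurable_fun setT f ->
  measurable [set x | c < f x].
Proof.
move=> mf; rewrite -[X in measurable X]setTI.
have mb : measurable_fun setT (fun x => c < f x) by exact: measurable_fun_ltr.
rewrite (_ : [set x | c < f x] = (fun x => c < f x) @^-1` [set true]); last by apply/seteqP; split.
exact: mb.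
Qed.

Lemma measurable_fun_level (A : set T) (f : T -> R) : measurable A -> measurable_fun setT f ->
  measurable_fun setT (fun c : measurableTypeR R => m (A `&` [set x | c < f x])).
Proof.
move=> mA mf; pose ms' := sigma_finite_of ms.
pose B := [set z : T * measurableTypeR R | A z.1 /\ z.2 < f z.1].
have mB : measurable B.
  apply: measurableI.
    by rewrite -[X in measurable X]setTI; exact: (@measurable_fst _ _ T (measurableTypeR R)).
  have mb : measurable_fun setT (fun z : T * measurableTypeR R => z.2 < f z.1).
    by apply: measurable_fun_ltr => //; exact: measurableT_comp.
  rewrite -[X in measurable X]setTI.
  exact: (mb measurableT [set true]).
have := measurable_fun_ysection ms' mB; congr measurable_fun; apply/funext => c /=.
by congr (m _); apply/seteqP; split => x; rewrite /ysection/= ?inE.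
Qed.

(** Tonelli's theorem for the region 0 <= c < f x over [A]. *)
Lemma layer_cake (A : set T) (f : T -> R) : measurable A -> measurable_fun setT f ->
  (forall x, 0 <= f x) ->
  (\int[m]_(x in A) (f x)%:E =
   \int[lebesgue_measure]_(c in `[0%R, +oo[) m (A `&` [set x | (c < f x)%R]))%E.
Proof.
move=> mA mf f0; pose ms' := sigma_finite_of ms.
pose g (z : T * measurableTypeR R) : \bar R :=
  ((\1_A z.1 * (((0 <= z.2) && (z.2 < f z.1)) : bool)%:R)%:E)%E.
have mg : measurable_fun setT g.
  apply/measurable_EFinP; apply: measurable_funM.
    have mA1 : measurable_fun setT (\1_A : T -> R) by exact: measurable_indic.
    exact: measurableT_comp mA1 measurable_fst.
  apply: (measurableT_comp (f := fun b : bool => b%:R : R)) => //.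
  apply: measurable_and.
    by apply: measurable_fun_ler => //.
  by apply: measurable_fun_ltr => //; exact: measurableT_comp.
have g0 z : (0 <= g z)%E by rewrite lee_fin mulr_ge0.
have := @fubini_tonelli _ _ _ _ _ ms' (@lebesgue_measure R) g mg g0.
rewrite /=.
rewrite [X in X = _ -> _](_ : _ = \int[m]_(x in A) (f x)%:E)%E; last first.
  rewrite [RHS]integral_mkcond; apply: eq_integral => x _.
  rewrite patchE /g/= indicE; case: ifPn => xA; last first.
    by rewrite integral0_eq// => c _; rewrite mul0r.
  have E (c : measurableTypeR R) : (true%:R * (0 <= c < f x)%R%:R)%:E =
      (\1_(`[0, f x[%classic : set (measurableTypeR R)) c)%:E :> \bar R.
    by rewrite mul1r indicE mem_setE in_itv.
  under eq_integral do rewrite E.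
  rewrite integral_indic//= setIT lebesgue_measure_itv/= lte_fin.
  case: ltP => fx; rewrite ?sube0//.
  by apply/eqP; rewrite eqe eq_le f0 fx.
move=> ->; rewrite [RHS]integral_mkcond; apply: eq_integral => c _.
rewrite patchE /g/= mem_setE in_itv/= andbT; case: ifPn => c0; last first.
  by rewrite integral0_eq// => x _; rewrite mulr0.
rewrite (eq_integral (fun x => (\1_(A `&` [set x | c < f x]) x)%:E)); last first.
  move=> x _; rewrite andTb !indicE in_setI -natrM mulnb; congr ((_ && _)%:R)%:E.
  by apply/idP/idP => [cf|/set_mem//]; exact: mem_set.
rewrite integral_indic ?setIT//.
exact/measurableI/measurable_superlevel.
Qed.

Lemma layer_cake_le (A1 A2 : set T) (f1 f2 : T -> R) (k : R) : 0 <= k ->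
  measurable A1 -> measurable A2 ->
  measurable_fun setT f1 -> measurable_fun setT f2 ->
  (forall x, 0 <= f1 x) -> (forall x, 0 <= f2 x) ->
  (forall c : R, (0 <= c)%R -> k%:E * m (A1 `&` [set x | (c < f1 x)%R]) <=
     m (A2 `&` [set x | (c < f2 x)%R]))%E ->
  (k%:E * \int[m]_(x in A1) (f1 x)%:E <= \int[m]_(x in A2) (f2 x)%:E)%E.
Proof.
move=> k0 mA1 mA2 mf1 mf2 f10 f20 H; rewrite !layer_cake//.
have ml := measurable_fun_level.
have -> : (k%:E * \int[lebesgue_measure]_(c in `[0%R, +oo[) m (A1 `&` [set x | (c < f1 x)%R]) =
    \int[lebesgue_measure]_(c in `[0%R, +oo[) (k%:E * m (A1 `&` [set x | (c < f1 x)%R])))%E.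
  by rewrite ge0_integralZl_EFin//; apply: measurable_funTS; apply: ml.
apply: ge0_le_integral => //.
- by move=> c _; rewrite mule_ge0// lee_fin.
- by apply: measurable_funeM; apply: measurable_funTS; apply: ml.
- by apply: measurable_funTS; apply: ml.
- by move=> c; rewrite /= in_itv/= andbT; exact: H.
Qed.

End layer_cake.

(** * Separability: the distance as a measurable function of two points, and partitions into small
    cells *)

Section countable_partition.
Context {R : realType} {X : completeMetricType R}.

Lemma dense_sequence (x0 : X) : @separable R X ->
  exists p : nat -> X, forall x e, 0 < e -> exists n, mdist (p n) x < e.
Proof.
move=> [D cD dD].
have ne (x : X) (e : R) : 0 < e -> exists2 y, D y & mdist y x < e.
  move=> e0; have ne0 : [set y : X | mdist x y < e] !=set0.
    by exists x; rewrite /= mdistxx.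
  have [y [/= xy Dy]] := dD _ ne0 (@open_ltr_mdist R X x e).
  by exists y => //; rewrite metric_sym.
have /pfcard_geP[D0|[f]] := cD.
  by have [y] := ne x0 1 ltr01; rewrite D0.
exists f => x e e0; have [y Dy yx] := ne x e e0.
have [n _ fn] : range f y by exact: 'surj_f.
  by exists n; rewrite fn.
Qed.

Variable p : nat -> X.
Hypothesis p_dense : forall x e, 0 < e -> exists n, mdist (p n) x < e.

(** The sigma-algebra is the product of the two Borel ones. Separability writes d(x, y) < c as the
    union over n of the conditions d(p n, x) + d(p n, y) < c, each of which splits into measurable
    functions of one variable. *)
Lemma measurable_mdist2 :
  measurable_fun [set: borel X * borel X]
    (fun z : borel X * borel X => mdist (z.1 : X) z.2).
Proof.
apply: (measurability _ (RGenInftyO.measurableE R)) => _ [_ [c ->] <-].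
rewrite setTI.
rewrite (_ : _ @^-1` _ = \bigcup_n [set z : borel X * borel X | mdist (p n) z.1 + mdist (p n) z.2 < c]).
  apply: bigcup_measurable => n _.
  have md := @measurable_mdist R X (p n).
  have mf : measurable_fun setT (fun z : borel X * borel X => mdist (p n) (z.1 : X) + mdist (p n) z.2).
    by apply: measurable_funD; [exact: measurableT_comp md measurable_fst|exact: measurableT_comp md measurable_snd].
  rewrite (_ : [set z | _] = [set z : borel X * borel X | - c < - (mdist (p n) (z.1 : X) + mdist (p n) z.2)]).
    by apply: measurable_superlevel; exact: measurable_funN.
  by apply/seteqP; split => z /=; rewrite ltrN2.
apply/seteqP; split => [z /=|z [n _ /=]]; rewrite in_itv/=.
  move=> zc; have e0 : 0 < (c - mdist (z.1 : X) z.2) / 2 by rewrite divr_gt0// subr_gt0.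
  have [n nz] := p_dense z.1 e0.
  exists n => //=; have := metric_triangle (p n) z.1 z.2; lra.
move=> nz; have := metric_triangle (z.1 : X) (p n) z.2.
by rewrite (metric_sym (z.1 : X) (p n)); lra.
Qed.

Section index.
Variables (e : R) (e0 : 0 < e).

(** Index of the first ball of radius [e] around a point of the dense sequence that contains [x].
    Its level sets are Borel pieces of diameter at most 2 e that partition the space. *)
Definition ball_index (x : X) : nat := ex_minn (p_dense x e0).

Definition cell (k : nat) : set (borel X) := [set x | ball_index x = k].

Lemma cell_near k x : cell k x -> mdist (p k) x < e.
Proof. by rewrite /cell/= /ball_index; case: ex_minnP => n nx _ <-. Qed.

Lemma measurable_cell k : measurable (cell k).
Proof.
rewrite (_ : cell k = [set x : X | mdist (p k) x < e] `\` \bigcup_(j in [set j | (j < k)%N]) [set x : X | mdist (p j) x < e]).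
  apply: measurableD.
    by apply: sub_sigma_algebra; exact: open_ltr_mdist.
  apply: bigcup_measurable => j _.
  by apply: sub_sigma_algebra; exact: open_ltr_mdist.
apply/seteqP; split => [x|x [/= xk H]].
  rewrite /cell/= /ball_index; case: ex_minnP => n nx nmin <-; split=> //.
  by move=> [j /= jn /nmin]; rewrite leqNgt jn.
rewrite /cell/= /ball_index; case: ex_minnP => n nx nmin.
apply/eqP; rewrite eqn_leq nmin//= leqNgt; apply/negP => nk.
by apply: H; exists n.
Qed.

Lemma measurable_ball_index : measurable_fun [set: borel X] (ball_index : borel X -> nat).
Proof.
move=> _ B _; rewrite setTI (_ : _ @^-1` B = \bigcup_(k in B) cell k).
  by apply: bigcup_measurable => k _; exact: measurable_cell.
apply/seteqP; split => [x Bx|x [k Bk xk]]; first by exists (ball_index x).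
by rewrite /preimage/= xk.
Qed.

End index.

End countable_partition.

(** * Composition of two transport plans with a common marginal *)

Section gluing.
Context {R : realType} {X : completeMetricType R}.
Variable p : nat -> X.
Hypothesis p_dense : forall x e, 0 < e -> exists n, mdist (p n) x < e.
Implicit Types mu : borel_measure X R.
Local Notation XX := (borel X * borel X)%type.
Implicit Types q : {measure set XX -> \bar R}.

Lemma coupling_setT mu nu q : mu setT = 1%E -> coupling mu nu q -> q setT = 1%E.
Proof. by move=> mu1 /(_ setT measurableT)[]; rewrite setXTT mu1. Qed.

Variables (mu0 mu mu1 : borel_measure X R) (q1 q2 : {measure set XX -> \bar R}).
Hypotheses (mu01 : mu0 setT = 1%E) (muT : mu setT = 1%E).
Hypotheses (q1c : coupling mu0 mu q1) (q2c : coupling mu mu1 q2).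
Variables (eta : R) (eta0 : 0 < eta).

Let eta2 : 0 < eta / 2.
Proof. by rewrite divr_gt0. Qed.

Let idx := ball_index p_dense eta2.
Let D := cell p_dense eta2.

Let mass k : R := fine (mu (D k)).

Let mD k : measurable (D k). Proof. exact: measurable_cell. Qed.

Let massE k : (mass k)%:E = mu (D k).
Proof.
rewrite /mass fineK// ge0_fin_numE//; apply: (@le_lt_trans _ _ 1%E); last exact: ltry.
by rewrite -muT; apply: le_measure => //; rewrite inE.
Qed.

Let diag := [set z : XX * XX | idx z.1.2 = idx z.2.1].

Let mdiag : measurable diag.
Proof.
rewrite (_ : diag = \bigcup_k ([set z : XX * XX | D k z.1.2] `&` [set z | D k z.2.1])).
  apply: bigcup_measurable => k _; apply: measurableI.
  - rewrite -[X in measurable X]setTI.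
    exact: (measurableT_comp measurable_snd measurable_fst measurableT (mD k)).
  - rewrite -[X in measurable X]setTI.
    exact: (measurableT_comp measurable_fst measurable_snd measurableT (mD k)).
apply/seteqP; split => [z zd|z [k _ [/= zk1 zk2]]]; last first.
  by rewrite /diag /= /idx zk1 zk2.
by exists (idx z.1.2) => //; split => //=; rewrite /D /cell /= -/idx zd.
Qed.

(** Density against the product of [q1] and [q2] that makes the two plans conditionally independent
    given the cell shared by their middle points. On cells of mass 0 the inverse is 0; these cells
    are negligible by [ae_mass]. *)
Let w (z : XX * XX) : R := (mass (idx z.1.2))^-1 * \1_diag z.

Let w0 z : 0 <= w z.
Proof. by rewrite mulr_ge0// invr_ge0 fine_ge0. Qed.

Let mw : measurable_fun setT w.
Proof.
apply: measurable_funM; last exact: measurable_indic.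
have mi := @measurable_ball_index _ _ _ p_dense _ eta2.
have mn : measurable_fun [set: nat] (fun k => (mass k)^-1 : R) by [].
apply: (measurableT_comp mn); apply: (measurableT_comp mi).
exact: measurableT_comp measurable_snd measurable_fst.
Qed.

Let ae_mass : {ae mu, forall y, mass (idx y) != 0}.
Proof.
pose F k := if mass k == 0 then D k else set0.
have : mu.-negligible (\bigcup_k F k).
  apply: negligible_bigcup => k; rewrite /F; case: ifPn => [/eqP k0|_]; last exact: negligible_set0.
  by exists (D k); split=> //; have := massE k; rewrite k0 => /esym.
apply: negligibleS => y /= /negP; rewrite negbK => y0; exists (idx y) => //.
by rewrite /F y0.
Qed.

Let q1T : q1 setT = 1%E. Proof. exact: coupling_setT q1c. Qed.
Let q2T : q2 setT = 1%E. Proof. exact: coupling_setT q2c. Qed.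

Let w_cell1 (x : X) (y : X) (z' : XX) : (w ((x, y), z'))%:E =
  (((mass (idx y))^-1)%:E * (\1_(D (idx y) `*` setT) z')%:E)%E.
Proof.
rewrite /w -EFinM !indicE.
have [zd|zd] := boolP (z' \in D (idx y) `*` setT).
  have E : idx z'.1 = idx y by case: (set_mem zd).
  by rewrite mem_set// /diag/= E.
rewrite memNset ?mulr0// => H; move/negP: zd; apply; apply/mem_set; split=> //.
Qed.

Let w_cell2 (z : XX) (y' z' : X) : (w (z, (y', z')))%:E =
  (((mass (idx y'))^-1)%:E * (\1_(setT `*` D (idx y')) z)%:E)%E.
Proof.
rewrite /w -EFinM !indicE.
have [zd|zd] := boolP (z \in setT `*` D (idx y')).
  have E : idx z.2 = idx y' by case: (set_mem zd).
  by rewrite /= E mem_set.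
rewrite memNset ?mulr0// => H; move/negP: zd; apply; apply/mem_set; split=> //.
Qed.

Let w1 : {ae q1, forall z, (\int[q2]_z' (w (z, z'))%:E = 1)%E}.
Proof.
have : q1.-negligible (snd @^-1` [set y : borel X | mass (idx y) = 0]).
  have [N [mN N0 sN]] := ae_mass.
  exists (setT `*` N); split; first exact: measurableX.
    by have [_ ->] := q1c mN.
  move=> [x y] /= y0; split=> //; apply: sN => /=.
  by rewrite y0 eqxx.
apply: negligibleS => -[x y] /= H; apply: contrapT => y0; apply: H.
under eq_integral do rewrite w_cell1.
rewrite ge0_integralZl_EFin//; last 2 first.
- by apply/measurable_EFinP; apply: measurable_indic; exact: measurableX.
- by rewrite invr_ge0 fine_ge0.
rewrite integral_indic ?setIT//; last exact: measurableX.
have [-> _] := q2c (mD (idx y)).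
by rewrite -massE -EFinM mulVf//; apply/eqP.
Qed.

Let w2 : {ae q2, forall z', (\int[q1]_z (w (z, z'))%:E = 1)%E}.
Proof.
have : q2.-negligible (fst @^-1` [set y : borel X | mass (idx y) = 0]).
  have [N [mN N0 sN]] := ae_mass.
  exists (N `*` setT); split; first exact: measurableX.
    by have [->] := q2c mN.
  move=> [x y] /= y0; split=> //; apply: sN => /=.
  by rewrite y0 eqxx.
apply: negligibleS => -[x y] /= H; apply: contrapT => y0; apply: H.
under eq_integral do rewrite w_cell2.
rewrite ge0_integralZl_EFin//; last 2 first.
- by apply/measurable_EFinP; apply: measurable_indic; exact: measurableX.
- by rewrite invr_ge0 fine_ge0.
rewrite integral_indic ?setIT//; last exact: measurableX.
have [_ ->] := q1c (mD (idx x)).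
by rewrite -massE -EFinM mulVf//; apply/eqP.
Qed.

(* Approximate gluing: without disintegration, the two plans are coupled through
   the cell of a fine partition containing their common marginal, so that the two
   copies of the middle point only agree up to [eta]. *)
Lemma gluing : exists Q : {measure set (XX * XX)%type -> \bar R},
  [/\ forall E, measurable E -> Q (E `*` setT) = q1 E,
      forall E, measurable E -> Q (setT `*` E) = q2 E &
      forall g h : XX * XX -> \bar R, measurable_fun setT g -> measurable_fun setT h ->
        (forall z, 0 <= g z)%E -> (forall z, 0 <= h z)%E ->
        (forall z, (mdist (z.1.2 : X) z.2.1 < eta)%R -> g z <= h z)%E ->
        (\int[Q]_z g z <= \int[Q]_z h z)%E].
Proof.
have [Q [Q1 Q2 QI]] := density_coupling q1T q2T w0 mw w1 w2.
exists Q; split=> // g h mg mh g0 h0 gh; rewrite !QI//.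
have mwE : measurable_fun setT (fun z => (w z)%:E) by exact/measurable_EFinP.
apply: ge0_le_integral => //.
- by move=> z _; rewrite mule_ge0// lee_fin.
- exact: emeasurable_funM.
- exact: emeasurable_funM.
move=> z _; have [zd|zd] := boolP (z \in diag); last first.
  by rewrite /w indicE (negbTE zd) mulr0 !mule0.
apply: lee_wpmul2r; rewrite ?lee_fin//; apply: gh.
have {}zd : idx z.1.2 = idx z.2.1 := set_mem zd.
have n1 := @cell_near _ _ _ p_dense _ eta2 (idx z.1.2) z.1.2 erefl.
have n2 := @cell_near _ _ _ p_dense _ eta2 (idx z.1.2) z.2.1 (esym zd).
have := metric_triangle (z.1.2 : X) (p (idx z.1.2)) z.2.1.
by rewrite (metric_sym (z.1.2 : X) (p _)); lra.
Qed.

End gluing.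

(** * Intermediate points and the Brunn-Minkowski inequality *)

Section marginals.
Context {d1 d2 : measure_display} {T1 : measurableType d1} {T2 : measurableType d2}
  {R : realType}.
Variable Q : {measure set (T1 * T2)%type -> \bar R}.

Lemma marginal_integral1 (P : {measure set T1 -> \bar R}) (f : T1 -> \bar R) :
  (forall A, measurable A -> Q (A `*` setT) = P A) ->
  measurable_fun setT f -> (forall x, 0 <= f x)%E ->
  (\int[Q]_z f z.1 = \int[P]_x f x)%E.
Proof.
move=> QP mf f0.
have := @ge0_integral_pushforward _ _ _ _ R _ (@measurable_fst _ _ T1 T2) Q setT f
  measurableT mf (fun x _ => f0 x).
rewrite preimage_setT => <-; apply: eq_measure_integral => A mA _.
rewrite -QP// /pushforward; congr (Q _).
by apply/seteqP; split => [[x y]|[x y]]//= [].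
Qed.

Lemma marginal_integral2 (P : {measure set T2 -> \bar R}) (f : T2 -> \bar R) :
  (forall B, measurable B -> Q (setT `*` B) = P B) ->
  measurable_fun setT f -> (forall x, 0 <= f x)%E ->
  (\int[Q]_z f z.2 = \int[P]_x f x)%E.
Proof.
move=> QP mf f0.
have := @ge0_integral_pushforward _ _ _ _ R _ (@measurable_snd _ _ T1 T2) Q setT f
  measurableT mf (fun x _ => f0 x).
rewrite preimage_setT => <-; apply: eq_measure_integral => A mA _.
rewrite -QP// /pushforward; congr (Q _).
by apply/seteqP; split => [[x y]|[x y]]//= [].
Qed.

End marginals.

(* [a], [b], [c] are the distances x-y, y'-z and x-z for two transport plans glued
   along a midpoint known only up to an error [eta] between y and y'. *)
Lemma interpolation_defect (R : realType) (l a b c eta th : R) : 0 < l < 1 ->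
  0 <= a -> 0 <= b -> 0 <= c -> 0 <= eta -> c <= a + b + eta -> 0 <= th ->
  [\/ th = 0, 2 * th <= a - l * c | 2 * th <= b - (1 - l) * c] ->
  th ^+ 2 + c ^+ 2 <=
  (1 + eta) * (a ^+ 2 / l + b ^+ 2 / (1 - l)) + eta + eta ^+ 2.
Proof.
move=> /andP[l0 l1] a0 b0 c0 eta0 cab th0 H.
(* [e] measures the departure of (a, b) from the proportion l : 1 - l, and [s] the slack in the
   triangle inequality. Up to a multiple of [eta], the excesses a - l c and b - (1 - l) c are
   combinations of the two, so a large [th] forces |e| or [s] to be large. *)
pose e := (1 - l) * a - l * b; pose s := a + b + eta - c.
have l1' : 0 < 1 - l by rewrite subr_gt0.
have s0 : 0 <= s by rewrite /s; lra.
have Y : a ^+ 2 / l + b ^+ 2 / (1 - l) = (a + b) ^+ 2 + e ^+ 2 / (l * (1 - l)).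
  by rewrite /e; field; apply/andP; split; apply/eqP; lra.
have Yge : (a + b) ^+ 2 + e ^+ 2 <= a ^+ 2 / l + b ^+ 2 / (1 - l).
  rewrite Y lerD2l ler_pdivlMr ?mulr_gt0// ler_piMr ?sqr_ge0//; nra.
have thes : 2 * th <= `|e| + s.
  have el := ler_norm e; have eN := ler_norm (- e); rewrite normrN in eN.
  have ls : l * s <= s by rewrite ler_piMl// ltW.
  have le0 : 0 <= l * eta by rewrite mulr_ge0// ltW.
  have le1 : 0 <= (1 - l) * eta by rewrite mulr_ge0// ltW.
  case: H => [->|H|H]; first by rewrite mulr0 addr_ge0.
    have E : a - l * c = e + l * s - l * eta by rewrite /e /s; ring.
    lra.
  have E : b - (1 - l) * c = - e + (1 - l) * s - (1 - l) * eta by rewrite /e /s; ring.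
  have ls' : (1 - l) * s <= s by rewrite ler_piMl//; lra.
  lra.
have th2 : th ^+ 2 <= e ^+ 2 + s ^+ 2.
  have e2 : `|e| ^+ 2 = e ^+ 2 by rewrite real_normK ?num_real.
  have ne := normr_ge0 e; rewrite -e2.
  have := sqr_ge0 (`|e| - s).
  have : (2 * th) ^+ 2 <= (`|e| + s) ^+ 2 by rewrite lerXn2r ?nnegrE//; lra.
  nra.
have ab0 : 0 <= a + b by rewrite addr_ge0.
have cE : c = a + b + eta - s by rewrite /s; ring.
have K : (1 + eta) * ((a + b) ^+ 2 + e ^+ 2) <= (1 + eta) * (a ^+ 2 / l + b ^+ 2 / (1 - l)).
  by rewrite ler_wpM2l//; lra.
have K2 : eta * (2 * (a + b)) <= eta * ((a + b) ^+ 2 + 1).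
  by rewrite ler_wpM2l//; have := sqr_ge0 (a + b - 1); nra.
have K3 : 0 <= eta * e ^+ 2 by rewrite mulr_ge0 ?sqr_ge0.
have K4 : 0 <= c * s by rewrite mulr_ge0.
have K5 : (a + b + eta) ^+ 2 = c ^+ 2 + 2 * (c * s) + s ^+ 2 by rewrite cE; ring.
lra.
Qed.

(** * Sets of approximate intermediate points *)

Section interpolants.
Context {R : realType} {X : completeMetricType R}.

(** Approximate l-intermediate points between [x0] and points of [A]. Strict inequalities with a
    tolerance make the set open, hence Borel, even for arbitrary [A]. *)
Definition interpolant (x0 : X) (A : set X) (l dl : R) : set X :=
  [set y | exists2 z, A z & mdist x0 y < l * mdist x0 z + dl /\
                           mdist y z < (1 - l) * mdist x0 z + dl].

Lemma open_interpolant x0 A l dl : open (interpolant x0 A l dl).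
Proof.
rewrite openE => y /= [z Az [y1 y2]]; apply/nbhs_ballP.
exists (Num.min (l * mdist x0 z + dl - mdist x0 y) ((1 - l) * mdist x0 z + dl - mdist y z)).
  by rewrite /= lt_min !subr_gt0 y1 y2.
move=> y'; rewrite ballEmdist/= lt_min => /andP[y'1 y'2].
exists z => //; split.
  by have := metric_triangle x0 y y'; lra.
by have := metric_triangle y' y z; rewrite (metric_sym y' y); lra.
Qed.

Lemma measurable_interpolant x0 A l dl :
  measurable (interpolant x0 A l dl : set (borel X)).
Proof. by apply: sub_sigma_algebra; exact: open_interpolant. Qed.

Lemma metric_interpolation (dl l eps : R) (x0 x y y' z : X) : 0 < l < 1 ->
  mdist x0 x < eps -> mdist y y' <= eps ->
  [\/ dl - 2 * eps <= mdist x y - l * mdist x z,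
      dl - 2 * eps <= mdist y' z - (1 - l) * mdist x z |
      mdist x0 y < l * mdist x0 z + dl /\ mdist y z < (1 - l) * mdist x0 z + dl].
Proof.
move=> /andP[l0 l1] xe yy; have e0 : 0 <= eps := le_trans (mdist_ge0 y y') yy.
have xz : mdist x z <= eps + mdist x0 z.
  by have := metric_triangle x x0 z; rewrite (metric_sym x x0); lra.
have xy := metric_triangle x0 x y; have yz := metric_triangle y y' z.
have h1 : l * mdist x z <= l * (eps + mdist x0 z) by rewrite ler_wpM2l// ltW.
have h2 : (1 - l) * mdist x z <= (1 - l) * (eps + mdist x0 z).
  by rewrite ler_wpM2l// subr_ge0 ltW.
have le1 : l * eps <= eps by rewrite ler_piMl// ltW.
have le2 : 0 <= l * eps by rewrite mulr_ge0// ltW.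
have [y1|y1] := leP (l * mdist x0 z + dl) (mdist x0 y); first by apply: Or31; lra.
have [y2|y2] := leP ((1 - l) * mdist x0 z + dl) (mdist y z); first by apply: Or32; lra.
exact: Or33.
Qed.

Variable p : nat -> X.
Hypothesis p_dense : forall x e, 0 < e -> exists n, mdist (p n) x < e.
Local Notation XX := (borel X * borel X)%type.
Implicit Types q : {measure set XX -> \bar R}.

Let md2 := measurable_mdist2 p_dense.

Lemma coupling_compose (mu0 mu mu1 : borel_measure X R) q1 q2
    (Q : {measure set (XX * XX)%type -> \bar R}) :
  coupling mu0 mu q1 -> coupling mu mu1 q2 ->
  (forall E, measurable E -> Q (E `*` setT) = q1 E) ->
  (forall E, measurable E -> Q (setT `*` E) = q2 E) ->
  exists2 q, coupling mu0 mu1 q &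
    transport_cost q = (\int[Q]_z (mdist (z.1.1 : X) z.2.2 ^+ 2)%:E)%E.
Proof.
move=> c1 c2 Q1 Q2; pose phi (z : XX * XX) := (z.1.1, z.2.2).
have mphi : measurable_fun setT phi.
  apply: measurable_fun_pair.
    exact: (measurableT_comp measurable_fst measurable_fst).
  exact: (measurableT_comp measurable_snd measurable_snd).
exists (measure_function_pushforward__canonical__measure_function_Measure Q mphi).
  move=> A mA; rewrite /= /pushforward; split.
    have [<- _] := c1 A mA; rewrite -Q1; last exact: measurableX.
    congr (Q _); apply/seteqP; split => [[[x y] [y' z]]|[[x y] [y' z]]] /=; tauto.
  have [_ <-] := c2 A mA; rewrite -Q2; last exact: measurableX.
  congr (Q _); apply/seteqP; split => [[[x y] [y' z]]|[[x y] [y' z]]] /=; tauto.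
rewrite /transport_cost.
have := @ge0_integral_pushforward _ _ _ _ R phi mphi Q setT
  (fun z => (mdist (z.1 : X) z.2 ^+ 2)%:E) measurableT _ (fun z _ => _).
rewrite preimage_setT; apply.
- by apply/measurable_EFinP; apply: measurable_funX; exact: md2.
- by move=> z; rewrite lee_fin sqr_ge0.
Qed.

(** Two nearly optimal plans through [mu] compose to a plan from [mu0] to [mu1], whose cost is at
    least [c]. Integrating [interpolation_defect] bounds this cost plus th^2 times the mass of [mu]
    off the intermediate set by c + eta K; the two occurrences of [c] cancel and [eta] is
    arbitrarily small. *)
Lemma interpolant_concentrated (x0 : X) (mu0 mu mu1 : borel_measure X R)
    (A : set (borel X)) (c l eps dl : R) :
  mu0 setT = 1%E -> mu setT = 1%E -> 0 <= c -> 0 < l < 1 -> 0 < eps ->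
  2 * eps < dl -> measurable A -> mu0 (~` ball x0 eps) = 0%E -> mu1 (~` A) = 0%E ->
  (forall q, coupling mu0 mu1 q -> c%:E <= transport_cost q)%E ->
  (forall eta, 0 < eta -> exists2 q, coupling mu0 mu q &
     (transport_cost q <= (l ^+ 2 * c + eta)%:E)%E) ->
  (forall eta, 0 < eta -> exists2 q, coupling mu mu1 q &
     (transport_cost q <= ((1 - l) ^+ 2 * c + eta)%:E)%E) ->
  mu (~` interpolant x0 A l dl) = 0%E.
Proof.
move=> mu01 muT c0 /andP[l0 l1] eps0 epsdl mA mu0B mu1A Cge C1 C2.
set S := interpolant x0 A l dl.
have mS : measurable (~` S : set (borel X)).
  by apply: measurableC; exact: measurable_interpolant.
have mB : measurable (~` ball x0 eps : set (borel X)).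
  by apply: measurableC; exact: measurable_metric_ball.
have mAc : measurable (~` A) by exact: measurableC.
have l1' : 0 < 1 - l by rewrite subr_gt0.
pose th := (dl - 2 * eps) / 2.
have th0 : 0 < th by rewrite divr_gt0// subr_gt0.
(* Collects the errors of first order in [eta], using eta + eta^2 <= 2 eta for eta <= 1. *)
pose K := c + 2 * (l^-1 + (1 - l)^-1) + 2.
have li : 0 < l^-1 by rewrite invr_gt0.
have li' : 0 < (1 - l)^-1 by rewrite invr_gt0.
have K0 : 0 < K by rewrite /K; lra.
have muS1 : (mu (~` S) <= 1)%E by rewrite -muT; apply: le_measure => //; rewrite inE.
have muSf : mu (~` S) = (fine (mu (~` S)))%:E.
  by rewrite fineK// ge0_fin_numE// (le_lt_trans muS1)// ltry.
suff H eta : 0 < eta -> eta <= 1 -> eta <= eps ->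
    th ^+ 2 * fine (mu (~` S)) <= eta * K.
  rewrite muSf; congr EFin; apply/eqP; rewrite eq_le fine_ge0// andbT.
  rewrite leNgt; apply/negP => s0.
  have t0 : 0 < th ^+ 2 * fine (mu (~` S)) by rewrite mulr_gt0// exprn_gt0.
  set t := th ^+ 2 * fine _ in H t0.
  pose eta := Num.min (Num.min 1 eps) (t / (2 * K)).
  have eta0 : 0 < eta by rewrite !lt_min ltr01 eps0 divr_gt0// mulr_gt0.
  have := H eta eta0.
  have e1 : eta <= 1 by rewrite /eta !ge_min lexx.
  have e2 : eta <= eps by rewrite /eta !ge_min lexx orbT.
  have e3 : eta <= t / (2 * K) by rewrite /eta !ge_min lexx orbT.
  move=> /(_ e1 e2); rewrite ler_pdivlMr ?mulr_gt0// in e3; lra.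
move=> eta0 eta1 etaeps.
have [q1 q1c q1C] := C1 eta eta0; have [q2 q2c q2C] := C2 eta eta0.
have [Q [Q1 Q2 QI]] := gluing p_dense mu01 muT q1c q2c eta0.
have [q qc qC] := coupling_compose q1c q2c Q1 Q2.
have q1T : q1 setT = 1%E by exact: coupling_setT q1c.
pose g (z : XX * XX) : \bar R := ((th ^+ 2 * \1_(~` S : set (borel X)) z.1.2)%:E +
   (mdist (z.1.1 : X) z.2.2 ^+ 2)%:E)%E.
(* The indicators in [F1] and [F2] absorb the pairs for which [x] is not near [x0] or the endpoint
   is not in [A]; they integrate to 0, so the pointwise inequality may be stated everywhere. *)
pose F1 (z : XX) : \bar R := (((1 + eta) / l)%:E * (mdist (z.1 : X) z.2 ^+ 2)%:E +
   ((eta + eta ^+ 2)%:E + (th ^+ 2 * \1_(~` ball x0 eps : set (borel X)) z.1)%:E))%E.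
pose F2 (z : XX) : \bar R := (((1 + eta) / (1 - l))%:E * (mdist (z.1 : X) z.2 ^+ 2)%:E +
   (th ^+ 2 * \1_(~` A) z.2)%:E)%E.
have mdE : measurable_fun setT (fun z : XX => (mdist (z.1 : X) z.2 ^+ 2)%:E).
  by apply/measurable_EFinP; apply: measurable_funX; exact: md2.
have e1 : 0 <= 1 + eta by lra.
have e2l : 0 <= (1 + eta) / l by rewrite mulr_ge0// ltW.
have e2l' : 0 <= (1 + eta) / (1 - l) by rewrite mulr_ge0// ltW.
have ee0 : 0 <= eta + eta ^+ 2 by rewrite addr_ge0 ?sqr_ge0// ltW.
have i0 (T : Type) (B : set T) (x : T) : (0 <= (th ^+ 2 * \1_B x)%:E)%E.
  by rewrite lee_fin mulr_ge0// sqr_ge0.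
have md0 (z : XX) : (0 <= (mdist (z.1 : X) z.2 ^+ 2)%:E)%E by rewrite lee_fin sqr_ge0.
have F10 z : (0 <= F1 z)%E.
  by apply: adde_ge0; [exact: mule_ge0|apply: adde_ge0; [|exact: i0]; rewrite lee_fin].
have F20 z : (0 <= F2 z)%E by apply: adde_ge0; [exact: mule_ge0|exact: i0].
have mi (B : set (borel X)) : measurable B ->
    measurable_fun setT (fun z : XX => (th ^+ 2 * \1_B z.1)%:E).
  move=> mB'; apply/measurable_EFinP; apply: measurable_funM => //.
  have mB1 : measurable_fun setT (\1_B : borel X -> R) by exact: measurable_indic.
  exact: measurableT_comp mB1 measurable_fst.
have mi2 (B : set (borel X)) : measurable B ->
    measurable_fun setT (fun z : XX => (th ^+ 2 * \1_B z.2)%:E).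
  move=> mB'; apply/measurable_EFinP; apply: measurable_funM => //.
  have mB1 : measurable_fun setT (\1_B : borel X -> R) by exact: measurable_indic.
  exact: measurableT_comp mB1 measurable_snd.
have mF1 : measurable_fun setT F1.
  apply: emeasurable_funD; first exact: measurable_funeM.
  by apply: emeasurable_funD => //; exact: mi.
have mF2 : measurable_fun setT F2.
  apply: emeasurable_funD; first exact: measurable_funeM.
  exact: mi2.
have md1122 : measurable_fun setT (fun z : XX * XX => (mdist (z.1.1 : X) z.2.2 ^+ 2)%:E).
  have mphi : measurable_fun setT (fun z : XX * XX => (z.1.1, z.2.2)).
    apply: measurable_fun_pair.
      exact: (measurableT_comp measurable_fst measurable_fst).
    exact: (measurableT_comp measurable_snd measurable_snd).
  exact: measurableT_comp mdE mphi.
have mi12 : measurable_fun setT (fun z : XX * XX => (th ^+ 2 * \1_(~` S : set (borel X)) z.1.2)%:E).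
  exact: measurableT_comp (mi2 _ mS) measurable_fst.
have key : (\int[Q]_z g z <= \int[Q]_z (F1 z.1 + F2 z.2))%E.
  apply: QI.
  - exact: emeasurable_funD.
  - by apply: emeasurable_funD; [exact: measurableT_comp mF1 measurable_fst|
      exact: measurableT_comp mF2 measurable_snd].
  - by move=> z; rewrite adde_ge0// lee_fin ?sqr_ge0// mulr_ge0// sqr_ge0.
  - by move=> z; rewrite adde_ge0.
  move=> [[x y] [y' z]] /= yy'; rewrite /g /F1 /F2/= -!EFinM -!EFinD lee_fin.
  set a := mdist x y; set b := mdist y' z; set cc := mdist x z.
  have a0 : 0 <= a := mdist_ge0 _ _; have b0 : 0 <= b := mdist_ge0 _ _.
  have cc0 : 0 <= cc := mdist_ge0 _ _.
  have ccab : cc <= a + b + eta.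
    have := metric_triangle x y z; have := metric_triangle y y' z.
    by rewrite -/a -/b -/cc; lra.
  have := @interpolation_defect R l a b cc eta th; rewrite l0 l1 => /(_ isT a0 b0 cc0 (ltW eta0) ccab (ltW th0)) D.
  have := @interpolation_defect R l a b cc eta 0; rewrite l0 l1 => /(_ isT a0 b0 cc0 (ltW eta0) ccab (lexx _)) D0.
  rewrite !indicE.
  have T2 := sqr_ge0 th.
  have ab0 : 0 <= (1 + eta) * (a ^+ 2 / l + b ^+ 2 / (1 - l)) + eta + eta ^+ 2 - cc ^+ 2.
    by have := D0 (Or31 _ _ erefl); rewrite expr0n add0r subr_ge0.
  have Tn (t : bool) : 0 <= th ^+ 2 * t%:R by rewrite mulr_ge0.
  have E : (1 + eta) / l * a ^+ 2 + (eta + eta ^+ 2 + th ^+ 2 * (x \in ~` ball x0 eps)%:R) +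
    ((1 + eta) / (1 - l) * b ^+ 2 + th ^+ 2 * (z \in ~` A)%:R) =
    (1 + eta) * (a ^+ 2 / l + b ^+ 2 / (1 - l)) + eta + eta ^+ 2 +
    th ^+ 2 * (x \in ~` ball x0 eps)%:R + th ^+ 2 * (z \in ~` A)%:R by ring.
  rewrite E.
  have [xB|xB] := boolP (x \in ~` ball x0 eps).
    have := Tn (z \in ~` A); have : th ^+ 2 * (y \in ~` S)%:R <= th ^+ 2.
      by rewrite ler_piMr// lern1 leq_b1.
    rewrite mulr1; lra.
  have [zA|zA] := boolP (z \in ~` A).
    have : th ^+ 2 * (y \in ~` S)%:R <= th ^+ 2.
      by rewrite ler_piMr// lern1 leq_b1.
    rewrite mulr1 mulr0; lra.
  have [yS|yS] := boolP (y \in ~` S); last by rewrite !mulr0; lra.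
  rewrite !mulr0 mulr1; rewrite !addr0; apply: D.
  have {}xB : mdist x0 x < eps.
    by move: xB; rewrite notin_setE ballEmdist /= => /contrapT.
  have {}zA : A z by move: zA; rewrite notin_setE/= => /contrapT.
  have {yS}/= yS : ~ S y := set_mem yS.
  have yy1 : mdist y y' <= eps := ltW (lt_le_trans yy' etaeps).
  have thE : 2 * th = dl - 2 * eps by rewrite /th; field.
  have l01 : 0 < l < 1 by rewrite l0.
  have [h|h|[y1 y2]] := metric_interpolation dl z l01 xB yy1.
  - by apply: Or32; rewrite thE.
  - by apply: Or33; rewrite thE.
  by exfalso; apply: yS; exists z.
move: key; rewrite /g ge0_integralD//; last by move=> z _; rewrite lee_fin sqr_ge0.
rewrite -qC ge0_integralD//; last 2 first.
- exact: measurableT_comp mF1 measurable_fst.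
- exact: measurableT_comp mF2 measurable_snd.
rewrite (marginal_integral1 Q1 mF1 F10) (marginal_integral2 Q2 mF2 F20).
rewrite (marginal_integral1 Q1 (mi2 _ mS)); last first.
  by move=> z; rewrite lee_fin mulr_ge0// sqr_ge0.
have [q11 q12] : (forall B, measurable B -> q1 (B `*` setT) = mu0 B) /\
    (forall B, measurable B -> q1 (setT `*` B) = mu B) by split => B /q1c[].
have q22 B : measurable B -> q2 (setT `*` B) = mu1 B by move=> /q2c[].
have IE (P : borel_measure X R) (B : set (borel X)) : measurable B ->
    (\int[P]_x (th ^+ 2 * \1_B x)%:E = (th ^+ 2)%:E * P B)%E.
  move=> mB'; under eq_integral do rewrite EFinM.
  rewrite ge0_integralZl_EFin ?sqr_ge0//.
    by rewrite integral_indic// setIT.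
  by apply/measurable_EFinP; exact: measurable_indic.
have miX (B : set (borel X)) : measurable B ->
    measurable_fun setT (fun x : borel X => (th ^+ 2 * \1_B x)%:E).
  by move=> mB'; apply/measurable_EFinP; apply: measurable_funM => //; exact: measurable_indic.
rewrite (marginal_integral2 q12 (miX _ mS) (i0 _ _)) IE//.
have iF1 : (\int[q1]_z F1 z <= ((1 + eta) / l * (l ^+ 2 * c + eta) + (eta + eta ^+ 2))%:E)%E.
  rewrite ge0_integralD//; last 4 first.
  - by move=> z _; exact: mule_ge0.
  - exact: measurable_funeM.
  - by move=> z _; apply: adde_ge0; [rewrite lee_fin|exact: i0].
  - by apply: emeasurable_funD => //; exact: mi.
  rewrite ge0_integralZl_EFin//.
  rewrite [leRHS]EFinD; apply: leeD.
    by rewrite [leRHS]EFinM lee_wpmul2l.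
  rewrite ge0_integralD//; last first.
  - exact: mi.
  rewrite (marginal_integral1 q11 (miX _ mB) (i0 _ _)) IE// mu0B mule0 adde0.
  by rewrite integral_cst// q1T mule1.
have iF2 : (\int[q2]_z F2 z <= ((1 + eta) / (1 - l) * ((1 - l) ^+ 2 * c + eta))%:E)%E.
  rewrite ge0_integralD//; last 3 first.
  - by move=> z _; exact: mule_ge0.
  - exact: measurable_funeM.
  - exact: mi2.
  rewrite ge0_integralZl_EFin//.
  rewrite (marginal_integral2 q22 (miX _ mAc) (i0 _ _)) IE// mu1A mule0 adde0.
  by rewrite [leRHS]EFinM lee_wpmul2l.
move=> key; have := le_trans key (leeD iF1 iF2).
rewrite muSf -EFinM => {}key.
have := le_trans (leeD (lexx _) (Cge _ qc)) key; rewrite -!EFinD lee_fin => H.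
have E : (1 + eta) / l * (l ^+ 2 * c + eta) + (eta + eta ^+ 2) +
    (1 + eta) / (1 - l) * ((1 - l) ^+ 2 * c + eta) =
    c + eta * c + (eta + eta ^+ 2) * (l^-1 + (1 - l)^-1) + (eta + eta ^+ 2).
  by clear -l0 l1; field; apply/andP; split; apply/eqP; lra.
rewrite {}E in H; rewrite /K; clear -H eta0 eta1 li li'.
have e2 : eta ^+ 2 <= eta by rewrite expr2 ler_piMl// ltW.
have K1 : (eta + eta ^+ 2) * (l^-1 + (1 - l)^-1) <= 2 * eta * (l^-1 + (1 - l)^-1).
  by rewrite ler_wpM2r//; lra.
lra.
Qed.

End interpolants.

(* Jensen's inequality for the concave power [x^(1-1/N)] will be used in tangent
   form: this covers [N = 1] and needs no finiteness of the measure. *)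
Lemma powR_tangent (R : realType) (N k x : R) : 1 <= N -> 0 < k -> 0 <= x ->
  x * x `^ (- N^-1) <=
  (1 - N^-1) * k `^ (- N^-1) * x + N^-1 * k * k `^ (- N^-1).
Proof.
move=> N1 k0 x0.
have Ni : 0 < N^-1 by rewrite invr_gt0 (lt_le_trans ltr01).
have Ni1 : N^-1 <= 1 by rewrite invf_le1// (lt_le_trans ltr01).
have [->|xN0] := eqVneq x 0.
  by rewrite mul0r mulr0 add0r mulr_ge0 ?powR_ge0// mulr_ge0// ltW.
have {xN0 x0} x0 : 0 < x by rewrite lt_neqAle eq_sym xN0.
set al := N^-1 in Ni Ni1 *.
pose L := ln (x / k).
have xk : 0 < x / k by rewrite divr_gt0.
have EL : expR L = x / k by rewrite lnK// posrE.
have kE : x `^ (- al) = k `^ (- al) * expR (- al * L).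
  have -> : x = k * (x / k) by rewrite mulrCA divff ?mulr1// gt_eqF.
  rewrite powRM ?(ltW k0) ?(ltW xk)//; congr (_ * _).
  by rewrite {1}/powR gt_eqF.
have xE : x = k * expR L by rewrite EL mulrCA divff ?mulr1// gt_eqF.
rewrite kE {1 2}xE; set P := k `^ _; have P0 : 0 <= P := powR_ge0 _ _.
have main : expR L * expR (- al * L) <= (1 - al) * expR L + al.
  rewrite -expRD; set th := L + - al * L.
  have thE : th = (1 - al) * L by rewrite /th; ring.
  have e0 := expR_gt0 th.
  have h1 : expR th * (1 + al * L) <= expR L.
    have -> : L = th + al * L by rewrite thE; ring.
    rewrite [leRHS]expRD ler_wpM2l ?(ltW e0)//.
    have -> : 1 + al * (th + al * L) = 1 + al * L by rewrite thE; ring.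
    exact: expR_ge1Dx.
  have h2 : expR th * (1 - th) <= 1.
    have e1 : 1 = expR th * expR (- th) by rewrite -expRD subrr expR0.
    rewrite [leRHS]e1 ler_wpM2l ?(ltW e0)//.
    exact: expR_ge1Dx.
  have h1' : (1 - al) * (expR th * (1 + al * L)) <= (1 - al) * expR L.
    by rewrite ler_wpM2l// subr_ge0.
  have h2' : al * (expR th * (1 - th)) <= al * 1 by rewrite ler_wpM2l// ltW.
  have E : (1 - al) * (expR th * (1 + al * L)) + al * (expR th * (1 - th)) = expR th.
    by rewrite thE; ring.
  lra.
have := ler_wpM2l (mulr_ge0 (ltW k0) P0) main.
by congr (_ <= _); ring.
Qed.

(** The tangent inequality at [k], integrated over [S], gives k^(-1/N) <= (1 - 1/N) k^(-1/N) + (1/N)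
    k^(1 - 1/N) m(S), since the density has mass at most 1 on [S]. *)
Lemma density_support_ge (R : realType) (X : completeMetricType R)
    (m mu : borel_measure X R) (rho : X -> R) (S : set (borel X)) (N k : R) :
  1 <= N -> 0 < k -> has_density m mu rho -> mu setT = 1%E -> measurable S ->
  mu (~` S) = 0%E ->
  ((k `^ (- N^-1))%:E <= \int[mu]_x (rho x `^ (- N^-1))%:E)%E ->
  ((k^-1)%:E <= m S)%E.
Proof.
move=> N1 k0 [mrho rho0 muE] muT mS muS H.
have Ni : 0 < N^-1 by rewrite invr_gt0 (lt_le_trans ltr01).
have Ni1 : N^-1 <= 1 by rewrite invf_le1// (lt_le_trans ltr01).
have mpow : measurable_fun [set: borel X] (fun x => (rho x `^ (- N^-1))%:E).
  apply/measurable_EFinP; exact: (measurableT_comp (measurable_powR _) mrho).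
have p0 (x : borel X) : (0 <= (rho x `^ (- N^-1))%:E)%E by rewrite lee_fin powR_ge0.
have mC : measurable (~` S) by exact: measurableC.
have E1 : (\int[mu]_x (rho x `^ (- N^-1))%:E =
    \int[mu]_x ((rho x `^ (- N^-1))%:E * (\1_S x)%:E))%E.
  apply: ge0_ae_eq_integral => //.
  - apply: emeasurable_funM => //; apply/measurable_EFinP; exact: measurable_indic.
  - by move=> x _; rewrite mule_ge0// lee_fin.
  exists (~` S); split => // x /= /existsNP[_]; apply: contra_not => Sx.
  by rewrite indicE mem_set// mule1.
have m1 : measurable_fun [set: borel X] (fun x => (\1_S x : R)%:E).
  by apply/measurable_EFinP; exact: measurable_indic.
rewrite E1 (@ge0_integral_density _ (borel X) R m rho rho0 mrho mu muE) in H; last 2 first.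
- exact: emeasurable_funM.
- by move=> x; rewrite mule_ge0// lee_fin.
set a := k `^ (- N^-1) in H; have a0 : 0 < a by rewrite powR_gt0.
have I1 : (\int[m]_x (rho x * \1_S x)%:E <= 1)%E.
  rewrite -muT muE//; apply: ge0_le_integral => //.
  - by move=> x _; rewrite lee_fin mulr_ge0.
  - by apply/measurable_EFinP; apply: measurable_funM => //; exact: measurable_indic.
  - exact/measurable_EFinP.
  - by move=> x _; rewrite lee_fin ler_piMr// indicE lern1 leq_b1.
have H2 : (a%:E <= ((1 - N^-1) * a)%:E + (N^-1 * k * a)%:E * m S)%E.
  apply: (le_trans H).
  apply: (@le_trans _ _ (\int[m]_x (((1 - N^-1) * a)%:E * (rho x * \1_S x)%:E +
     (N^-1 * k * a)%:E * (\1_S x)%:E))%E).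
    apply: ge0_le_integral => //.
    - by move=> x _; rewrite !mule_ge0// lee_fin.
    - by apply: emeasurable_funM; [exact: emeasurable_funM|exact/measurable_EFinP].
    - apply: emeasurable_funD; apply: measurable_funeM => //.
      by apply/measurable_EFinP; apply: measurable_funM => //; exact: measurable_indic.
    move=> x _; rewrite -!EFinM -EFinD lee_fin.
    have := powR_tangent N1 k0 (rho0 x); rewrite -/a.
    rewrite indicE; case: (x \in S) => /=; last by rewrite !(mulr0,mul0r) addr0.
    by rewrite !mulr1 [rho x * _]mulrC.
  rewrite ge0_integralD//; last 4 first.
  - by move=> x _; rewrite mule_ge0// lee_fin mulr_ge0 ?subr_ge0// ltW.
  - apply: measurable_funeM.
    by apply/measurable_EFinP; apply: measurable_funM => //; exact: measurable_indic.
  - by move=> x _; rewrite mule_ge0// lee_fin ?mulr_ge0// ltW.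
  - exact: measurable_funeM.
  rewrite ge0_integralZl_EFin//; last 3 first.
  - by move=> x _; rewrite lee_fin mulr_ge0.
  - by apply/measurable_EFinP; apply: measurable_funM => //; exact: measurable_indic.
  - by rewrite mulr_ge0 ?subr_ge0// ltW.
  rewrite ge0_integralZl_EFin//; last first.
  - by rewrite !mulr_ge0// ltW.
  rewrite integral_indic// setIT leeD2r//.
  by rewrite -[leRHS]mule1 lee_wpmul2l// lee_fin mulr_ge0 ?subr_ge0// ltW.
have [->|mSf] := eqVneq (m S) +oo%E; first exact: leey.
have mSE : m S = (fine (m S))%:E by rewrite fineK// ge0_fin_numE// ltey.
move: H2; rewrite mSE -EFinM -EFinD !lee_fin; set s := fine _ => H2.
have : N^-1 * a * 1 <= N^-1 * a * (k * s) by lra.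
by rewrite ler_pM2l ?mulr_gt0// -ler_pdivrMl// mulr1.
Qed.

(** * Nearly optimal couplings; finiteness of the cost from second moments *)

Section wasserstein_tools.
Context {R : realType} {X : completeMetricType R}.
Implicit Types mu nu : borel_measure X R.

Lemma transport_cost_ge0 (q : {measure set (borel X * borel X)%type -> \bar R}) :
  (0 <= transport_cost q)%E.
Proof. by apply: integral_ge0 => z _; rewrite lee_fin sqr_ge0. Qed.

Lemma W2_EFin mu nu (w : R) : W2 mu nu = w%:E ->
  ereal_inf [set transport_cost q | q in coupling mu nu] = (w ^+ 2)%:E.
Proof.
rewrite /W2; set I := ereal_inf _.
have : (0 <= I)%E by apply: le_ereal_inf_tmp => _ [q _ <-]; exact: transport_cost_ge0.
case: I => [r| |] //=; rewrite ?lee_fin => r0.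
  by move=> -[]; rewrite powR12_sqrt// => <-; rewrite sqr_sqrtr.
by rewrite invr_eq0 pnatr_eq0.
Qed.

Lemma W2_cost mu nu (w : R) : 0 <= w ->
  ereal_inf [set transport_cost q | q in coupling mu nu] = (w ^+ 2)%:E ->
  W2 mu nu = w%:E.
Proof.
by move=> w0 E; rewrite /W2 E poweR_EFin powR12_sqrt ?sqr_ge0// sqrtr_sqr ger0_norm.
Qed.

Lemma W2_coupling mu nu (w eta : R) : W2 mu nu = w%:E -> 0 < eta ->
  exists2 q, coupling mu nu q & (transport_cost q <= (w ^+ 2 + eta)%:E)%E.
Proof.
move=> /W2_EFin E eta0.
have Ef : ereal_inf [set transport_cost q | q in coupling mu nu] \is a fin_num by rewrite E.
by have [c [q qc <-]] := lb_ereal_inf_adherent eta0 Ef; rewrite E => /ltW qE; exists q.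
Qed.

Variable p : nat -> X.
Hypothesis p_dense : forall x e, 0 < e -> exists n, mdist (p n) x < e.
Let md2 := measurable_mdist2 p_dense.

(** From (a + b)^2 <= (1 + k) a^2 + (1 + 1/k) b^2. The weight stays free because it is taken large
    when one marginal is a Dirac mass at [x0]. *)
Lemma cost_le_moments (x0 : X) mu nu (k : R) q : 0 < k -> coupling mu nu q ->
  (transport_cost q <= (1 + k)%:E * \int[mu]_x (mdist x0 x ^+ 2)%:E +
                       (1 + k^-1)%:E * \int[nu]_x (mdist x0 x ^+ 2)%:E)%E.
Proof.
move=> k0 qc; have ki0 : 0 < k^-1 by rewrite invr_gt0.
have [k1 ki1] : 0 <= 1 + k /\ 0 <= 1 + k^-1 by split; rewrite addr_ge0// ltW.
have md : measurable_fun [set: borel X] (fun x => (mdist x0 x ^+ 2)%:E).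
  by apply/measurable_EFinP; apply: measurable_funX; exact: measurable_mdist.
have md0 (x : borel X) : (0 <= (mdist x0 x ^+ 2)%:E)%E by rewrite lee_fin sqr_ge0.
have q1 B : measurable B -> q (B `*` setT) = mu B by move=> /qc[].
have q2 B : measurable B -> q (setT `*` B) = nu B by move=> /qc[].
have m1 : measurable_fun setT
    (fun z : borel X * borel X => (mdist x0 (z.1 : X) ^+ 2)%:E).
  exact: measurableT_comp md measurable_fst.
have m2 : measurable_fun setT
    (fun z : borel X * borel X => (mdist x0 (z.2 : X) ^+ 2)%:E).
  exact: measurableT_comp md measurable_snd.
rewrite -(marginal_integral1 q1 md md0) -(marginal_integral2 q2 md md0).
rewrite -!ge0_integralZl_EFin// -ge0_integralD//; last 4 first.
- by move=> z _; rewrite mule_ge0// lee_fin.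
- exact: measurable_funeM.
- by move=> z _; rewrite mule_ge0// lee_fin.
- exact: measurable_funeM.
apply: ge0_le_integral => //.
- by move=> z _; rewrite lee_fin sqr_ge0.
- by apply/measurable_EFinP; apply: measurable_funX; exact: md2.
- by apply: emeasurable_funD; exact: measurable_funeM.
move=> [x y] _ /=; rewrite -!EFinM -EFinD lee_fin.
have := metric_triangle x x0 y; rewrite (metric_sym x x0).
have := mdist_ge0 x y; have := mdist_ge0 x0 x; have := mdist_ge0 x0 y.
set a := mdist x0 x; set b := mdist x0 y; set c := mdist x y => b0 a0 c0 ab.
have : c ^+ 2 <= (a + b) ^+ 2 by rewrite lerXn2r// nnegrE addr_ge0.
have : 0 <= k^-1 * (k * a - b) ^+ 2 by rewrite mulr_ge0 ?sqr_ge0// ltW.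
have -> : k^-1 * (k * a - b) ^+ 2 = k * a ^+ 2 - 2 * (a * b) + k^-1 * b ^+ 2.
  by field; rewrite gt_eqF.
lra.
Qed.

Lemma product_coupling mu nu : mu setT = 1%E -> nu setT = 1%E ->
  exists q, coupling mu nu q.
Proof.
move=> mu1 nu1.
have h (P : borel_measure X R) : P setT = 1%E ->
    (\int[P]_y (1 : R)%:E = 1)%E by move=> PT; rewrite integral_cst// PT mule1.
have [q [q1 q2 _]] := @density_coupling _ _ _ _ _ mu nu mu1 nu1 (fun=> 1)
  (fun=> ler01) (measurable_cst _) (aeW _ (fun=> h _ nu1)) (aeW _ (fun=> h _ mu1)).
by exists q => A mA; rewrite q1// q2.
Qed.

Lemma W2_EFin_exists (x0 : X) mu nu : mu setT = 1%E -> nu setT = 1%E ->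
  (\int[mu]_x (mdist x0 x ^+ 2)%:E < +oo)%E ->
  (\int[nu]_x (mdist x0 x ^+ 2)%:E < +oo)%E ->
  exists2 w, 0 <= w & W2 mu nu = w%:E.
Proof.
move=> mu1 nu1 muf nuf; have [q qc] := product_coupling mu1 nu1.
have If : (ereal_inf [set transport_cost q | q in coupling mu nu] < +oo)%E.
  apply: (@le_lt_trans _ _ (transport_cost q)); first by apply: ereal_inf_lbound; exists q.
  apply: le_lt_trans (cost_le_moments x0 ltr01 qc) _.
  by rewrite lte_add_pinfty// lte_mul_pinfty ?lee_fin ?addr_ge0 ?invr_ge0.
have : (0 <= ereal_inf [set transport_cost q | q in coupling mu nu])%E.
  by apply: le_ereal_inf_tmp => _ [q' _ <-]; exact: transport_cost_ge0.
rewrite /W2; case: ereal_inf If => [r _ r0| |]//.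
by exists (r `^ 2^-1); [exact: powR_ge0|].
Qed.

End wasserstein_tools.

Section concentrated.
Context {R : realType} {X : completeMetricType R}.
Variables (mu : borel_measure X R) (x0 : X) (r : R).
Hypotheses (r0 : 0 < r) (mu1 : mu setT = 1%E) (muB : mu (~` ball x0 r) = 0%E).

Lemma concentrated_moment : (\int[mu]_x (mdist x0 x ^+ 2)%:E <= (r ^+ 2)%:E)%E.
Proof.
have mB : measurable (~` ball x0 r : set (borel X)).
  by apply: measurableC; exact: measurable_metric_ball.
rewrite -[leRHS]mule1 -mu1 -integral_cst//.
apply: ae_ge0_le_integral => //.
- by move=> x _; rewrite lee_fin sqr_ge0.
- by apply/measurable_EFinP; apply: measurable_funX; exact: measurable_mdist.
- by move=> x _; rewrite lee_fin sqr_ge0.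
exists (~` ball x0 r); split => // x /= /existsNP[_]; apply: contra_not.
by rewrite ballEmdist /= => xr; rewrite lee_fin lerXn2r ?nnegrE ?mdist_ge0 ?ltW.
Qed.

Lemma concentrated_P2 : P2 mu.
Proof. by split => //; exists x0; rewrite (le_lt_trans concentrated_moment)// ltry. Qed.

Lemma concentrated_bounded_support : bounded_support mu.
Proof.
have mB := @measurable_metric_ball R X.
(* A point at distance at least r + 1 has a unit ball disjoint from the ball of radius r, hence of
   mass 0, and is not in the support. *)
exists x0, (r + 1) => x xs; rewrite ballEmdist /= ltNge; apply/negP => rx.
have := xs 1 ltr01; rewrite lt_neqAle => /andP[+ _]; apply/negP; rewrite negbK eq_sym.
rewrite eq_le measure_ge0 andbT -muB le_measure ?inE//; first exact: measurableC.
move=> y; rewrite !ballEmdist /= => y1 y2.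
by have := metric_triangle x0 y x; rewrite (metric_sym y x); lra.
Qed.

End concentrated.

Lemma uniform_measure (R : realType) (X : completeMetricType R)
    (m : borel_measure X R) (A : set (borel X)) :
  measurable A -> (0 < m A < +oo)%E ->
  exists2 mu : borel_measure X R,
    has_density m mu (fun x => (fine (m A))^-1 * \1_A x) &
    mu setT = 1%E /\ mu (~` A) = 0%E.
Proof.
move=> mA /andP[mA0 mAf].
have mAE : m A = (fine (m A))%:E by rewrite fineK// ge0_fin_numE.
have a0 : 0 < fine (m A) by rewrite fine_gt0// mA0.
pose w x := (fine (m A))^-1 * \1_A x : R.
have w0 x : 0 <= w x by rewrite mulr_ge0// invr_ge0 ltW.
have mw : measurable_fun [set: borel X] w.
  by apply: measurable_funM => //; exact: measurable_indic.
exists (density_measure_pack m w0 mw); first by split.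
split; rewrite /= /density_measure.
  under eq_integral do rewrite EFinM.
  rewrite ge0_integralZl_EFin//; last by apply/measurable_EFinP; exact: measurable_indic.
  by rewrite integral_indic// setIT mAE -EFinM mulVf// gt_eqF.
by apply: integral0_eq => x /= xA; rewrite /w indicE memNset ?mulr0.
Qed.

(** * Lower bound for the measure of intermediate points *)

Section brunn_minkowski.
Context {R : realType} {X : completeMetricType R}.
Variables (m : borel_measure X R) (N : R).
Hypotheses (N1 : 1 <= N) (mms : metric_measure_space m) (cd : CD0 N m).

(** In the curvature-dimension inequality the contribution of the small ball is dropped, being
    nonnegative; that of [A] is l m(A)^(1/N) = k^(-1/N) with k = 1 / (l^N m(A)). Then
    [density_support_ge] bounds from below the measure of the set that carries the intermediate
    measure. *)
Lemma brunn_minkowski (x0 : X) (A : set (borel X)) (r l dl : R) :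
  0 < l < 1 -> 0 < dl -> measurable A -> A `<=` ball x0 r ->
  ((l `^ N)%:E * m A <= m (interpolant x0 A l dl))%E.
Proof.
move=> /andP[l0 l1] dl0 mA Ar.
have [sep _ _ mball] := mms; have [p p_dense] := dense_sequence x0 sep.
wlog r0 : r Ar / 0 < r.
  move=> /(_ (Num.max r 1)); apply; last by rewrite lt_max ltr01 orbT.
  move=> x /Ar; rewrite !ballEmdist /= => /lt_le_trans; apply.
  by rewrite le_max lexx.
have mB := @measurable_metric_ball R X x0.
have [->|mA0] := eqVneq (m A) 0%E; first by rewrite mule0.
have mA1 : (0 < m A < +oo)%E.
  rewrite lt0e mA0 measure_ge0/=; have /andP[_] := mball x0 r r0.
  by apply: le_lt_trans; rewrite le_measure ?inE.
(* Any radius with 2 eps < dl leaves the room that [interpolant_concentrated] asks for. *)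
set eps := dl / 4; have eps0 : 0 < eps by rewrite divr_gt0.
have [mu0 h0 [mu0T mu0B]] := uniform_measure (mB eps) (mball x0 eps eps0).
have [mu1 h1 [mu1T mu1A]] := uniform_measure mA mA1.
have mu1B : mu1 (~` ball x0 r) = 0%E.
  apply/eqP; rewrite eq_le measure_ge0 andbT -mu1A le_measure ?inE//.
  - exact: measurableC.
  - exact: measurableC.
  - exact: subsetC.
have mu0P := concentrated_P2 eps0 mu0T mu0B; have mu1P := concentrated_P2 r0 mu1T mu1B.
have [q [mut [rhot [[qc _] [mutP mut0 mut1 Wt] dens cdI]]]] :=
  cd mu0P mu1P (concentrated_bounded_support mu0B)
     (concentrated_bounded_support mu1B) h0 h1.
have l01 : 0 <= l <= 1 by rewrite !ltW.
have mutT : mut l setT = 1%E by have [] := mutP l l01.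
have finM (mu : borel_measure X R) s : 0 < s -> mu setT = 1%E -> mu (~` ball x0 s) = 0%E ->
    (\int[mu]_x (mdist x0 x ^+ 2)%:E < +oo)%E.
  by move=> s0 muT muB; rewrite (le_lt_trans (concentrated_moment s0 muT muB))// ltry.
have [w w0 Ww] := W2_EFin_exists p_dense mu0T mu1T (finM _ _ eps0 mu0T mu0B) (finM _ _ r0 mu1T mu1B).
have conc : mut l (~` interpolant x0 A l dl) = 0%E.
  apply: (@interpolant_concentrated _ _ p p_dense x0 mu0 (mut l) mu1 A (w ^+ 2) l eps dl) => //.
  - exact: sqr_ge0.
  - by rewrite l0.
  - by rewrite /eps; lra.
  - by move=> q' q'c; rewrite -(W2_EFin Ww); apply: ereal_inf_lbound; exists q'.
  - move=> eta eta0.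
    have W0l : W2 (mut 0) (mut l) = (l * w)%:E.
      by rewrite Wt ?lexx ?ler01// Ww sub0r normrN ger0_norm ?ltW.
    have [q' q'c q'E] := W2_coupling W0l eta0.
    exists q'; last by rewrite -exprMn.
    by move=> B mB'; have [E1 E2] := q'c B mB'; rewrite -mut0.
  - move=> eta eta0.
    have W1l : W2 (mut l) (mut 1) = ((1 - l) * w)%:E.
      rewrite Wt ?lexx ?ler01// Ww distrC ger0_norm//.
      by rewrite subr_ge0 ltW.
    have [q' q'c q'E] := W2_coupling W1l eta0.
    exists q'; last by rewrite -exprMn.
    by move=> B mB'; have [E1 E2] := q'c B mB'; rewrite -mut1.
have mAE : m A = (fine (m A))%:E by rewrite fineK// ge0_fin_numE//; case/andP: mA1.
have a0 : 0 < fine (m A) by rewrite fine_gt0.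
set a := fine (m A) in h1 mAE a0.
pose k := (l `^ N)^-1 * a^-1.
have lN0 : 0 < l `^ N by rewrite powR_gt0.
have k0 : 0 < k by rewrite mulr_gt0 ?invr_gt0.
have kN : k `^ (- N^-1) = l * a^-1 `^ (- N^-1).
  rewrite /k powRM ?invr_ge0 ?(ltW a0) ?(ltW lN0)//; congr (_ * _).
  rewrite -powRN -powRrM mulrNN divff ?powRr1 ?(ltW l0)//.
  by rewrite gt_eqF// (lt_le_trans ltr01).
have -> : ((l `^ N)%:E * m A = (k^-1)%:E)%E by rewrite mAE -EFinM /k invfM !invrK.
apply: (@density_support_ge _ _ m (mut l) (rhot l) (interpolant x0 A l dl) N k N1 k0
  (dens l l01) mutT (measurable_interpolant x0 A l dl) conc).
apply: le_trans (cdI l N l01 (lexx _)).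
have [mrho1 rho10 _] := h1.
have q2 B : measurable B -> q (setT `*` B) = mu1 B by move=> /qc[].
have mf : measurable_fun [set: borel X] (fun x => (l * (a^-1 * \1_A x) `^ (- N^-1))%:E).
  apply/measurable_EFinP; apply: measurable_funM => //.
  exact: (measurableT_comp (measurable_powR _) mrho1).
have f0 (x : borel X) : (0 <= (l * (a^-1 * \1_A x) `^ (- N^-1))%:E)%E.
  by rewrite lee_fin mulr_ge0 ?powR_ge0// ltW.
apply: (@le_trans _ _ (\int[q]_z (l * (a^-1 * \1_A z.2) `^ (- N^-1))%:E)%E).
  rewrite (marginal_integral2 q2 mf f0) kN -[leLHS]mule1 -mu1T -integral_cst//.
  apply: ae_ge0_le_integral => //.
  - by move=> x _; rewrite lee_fin mulr_ge0 ?powR_ge0// ltW.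
  - exists (~` A); split => //; first exact: measurableC.
    move=> x /= /existsNP[_]; apply: contra_not => Ax.
    by rewrite indicE mem_set// mulr1.
apply: ge0_le_integral => //.
- exact: measurableT_comp mf measurable_snd.
- apply/measurable_EFinP; apply: measurable_funD; last first.
    by move/measurable_EFinP: mf => mf1; exact: (measurableT_comp mf1 measurable_snd).
  apply: measurable_funM => //.
  have [mrho0 _ _] := h0.
  exact: (measurableT_comp (measurable_powR _) (measurableT_comp mrho0 measurable_fst)).
- by move=> z _; rewrite lee_fin lerDr mulr_ge0 ?powR_ge0// subr_ge0 ltW.
Qed.

End brunn_minkowski.

(** * Volumes of balls *)

(** Bernoulli's inequality: [powR_tangent] at k = 1 and x = s^(-p), multiplied by p s^p. *)
Lemma powR_bernoulli (R : realType) (p s : R) : 1 <= p -> 0 < s ->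
  1 + p * (s - 1) <= s `^ p.
Proof.
move=> p1 s0; have p0 : 0 < p by exact: lt_le_trans ltr01 p1.
have := powR_tangent p1 (ltr01 : 0 < 1 :> R) (powR_ge0 s (- p)).
rewrite -powRrM mulrNN divff ?gt_eqF// powRr1 ?(ltW s0)// powR1 !mulr1 => H.
have sp0 : 0 < s `^ p by rewrite powR_gt0.
have E : s `^ p * s `^ (- p) = 1 by rewrite powRN divff// gt_eqF.
have := ler_wpM2l (ltW (mulr_gt0 p0 sp0)) H.
have -> : p * s `^ p * (s `^ (- p) * s) = p * s * (s `^ p * s `^ (- p)) by ring.
have -> : p * s `^ p * ((1 - p^-1) * s `^ (- p) + p^-1) =
  (s `^ p * s `^ (- p)) * (p - p * p^-1) + p * p^-1 * s `^ p by ring.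
by rewrite E divff ?gt_eqF// mul1r mul1r mulr1; lra.
Qed.

(** The form in which limits in a scaling parameter are taken below. *)
Lemma powR_le_limit (R : realType) (p a b : R) : 1 <= p -> 0 <= a ->
  (forall s, 0 < s < 1 -> s `^ p * a <= b) -> a <= b.
Proof.
move=> p1 a0 H; rewrite leNgt; apply/negP => ba.
have p0 : 0 < p by exact: lt_le_trans ltr01 p1.
have {}a0 : 0 < a.
  rewrite lt_neqAle a0 andbT eq_sym; apply/eqP => a00.
  have := H 2^-1; rewrite a00 mulr0 invr_gt0 ltr0n invf_lt1 ?ltr0n ?ltr1n// => /(_ isT).
  by rewrite leNgt -a00 ba.
(* By Bernoulli (1 - u)^p a >= (1 - p u) a, and p u a <= (a - b) / 2 keeps this above [b]. *)
pose u := Num.min 2^-1 ((a - b) / (2 * p * a)).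
have pa : 0 < 2 * p * a by rewrite !mulr_gt0.
have u0 : 0 < u by rewrite lt_min invr_gt0 ltr0n divr_gt0// subr_gt0.
have u1 : u <= 2^-1 by rewrite /u ge_min lexx.
have u2 : u * (2 * p * a) <= a - b by rewrite -ler_pdivlMr// /u ge_min lexx orbT.
have s01 : 0 < 1 - u < 1 by apply/andP; split; lra.
have := H _ s01; have /andP[s0 _] := s01.
have := ler_wpM2r (ltW a0) (powR_bernoulli p1 s0).
have -> : 1 + p * (1 - u - 1) = 1 - p * u by ring.
have : u * p * a * 2 = u * (2 * p * a) by ring.
lra.
Qed.

(** * Integrating a power lower bound by Riemann sums on a geometric mesh *)

Section geometric_mesh.
Context {R : realType}.
Variables (J v : R -> R) (p Q T : R).
Hypotheses (p1 : 1 <= p) (Q0 : 0 <= Q).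
Hypothesis JJ : forall s t, 0 < s -> s <= t -> t <= T -> (t - s) * v s <= J t - J s.
Hypothesis vQ : forall s, 0 < s -> s <= T -> Q * s `^ (p - 1) <= v s.

Let p0 : 0 < p. Proof. exact: lt_le_trans ltr01 p1. Qed.

(** On a step [u, u th] the lower Riemann sum of the power p - 1 loses at most the factor th^(p-1).
    The ratio being constant, the loss is the same on all steps and the inequalities add up. *)
Lemma mesh_sum (th s : R) n : 1 <= th -> 0 < s -> s * th ^+ n <= T ->
  Q * ((s * th ^+ n) `^ p - s `^ p) <= th `^ (p - 1) * (p * (J (s * th ^+ n) - J s)).
Proof.
move=> th1 s0; have th0 : 0 < th := lt_le_trans ltr01 th1.
elim: n => [|n IH] uT; first by rewrite expr0 mulr1 !subrr !mulr0.
set u := s * th ^+ n in IH *.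
have u0 : 0 < u by rewrite mulr_gt0// exprn_gt0.
have uE : s * th ^+ n.+1 = u * th by rewrite exprSr mulrA.
have uu : u <= u * th by rewrite ler_peMr// ltW.
rewrite uE in uT *; have {}IH := IH (le_trans uu uT).
suff step : Q * ((u * th) `^ p - u `^ p) <= th `^ (p - 1) * (p * (J (u * th) - J u)).
  have := lerD step IH.
  have -> : Q * ((u * th) `^ p - u `^ p) + Q * (u `^ p - s `^ p) =
     Q * ((u * th) `^ p - s `^ p) by ring.
  by congr (_ <= _); ring.
have pE x : 0 < x -> x `^ p = x * x `^ (p - 1).
  by move=> x0; rewrite -{2}(powRr1 (ltW x0)) -powRD ?(gt_eqF x0) ?implybT// addrC subrK.
have thp : th `^ p - 1 <= p * th `^ (p - 1) * (th - 1).
  have := powR_tangent p1 (ltr01 : 0 < 1 :> R) (powR_ge0 th p).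
  rewrite -powRrM mulrN divff ?gt_eqF// powRN powRr1 ?(ltW th0)// powR1 !mulr1.
  have -> : th `^ p / th = th `^ (p - 1).
    by rewrite (pE th th0) mulrC mulKf// gt_eqF.
  move=> H; have := ler_wpM2l (ltW p0) H.
  have -> : p * ((1 - p^-1) * th `^ p + p^-1) = p * th `^ p - p * p^-1 * th `^ p + p * p^-1.
    by ring.
  rewrite divff ?gt_eqF// mul1r {1}(pE th th0); rewrite (pE th th0).
  have -> : p * th `^ (p - 1) * (th - 1) =
    p * (th * th `^ (p - 1)) - p * th `^ (p - 1) by ring.
  lra.
have J1 := JJ u0 uu uT; have v1 := vQ u0 (le_trans uu uT).
have d0 : 0 <= u * th - u by rewrite subr_ge0.
have J2 := le_trans (ler_wpM2l d0 v1) J1.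
have J3 := ler_wpM2l (mulr_ge0 (powR_ge0 th (p - 1)) (ltW p0)) J2.
rewrite [leRHS]mulrA; apply: le_trans J3.
rewrite powRM ?(ltW u0) ?(ltW th0)// (pE u u0).
have := ler_wpM2l (mulr_ge0 Q0 (mulr_ge0 (ltW u0) (powR_ge0 u (p - 1)))) thp.
by congr (_ <= _); ring.
Qed.

(** The integrated form of J' >= v >= Q x^(p-1), obtained by refining the mesh between s and t. *)
Lemma mesh_limit (s t : R) : 0 < s -> s <= t -> t <= T ->
  Q * (t `^ p - s `^ p) <= p * (J t - J s).
Proof.
move=> s0 st tT; have t0 : 0 < t := lt_le_trans s0 st.
have k1 : 1 <= t / s by rewrite ler_pdivlMr// mul1r.
apply: (powR_le_limit p1).
  by rewrite mulr_ge0// subr_ge0 ge0_ler_powR// ?nnegrE ltW.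
move=> e /andP[e0 e1].
pose c := ln (t / s); have c0 : 0 <= c by rewrite ln_ge0.
have le0 : ln e < 0 by rewrite ln_lt0// e0.
(* The ratio [th] is the n-th root of t / s, and this n is large enough for th <= 1 / e. *)
pose n := (Num.truncn (c / - ln e)).+1.
have nc : c / n%:R <= - ln e.
  rewrite ler_pdivrMr ?ltr0n// mulrC -ler_pdivrMr ?oppr_gt0//.
  by apply: ltW; exact: truncnS_gt.
pose th := expR (c / n%:R).
have th1 : 1 <= th by rewrite -expR0 ler_expR divr_ge0.
have thn : s * th ^+ n = t.
  rewrite -expRM_natr mulrVK ?unitfE ?pnatr_eq0// lnK ?posrE ?divr_gt0//.
  by rewrite mulrC divfK// gt_eqF.
have the : e <= th^-1.
  by rewrite -expRN -[leLHS]lnK ?posrE// ler_expR lerNr.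
have := @mesh_sum th s n th1 s0; rewrite thn => /(_ tT) H.
have th0 : 0 < th := lt_le_trans ltr01 th1.
have D0 : 0 <= Q * (t `^ p - s `^ p).
  by rewrite mulr_ge0// subr_ge0 ge0_ler_powR// ?nnegrE ltW.
apply: (@le_trans _ _ (th `^ (1 - p) * (Q * (t `^ p - s `^ p)))).
  rewrite ler_wpM2r//.
  apply: (@le_trans _ _ (th^-1 `^ p)).
    by rewrite ge0_ler_powR// ?nnegrE ?invr_ge0 ltW.
  rewrite -powR_inv1 ?(ltW th0)// -powRrM mulN1r.
  by rewrite ler_powR// lerDr.
have := ler_wpM2l (powR_ge0 th (1 - p)) H.
rewrite [X in _ <= X -> _]mulrA -powRD ?(gt_eqF th0) ?implybT//.
have -> : 1 - p + (p - 1) = 0 by ring.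
by rewrite powRr0 mul1r.
Qed.

Lemma mesh_limit0 (t : R) : 0 < t -> t <= T -> (forall s, 0 < s -> 0 <= J s) ->
  Q * t `^ p <= p * J t.
Proof.
move=> t0 tT J0; apply/ler_addgt0Pr => e e0.
pose s := Num.min (Num.min t 1) (e / (Q + 1)).
have Q1 : 0 < Q + 1 by rewrite ltr_wpDl.
have s0 : 0 < s by rewrite !lt_min t0 ltr01 divr_gt0.
have st : s <= t by rewrite /s !ge_min lexx.
have s1 : s <= 1 by rewrite /s !ge_min lexx orbT.
have s2 : s * (Q + 1) <= e by rewrite -ler_pdivlMr// /s !ge_min lexx orbT.
have := mesh_limit s0 st tT.
have sp : s `^ p <= s.
  by rewrite -[leRHS]powRr1 ?(ltW s0)// ger_powR// s0.
have := ler_wpM2l Q0 sp; have := mulr_ge0 (ltW p0) (J0 s s0).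
lra.
Qed.

End geometric_mesh.

(** * Bishop-Gromov and its equality case *)

Section volume_cone.
Context {R : realType} {X : completeMetricType R}.
Variables (m : borel_measure X R) (x0 : X) (N : R).
Hypotheses (N1 : 1 <= N) (mms : metric_measure_space m) (cd : CD0 N m).

Local Notation d := (mdist x0).
Local Notation B r := (ball x0 r : set (borel X)).
Local Notation T r := (radial x0 (tent r)).

Let N0 : 0 < N. Proof. exact: lt_le_trans ltr01 N1. Qed.

Let mB r : measurable (B r).
Proof. exact: measurable_metric_ball. Qed.

Let Bfin r : 0 < r -> (m (B r) < +oo)%E.
Proof. by have [_ _ _ h] := mms => r0; case/andP: (h x0 r r0). Qed.

Definition ball_volume (r : R) : R := fine (m (B r)).
Local Notation V := ball_volume.

Lemma ball_volumeE r : 0 < r -> m (B r) = (V r)%:E.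
Proof. by move=> r0; rewrite fineK// ge0_fin_numE// Bfin. Qed.

Lemma ball_volume_gt0 r : 0 < r -> 0 < V r.
Proof.
move=> r0; have [_ _ _ h] := mms.
by rewrite -lte_fin -ball_volumeE//; case/andP: (h x0 r r0).
Qed.

(** Contracting the ball of radius s by the factor l = e r / s, with tolerance (1 - e) r, keeps it
    inside the ball of radius r; then e tends to 1. *)
Lemma bishop_gromov (r s : R) : 0 < r -> r <= s -> V s * r `^ N <= V r * s `^ N.
Proof.
move=> r0; rewrite le_eqVlt => /orP[/eqP->//|rs].
have s0 : 0 < s := lt_trans r0 rs.
have sN : 0 < s `^ N by rewrite powR_gt0.
suff H : (r / s) `^ N * V s <= V r.
  have := ler_wpM2r (ltW sN) H; congr (_ <= _).
  rewrite mulrAC -powRM ?divr_ge0 ?(ltW r0) ?(ltW s0)//.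
  by rewrite divfK ?gt_eqF// mulrC.
apply: (powR_le_limit N1); first by rewrite mulr_ge0 ?powR_ge0// ltW// ball_volume_gt0.
move=> e /andP[e0 e1]; rewrite mulrA -powRM ?divr_ge0 ?(ltW r0) ?(ltW s0) ?(ltW e0)//.
set l := e * (r / s).
have rs1 : r / s < 1 by rewrite ltr_pdivrMr// mul1r.
have l0 : 0 < l by rewrite mulr_gt0// divr_gt0.
have l1 : l < 1 by rewrite (lt_trans _ rs1)// /l gtr_pMl// divr_gt0.
have dl0 : 0 < (1 - e) * r by rewrite mulr_gt0// subr_gt0.
have l01 : 0 < l < 1 by rewrite l0.
have := brunn_minkowski N1 mms cd l01 dl0 (mB s) (@subset_refl _ _).
rewrite ball_volumeE// -EFinM => /le_trans H.
rewrite -lee_fin -(ball_volumeE r0); apply: H; rewrite le_measure ?inE//.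
  exact: measurable_interpolant.
move=> y [z zs [yz _]]; rewrite ballEmdist /=; rewrite ballEmdist /= in zs.
apply: (lt_trans yz); have : l * d z < l * s by rewrite ltr_pM2l.
have -> : l * s = e * r by rewrite /l -mulrA divfK// gt_eqF.
lra.
Qed.

Let mtent r : measurable_fun [set: borel X] (fun x => (T r x)%:E).
Proof.
apply/measurable_EFinP; apply: measurable_funB => //; apply: measurable_funX.
by apply: measurable_minr => //; exact: measurable_mdist.
Qed.

Let tent0 r x : 0 <= r -> 0 <= T r x.
Proof. by move=> r0; apply: tent_ge0 => //; exact: mdist_ge0. Qed.

Lemma integral_tent r : 0 < r ->
  (\int[m]_x (T r x)%:E + \int[m]_(x in B r) (d x ^+ 2)%:E = (r ^+ 2 * V r)%:E)%E.
Proof.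
move=> r0.
have -> : (\int[m]_x (T r x)%:E = \int[m]_(x in B r) (T r x)%:E)%E.
  rewrite [RHS]integral_mkcond; apply: eq_integral => x _; rewrite patchE.
  case: ifPn => //; rewrite notin_setE ballEmdist/= => /negP; rewrite -leNgt => h.
  by rewrite /radial tent_large.
rewrite -ge0_integralD//; last 4 first.
- by move=> x _; rewrite lee_fin tent0// ltW.
- by apply: measurable_funTS; exact: mtent.
- by move=> x _; rewrite lee_fin sqr_ge0.
- apply: measurable_funTS; apply/measurable_EFinP; apply: measurable_funX.
  exact: measurable_mdist.
rewrite (eq_integral (fun=> (r ^+ 2)%:E)); last first.
  move=> x /set_mem; rewrite ballEmdist/= => xr; rewrite -EFinD; congr EFin.
  by rewrite /radial /tent (min_idPl (ltW xr)) subrK.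
by rewrite integral_cst// EFinM ball_volumeE.
Qed.

Definition tent_integral r := fine (\int[m]_x (T r x)%:E).
Local Notation I := tent_integral.

Lemma tent_integralE r : 0 < r -> (\int[m]_x (T r x)%:E = (I r)%:E)%E.
Proof.
move=> r0; rewrite fineK// ge0_fin_numE; last first.
  by apply: integral_ge0 => x _; rewrite lee_fin tent0// ltW.
apply: (@le_lt_trans _ _ (r ^+ 2 * V r)%:E); last exact: ltry.
rewrite -integral_tent// leeDl// integral_ge0// => x _.
by rewrite lee_fin sqr_ge0.
Qed.

(** From r to s the tent grows by s^2 - r^2 on the whole ball of radius r. So, as a function of the
    squared radius, [I] grows at rate at least [V]. *)
Lemma tent_integral_annulus r s : 0 < r -> r <= s ->
  (s ^+ 2 - r ^+ 2) * V r <= I s - I r.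
Proof.
move=> r0 rs; have s0 : 0 < s := lt_le_trans r0 rs.
have sr : 0 <= s ^+ 2 - r ^+ 2.
  by rewrite subr_ge0 lerXn2r// nnegrE ltW.
rewrite lerBrDr -lee_fin EFinD EFinM -ball_volumeE// -!tent_integralE//.
have -> : m (B r) = (\int[m]_x (\1_(B r) x)%:E)%E by rewrite integral_indic// setIT.
rewrite -ge0_integralZl_EFin//; last first.
  by apply/measurable_EFinP; exact: measurable_indic.
rewrite -ge0_integralD//; last 3 first.
- by move=> x _; rewrite -EFinM lee_fin mulr_ge0.
- by apply: measurable_funeM; apply/measurable_EFinP; exact: measurable_indic.
- by move=> x _; rewrite lee_fin tent0// ltW.
apply: ge0_le_integral => //.
- by move=> x _; rewrite adde_ge0// lee_fin ?mulr_ge0// tent0// ltW.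
- apply: emeasurable_funD => //; apply: measurable_funeM.
  by apply/measurable_EFinP; exact: measurable_indic.
move=> x _; rewrite -EFinM -EFinD lee_fin indicE.
have [xr|xr] := boolP (x \in _).
  have {}xr : d x < r by move: xr; rewrite inE ballEmdist.
  rewrite mulr1 /radial /tent (min_idPl (ltW xr)) (min_idPl (ltW (lt_le_trans xr rs))).
  by rewrite addrA subrK.
have {}xr : r <= d x.
  by move: xr; rewrite notin_setE ballEmdist /= => /negP; rewrite -leNgt.
by rewrite mulr0 add0r {1}/radial tent_large// tent0// ltW.
Qed.

Hypothesis laplacian : forall f : X -> R,
     dom_cheeger m f -> f \in Lfun m 1%E ->
     (fun x => mdist x0 x * f x) \in Lfun m 1%E ->
     (fun x => mdist x0 x * mgrad m f x) \in Lfun m 1%E ->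
     (- (\int[m]_x
           (local_grad_inner m x0 (fun y => (mdist x0 y ^+ 2)%R) f x)%:E) =
      (2 * N)%:E * \int[m]_x (f x)%:E)%E.

(** The Laplacian inequality leaves a margin around the ball, taken here as the ball of radius r /
    e. Bishop-Gromov bounds the volume of the latter by e^(-N) V(r), so the total loss is e^(-N-2),
    and e tends to 1. *)
Lemma tent_integral_le r : 0 < r -> (N + 2) * I r <= 2 * (r ^+ 2 * V r).
Proof.
move=> r0; have N21 : 1 <= N + 2 by rewrite ler_wpDr.
have I0 : 0 <= I r.
  by rewrite fine_ge0// integral_ge0// => x _; rewrite lee_fin tent0// ltW.
apply: (powR_le_limit N21); first by rewrite mulr_ge0// addr_ge0// ltW.
move=> e /andP[e0 e1].
have re0 : 0 < r / e by rewrite divr_gt0.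
have rre : r < r / e by rewrite ltr_pdivlMr// gtr_pMr.
have := laplacian_ball_ineq Bfin laplacian r0 (_ : 0 < r / e - r).
rewrite subr_gt0 rre addrC subrK => /(_ isT).
have := integral_tent re0; have rI := tent_integral_annulus r0 (ltW rre).
rewrite !tent_integralE//.
case: (\int[m]_(x in _) _)%E => [w| |]//; rewrite -EFinD -!EFinM lee_fin => -[wE H].
have V0 := ball_volume_gt0 r0.
have sq : 0 <= ((r / e) ^+ 2 - r ^+ 2) * V r.
  by rewrite mulr_ge0 ?(ltW V0)// subr_ge0 lerXn2r ?nnegrE ?ltW.
have K : (N + 2) * I r <= 2 * ((r / e) ^+ 2 * V (r / e)) by lra.
have bg := bishop_gromov r0 (ltW rre).
have E : e `^ (N + 2) = e `^ N * e ^+ 2.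
  by rewrite powRD ?(gt_eqF e0) ?implybT// -powR_mulrn// ltW.
apply: le_trans (ler_wpM2l (powR_ge0 e (N + 2)) K) _.
rewrite E (_ : e `^ N * e ^+ 2 * (2 * ((r / e) ^+ 2 * V (r / e))) =
  2 * (r ^+ 2 * (V (r / e) * e `^ N))); last by field; rewrite gt_eqF.
rewrite ler_wpM2l// ler_wpM2l ?sqr_ge0//.
have rN : 0 < r `^ N by rewrite powR_gt0.
have eN : (r / e) `^ N * e `^ N = r `^ N.
  by rewrite -powRM ?(ltW e0) ?(ltW re0)// divfK// gt_eqF.
rewrite -(ler_pM2r rN); have := ler_wpM2r (powR_ge0 e N) bg.
by rewrite -(mulrA (V r)) eN; congr (_ <= _); ring.
Qed.

(** In the variable t, the squared radius, [I] grows at rate V(sqrt t) >= Q t^(N/2), where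
    Bishop-Gromov allows Q = V(r) / r^N up to r^2 and Q = V(s) / s^N from there to s^2. With p = N/2
    + 1 the upper bound p I(s) <= s^2 V(s) then excludes V(r) / r^N > V(s) / s^N. *)
Lemma volume_cone_le r s : 0 < r -> r <= s -> V r * s `^ N <= V s * r `^ N.
Proof.
move=> r0 rs; have s0 : 0 < s := lt_le_trans r0 rs.
pose p := N / 2 + 1; have p1 : 1 <= p by rewrite lerDr divr_ge0// ltW.
pose J t := I (Num.sqrt t); pose v t := V (Num.sqrt t).
have sN u : 0 < u -> 0 < u `^ N by move=> u0; rewrite powR_gt0.
have JJ T u t : 0 < u -> u <= t -> t <= T -> (t - u) * v u <= J t - J u.
  move=> u0 ut _; have t0 : 0 < t := lt_le_trans u0 ut.
  have := @tent_integral_annulus (Num.sqrt u) (Num.sqrt t).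
  by rewrite !sqr_sqrtr ?(ltW u0) ?(ltW t0)// sqrtr_gt0 ler_wsqrtr//; apply.
have vQ u t : 0 < u -> 0 < t -> t <= u ^+ 2 -> V u / u `^ N * t `^ (p - 1) <= v t.
  move=> u0 t0 tu; have st : 0 < Num.sqrt t by rewrite sqrtr_gt0.
  have su : Num.sqrt t <= u by rewrite -(ger0_norm (ltW u0)) -sqrtr_sqr ler_wsqrtr.
  have -> : t `^ (p - 1) = Num.sqrt t `^ N.
    rewrite /p addrK -powR12_sqrt ?(ltW t0)// -powRrM mulrC.
    by [].
  by rewrite mulrAC ler_pdivrMr ?sN// bishop_gromov.
have Q0 u : 0 < u -> 0 <= V u / u `^ N.
  by move=> u0; rewrite divr_ge0 ?powR_ge0// ltW// ball_volume_gt0.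
have pE u : 0 < u -> (u ^+ 2) `^ p = u ^+ 2 * u `^ N.
  move=> u0; rewrite -powR_mulrn ?(ltW u0)// -powRrM /p mulrDr mulr1 mulrCA divff//.
  by rewrite mulr1 powRD ?(gt_eqF u0) ?implybT// mulrC.
have s2 u : 0 < u -> Num.sqrt (u ^+ 2) = u.
  by move=> u0; rewrite sqrtr_sqr ger0_norm// ltW.
have J0 t : 0 < t -> 0 <= J t.
  move=> t0; rewrite fine_ge0// integral_ge0// => x _.
  by rewrite lee_fin tent0// sqrtr_ge0.
have r2 : 0 < r ^+ 2 by rewrite exprn_gt0.
have rs2 : r ^+ 2 <= s ^+ 2 by rewrite lerXn2r// nnegrE ltW.
have := mesh_limit p1 (Q0 s s0) (JJ (s ^+ 2)) (vQ s ^~ s0) r2 rs2 (lexx _).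
have := mesh_limit0 p1 (Q0 r r0) (JJ (r ^+ 2)) (vQ r ^~ r0) r2 (lexx _) J0.
rewrite /J !s2// !pE//.
have := tent_integral_le s0.
have -> : (N + 2) * I s = 2 * (p * I s) by rewrite /p; field.
rewrite ler_pM2l//; set K := p * I s; rewrite [p * (I s - I r)]mulrBr -/K.
have -> : V r / r `^ N * (r ^+ 2 * r `^ N) = r ^+ 2 * V r.
  by rewrite mulrCA divfK// gt_eqF// sN.
have -> : V s / s `^ N * (s ^+ 2 * s `^ N - r ^+ 2 * r `^ N) =
    s ^+ 2 * V s - r ^+ 2 * (V s / s `^ N * r `^ N).
  by rewrite mulrBr mulrCA divfK ?gt_eqF ?sN// [X in _ - X]mulrCA.
move=> h1 h2 h3; have : r ^+ 2 * V r <= r ^+ 2 * (V s / s `^ N * r `^ N) by lra.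
by rewrite ler_pM2l// mulrAC ler_pdivlMr ?sN.
Qed.

Lemma volume_cone r : 0 < r -> m (B r) = (V 1 * r `^ N)%:E.
Proof.
move=> r0; rewrite ball_volumeE//; congr EFin; apply/eqP; rewrite eq_le.
have [r1|/ltW r1] := leP r 1.
  have := volume_cone_le r0 r1; have := bishop_gromov r0 r1.
  by rewrite powR1 !mulr1 => -> ->.
have := volume_cone_le ltr01 r1; have := bishop_gromov ltr01 r1.
by rewrite powR1 !mulr1 => -> ->.
Qed.

End volume_cone.

(** * Gaussian integrals *)

Section gaussian_integrals.
Context {R : realType} {X : completeMetricType R}.
Variables (m : borel_measure X R) (x0 : X) (N C : R).
Hypotheses (N1 : 1 <= N) (C0 : 0 < C) (ms : sigma_finite setT m).
Hypothesis volume : forall r, 0 < r -> m (ball x0 r) = (C * r `^ N)%:E.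

Local Notation d := (mdist x0).
Local Notation B r := (ball x0 r : set (borel X)).

Let N0 : 0 < N. Proof. exact: lt_le_trans ltr01 N1. Qed.

Let mB r : measurable (B r).
Proof. exact: measurable_metric_ball. Qed.

Let md : measurable_fun [set: borel X] d.
Proof. exact: measurable_mdist. Qed.

Definition gauss (a : R) (x : X) : R := expR (- (a * d x ^+ 2)).

Lemma gauss_ge0 a x : 0 <= gauss a x. Proof. exact: expR_ge0. Qed.

Lemma measurable_gauss a : measurable_fun [set: borel X] (gauss a).
Proof.
apply: measurableT_comp => //; apply: measurable_funN; apply: measurable_funM => //.
exact: measurable_funX.
Qed.

Lemma gauss_superlevel a c : 0 < a -> 0 < c < 1 ->
  [set x : borel X | c < gauss a x] = B (Num.sqrt (- ln c / a)).
Proof.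
move=> a0 /andP[c0 c1]; apply/seteqP.
have H x : (c < gauss a x) = (d x < Num.sqrt (- ln c / a)).
  rewrite -(lnK (c0 : c \is Num.pos)) ltr_expR expRK ltrNr.
  have lc : 0 < - ln c by rewrite oppr_gt0 ln_lt0// c0.
  rewrite -{2}(ger0_norm (mdist_ge0 x0 x)) -sqrtr_sqr ltr_sqrt ?divr_gt0//.
  by rewrite ltr_pdivlMr// mulrC.
by split => x /=; rewrite ballEmdist/= H.
Qed.

(** Serves the height 0 of the layer cake on the whole space. As N >= 1, r <= r^N for r >= 1, so the
    volumes of balls exceed any finite mass. *)
Lemma measure_full : m setT = +oo%E.
Proof.
apply/eqP; rewrite eq_le leey/= leNgt; apply/negP => mf.
have mE : m setT = (fine (m setT))%:E by rewrite fineK// ge0_fin_numE.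
pose r := 1 + fine (m setT) / C.
have t0 : 0 <= fine (m setT) / C by rewrite divr_ge0// ?fine_ge0// ltW.
have r1 : 1 <= r by rewrite /r lerDl.
have r0 : 0 < r by rewrite (lt_le_trans ltr01).
have : (m (B r) <= m (setT : set (borel X)))%E by apply: le_measure; rewrite ?inE.
rewrite mE volume// lee_fin; have rN : r <= r `^ N by rewrite -{1}(powRr1 (ltW r0)) ler_powR.
have := ler_wpM2l (ltW C0) rN; rewrite {1}/r mulrDr mulrC mul1r mulrCA divff ?gt_eqF//.
move=> h1 h2; have := le_trans h1 h2.
by rewrite mulr1 gerDr leNgt C0.
Qed.

(** Layer cake: at equal height in (0, 1) the superlevel sets of the two Gaussians are balls around
    [x0] with radii in ratio l. The last hypothesis handles the height 0, where both superlevel sets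
    are the whole space. *)
Lemma gauss_scale_le (A1 A2 : set (borel X)) (l a : R) : 0 < l -> 0 < a ->
  measurable A1 -> measurable A2 ->
  (forall r, 0 < r -> ((l `^ N)%:E * m (A1 `&` B r) <= m (A2 `&` B (l * r)))%E) ->
  ((l `^ N)%:E * m A1 <= m A2)%E ->
  ((l `^ N)%:E * \int[m]_(x in A1) (gauss a x)%:E <=
   \int[m]_(x in A2) (gauss (a / l ^+ 2) x)%:E)%E.
Proof.
move=> l0 a0 mA1 mA2 Hr HT; have al0 : 0 < a / l ^+ 2 by rewrite divr_gt0// exprn_gt0.
apply: (layer_cake_le ms (powR_ge0 l N) mA1 mA2 (measurable_gauss _) (measurable_gauss _)).
- exact: gauss_ge0.
- exact: gauss_ge0.
move=> c; rewrite le_eqVlt => /orP[/eqP <-|c0].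
  rewrite (_ : [set x | 0 < gauss a x] = setT); last first.
    by apply/seteqP; split => // x _ /=; exact: expR_gt0.
  rewrite (_ : [set x | 0 < gauss (a / l ^+ 2) x] = setT); last first.
    by apply/seteqP; split => // x _ /=; exact: expR_gt0.
  by rewrite !setIT.
have [c1|c1] := ltP c 1; last first.
  rewrite (_ : [set x | c < gauss a x] = set0); last first.
    apply/seteqP; split => // x /= /(le_lt_trans c1); apply/negP; rewrite -leNgt.
    by rewrite -expR0 ler_expR oppr_le0 mulr_ge0 ?sqr_ge0// ltW.
  by rewrite setI0 measure0 mule0.
rewrite !gauss_superlevel ?c0//.
have lc : 0 < - ln c by rewrite oppr_gt0 ln_lt0// c0.
have -> : Num.sqrt (- ln c / (a / l ^+ 2)) = l * Num.sqrt (- ln c / a).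
  rewrite invf_div mulrA mulrAC [_ * l ^+ 2]mulrC.
  by rewrite sqrtrM ?sqr_ge0// sqrtr_sqr ger0_norm// ltW.
by apply: Hr; rewrite sqrtr_gt0 divr_gt0.
Qed.

(** Absorption, with h = 1/2. Outside the ball of radius r0 the Gaussian of rate a is at most eta =
    h^(N+1) times that of rate a/4, whose integral is, by scaling, at most h^(-N) times that of rate
    a. Restricting to a ball makes the integral finite beforehand, so half of it can be moved to the
    left. *)
Lemma gauss_ball_bound (a : R) : 0 < a -> exists K : R, forall r, 0 < r ->
  (\int[m]_(x in B r) (gauss a x)%:E <= K%:E)%E.
Proof.
move=> a0; pose h : R := 2^-1; have h0 : 0 < h by rewrite invr_gt0.
have h1 : h < 1 by rewrite invf_lt1// ltr1n.
pose eta := h * h `^ N; have hN : 0 < h `^ N by rewrite powR_gt0.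
have eta0 : 0 < eta by rewrite mulr_gt0.
have hN1 : h `^ N <= 1 by rewrite -[leRHS](powRr0 h) ger_powR ?h0// ltW.
have eta1 : eta < 1 by rewrite (le_lt_trans _ h1)// ler_piMr// ltW.
have le0 : 0 < - ln eta by rewrite oppr_gt0 ln_lt0// eta0.
pose r0 := Num.sqrt (- ln eta / (3 / 4 * a)).
have a34 : 0 < 3 / 4 * a by rewrite !mulr_gt0.
have r00 : 0 < r0 by rewrite sqrtr_gt0 divr_gt0.
have pw x : gauss a x <= \1_(B r0) x + eta * gauss (a / 4) x.
  rewrite indicE; case: (boolP (x \in _)) => [_|].
    have : gauss a x <= 1 by rewrite -expR0 ler_expR oppr_le0 mulr_ge0 ?sqr_ge0// ltW.
    by move=> g1; rewrite (le_trans g1)// lerDl mulr_ge0 ?gauss_ge0// ltW.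
  rewrite notin_setE ballEmdist/= => /negP; rewrite -leNgt => r0x.
  rewrite add0r -{1}(lnK (eta0 : eta \is Num.pos)) -expRD ler_expR.
  have r0x2 : r0 ^+ 2 <= d x ^+ 2 by rewrite lerXn2r// nnegrE ?mdist_ge0// ltW.
  rewrite sqr_sqrtr ?divr_ge0 ?(ltW le0) ?(ltW a34)// in r0x2.
  rewrite ler_pdivrMr// in r0x2; lra.
exists (2 * (C * r0 `^ N)) => r rp.
have BrF : (\int[m]_(x in B r) (gauss a x)%:E < +oo)%E.
  apply: (@le_lt_trans _ _ (m (B r))); last by rewrite volume// ltry.
  rewrite -[leRHS]mul1e -integral_cst//; apply: ge0_le_integral => //.
  - by move=> x _; rewrite lee_fin gauss_ge0.
  - by apply: measurable_funTS; apply/measurable_EFinP; exact: measurable_gauss.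
  - by move=> x _; rewrite lee_fin -expR0 ler_expR oppr_le0 mulr_ge0 ?sqr_ge0// ltW.
have Y0 : (0 <= \int[m]_(x in B r) (gauss a x)%:E)%E.
  by apply: integral_ge0 => x _; rewrite lee_fin gauss_ge0.
have BI s x : 0 < s -> (B r `&` B s) x = (B (Num.min r s)) x.
  by move=> s0; rewrite /= !ballEmdist /= lt_min; apply/propext; split => [[-> ->]|/andP[]].
have scl : ((h `^ N)%:E * \int[m]_(x in B r) (gauss (a / 4) x)%:E <=
    \int[m]_(x in B r) (gauss a x)%:E)%E.
  have aE : a = a / 4 / h ^+ 2 by rewrite /h; field.
  apply: (@le_trans _ _ (\int[m]_(x in B (h * r)) (gauss a x)%:E)%E); last first.
    apply: ge0_subset_integral => //.
    - by apply: measurable_funTS; apply/measurable_EFinP; exact: measurable_gauss.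
    - by move=> x _; rewrite lee_fin gauss_ge0.
    - move=> x; rewrite !ballEmdist/= => /lt_le_trans; apply.
      by rewrite ler_piMl ?(ltW h1)// ltW.
  rewrite [in leRHS]aE; apply: gauss_scale_le => //.
  - by rewrite divr_gt0.
  - move=> s s0; have -> : B r `&` B s = B (Num.min r s).
      by apply/seteqP; split => x; rewrite BI.
    have -> : B (h * r) `&` B (h * s) = B (h * Num.min r s).
      apply/seteqP; split => x /=; rewrite !ballEmdist/= minr_pMr ?(ltW h0)// lt_min.
        by move=> [-> ->].
      by move=> /andP[].
    have m0 : 0 < Num.min r s by rewrite lt_min rp.
    rewrite !volume ?mulr_gt0// -EFinM lee_fin powRM ?(ltW h0) ?(ltW m0)//.
    by rewrite mulrCA.
  - rewrite !volume ?mulr_gt0// -EFinM lee_fin powRM ?(ltW h0) ?(ltW rp)//.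
    by rewrite mulrCA.
have main : (\int[m]_(x in B r) (gauss a x)%:E <=
    (C * r0 `^ N)%:E + h%:E * \int[m]_(x in B r) (gauss a x)%:E)%E.
  apply: (@le_trans _ _ (\int[m]_(x in B r) ((\1_(B r0) x)%:E + eta%:E * (gauss (a / 4) x)%:E))%E).
    apply: ge0_le_integral => //.
    - by move=> x _; rewrite lee_fin gauss_ge0.
    - by apply: measurable_funTS; apply/measurable_EFinP; exact: measurable_gauss.
    - apply: measurable_funTS; apply: emeasurable_funD.
        by apply/measurable_EFinP; exact: measurable_indic.
      by apply: measurable_funeM; apply/measurable_EFinP; exact: measurable_gauss.
    - by move=> x _; rewrite -EFinM -EFinD lee_fin.
  have mg : measurable_fun (B r) (fun x => (gauss (a / 4) x)%:E).
    by apply: measurable_funTS; apply/measurable_EFinP; exact: measurable_gauss.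
  have g0 (x : borel X) : (0 <= (gauss (a / 4) x)%:E)%E by rewrite lee_fin gauss_ge0.
  rewrite ge0_integralD//; last 3 first.
  - by apply/measurable_EFinP; exact: measurable_indic.
  - by move=> x _; rewrite mule_ge0// lee_fin ltW.
  - exact: measurable_funeM.
  rewrite ge0_integralZl_EFin ?(ltW eta0)//; apply: leeD.
    rewrite integral_indic// -volume// le_measure ?inE//; exact: measurableI.
  by rewrite EFinM -muleA lee_wpmul2l// lee_fin ltW.
move: BrF Y0 main; case: (\int[m]_(x in B r) _)%E => [y| |]// _ _.
by rewrite -EFinM -EFinD !lee_fin /h; lra.
Qed.

Lemma gauss_integrable (a : R) : 0 < a -> (\int[m]_x (gauss a x)%:E < +oo)%E.
Proof.
move=> a0; have [K HK] := gauss_ball_bound a0.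
apply: (@le_lt_trans _ _ K%:E); last exact: ltry.
have mono : {homo (fun n : nat => B n.+1%:R) : n k / (n <= k)%N >-> (n <= k)%O}.
  move=> n k nk; rewrite subsetEset => x; rewrite !ballEmdist/= => /lt_le_trans; apply.
  by rewrite ler_nat.
have UT : \bigcup_n B n.+1%:R = setT.
  apply/seteqP; split => // x _; exists (Num.truncn (d x)) => //.
  by rewrite ballEmdist /=; exact: truncnS_gt.
have mg n : measurable_fun (B n.+1%:R) (fun x => (gauss a x)%:E).
  by apply: measurable_funTS; apply/measurable_EFinP; exact: measurable_gauss.
have g0 n (x : borel X) : B n.+1%:R x -> (0 <= (gauss a x)%:E)%E by rewrite lee_fin gauss_ge0.
have cv := @ge0_nondecreasing_set_cvg_integral _ _ _ _ _ m mono (fun n => mB _) mg g0.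
rewrite UT in cv; rewrite -(cvg_lim _ cv)//; apply: lime_le.
  by apply/cvg_ex; eexists; exact: cv.
by apply: nearW => n; apply: HK; rewrite ltr0n.
Qed.

Definition gauss_int (a : R) : R := fine (\int[m]_x (gauss a x)%:E)%E.
Local Notation z := gauss_int.

Lemma gauss_intE (a : R) : 0 < a -> (\int[m]_x (gauss a x)%:E = (z a)%:E)%E.
Proof.
move=> a0; rewrite fineK// ge0_fin_numE ?gauss_integrable//.
by apply: integral_ge0 => x _; rewrite lee_fin gauss_ge0.
Qed.

Lemma gauss_int_gt0 (a : R) : 0 < a -> 0 < z a.
Proof.
move=> a0; rewrite -lte_fin -gauss_intE//.
apply: (@lt_le_trans _ _ ((expR (- a))%:E * m (B 1))%E).
  by rewrite volume// powR1 mulr1 -EFinM lte_fin mulr_gt0// expR_gt0.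
rewrite -integral_cst//; apply: (@le_trans _ _ (\int[m]_(x in B 1) (gauss a x)%:E)%E).
  apply: ge0_le_integral => //.
  - by move=> x _; rewrite lee_fin expR_ge0.
  - by apply: measurable_funTS; apply/measurable_EFinP; exact: measurable_gauss.
  - move=> x; rewrite ballEmdist/= => x1; rewrite lee_fin ler_expR lerN2 ler_piMr// ?(ltW a0)//.
    by rewrite expr_le1 ?mdist_ge0// ltW.
apply: ge0_subset_integral => //.
- by apply/measurable_EFinP; exact: measurable_gauss.
- by move=> x _; rewrite lee_fin gauss_ge0.
Qed.

Lemma gauss_int_scale (l a : R) : 0 < l -> 0 < a -> l `^ N * z a = z (a / l ^+ 2).
Proof.
suff H k b : 0 < k -> 0 < b -> k `^ N * z b <= z (b / k ^+ 2).
  move=> l0 a0; apply/eqP; rewrite eq_le H//=.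
  have al0 : 0 < a / l ^+ 2 by rewrite divr_gt0// exprn_gt0.
  have li0 : 0 < l^-1 by rewrite invr_gt0.
  have := H _ _ li0 al0; have -> : a / l ^+ 2 / l^-1 ^+ 2 = a by field; rewrite gt_eqF.
  have lN : 0 < l `^ N by rewrite powR_gt0.
  move=> /(ler_wpM2l (ltW lN)); rewrite mulrA -powRM ?(ltW l0) ?(ltW li0)//.
  by rewrite divff ?gt_eqF// powR1 mul1r.
move=> k0 b0; rewrite -lee_fin EFinM -!gauss_intE ?divr_gt0 ?exprn_gt0//.
apply: gauss_scale_le => //.
- move=> r r0; rewrite !setTI !volume ?mulr_gt0// -EFinM lee_fin powRM ?(ltW k0) ?(ltW r0)//.
  by rewrite mulrCA.
- by rewrite measure_full leey.
Qed.

Lemma gauss_intP (a : R) : 0 < a -> z a = a `^ (- (N / 2)) * z 1.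
Proof.
move=> a0; have l0 : 0 < a `^ (- 2^-1) by rewrite powR_gt0.
have := gauss_int_scale l0 ltr01.
rewrite -powRrM (_ : - 2^-1 * N = - (N / 2)); last by ring.
move=> ->; congr z.
rewrite -powR_mulrn ?powR_ge0// -powRrM mulNr mulVf ?pnatr_eq0//.
by rewrite powRN powRr1 ?(ltW a0)// invrK mul1r.
Qed.

Let M (a : R) : \bar R := (\int[m]_x (d x ^+ 2 * gauss a x)%:E)%E.

Let mM (a : R) : measurable_fun [set: borel X] (fun x => (d x ^+ 2 * gauss a x)%:E).
Proof.
apply/measurable_EFinP; apply: measurable_funM; first exact: measurable_funX.
exact: measurable_gauss.
Qed.

Let M0 (a : R) x : (0 <= (d x ^+ 2 * gauss a x)%:E)%E.
Proof. by rewrite lee_fin mulr_ge0 ?sqr_ge0 ?gauss_ge0. Qed.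

Let mgE a : measurable_fun [set: borel X] (fun x => (gauss a x)%:E).
Proof. by apply/measurable_EFinP; exact: measurable_gauss. Qed.

(** Convexity of exp(- a d^2) in the rate: its tangents at both ends are integrated. [M] stands for
    minus the derivative of [z]. *)
Lemma gauss_int_increment (a b : R) : 0 < a -> a < b ->
  ((z b)%:E + (b - a)%:E * M b <= (z a)%:E)%E /\ ((z a)%:E <= (z b)%:E + (b - a)%:E * M a)%E.
Proof.
move=> a0 ab; have b0 : 0 < b := lt_trans a0 ab.
have ba : 0 <= b - a by rewrite subr_ge0 ltW.
have g0 c (x : borel X) : (0 <= (gauss c x)%:E)%E by rewrite lee_fin gauss_ge0.
have gE c e x : gauss c x + (c - e) * (d x ^+ 2 * gauss c x) <= gauss e x.
  have -> : gauss e x = gauss c x * expR ((c - e) * d x ^+ 2).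
    by rewrite /gauss -expRD; congr expR; ring.
  have := ler_wpM2l (gauss_ge0 c x) (expR_ge1Dx ((c - e) * d x ^+ 2)).
  by congr (_ <= _); ring.
rewrite -!gauss_intE//; split.
  rewrite -ge0_integralZl_EFin// -ge0_integralD//; last 2 first.
  - by move=> x _; rewrite mule_ge0.
  - exact: measurable_funeM.
  apply: ge0_le_integral => //.
  - by move=> x _; rewrite adde_ge0// mule_ge0.
  - by apply: emeasurable_funD => //; exact: measurable_funeM.
  - by move=> x _; rewrite -EFinM -EFinD lee_fin.
rewrite -ge0_integralZl_EFin// -ge0_integralD//; last 2 first.
- by move=> x _; rewrite mule_ge0.
- exact: measurable_funeM.
apply: ge0_le_integral => //.
- by apply: emeasurable_funD => //; exact: measurable_funeM.
- by move=> x _; rewrite -EFinM -EFinD lee_fin; have := gE a b x; lra.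
Qed.

(** The moment is compared with the difference quotients of [z] on [e a, a] and [a, a / e]. As z is
    a multiple of a^(-N/2), its tangent lines, of slope -g, bound these quotients by g(a) up to a
    power of e, and e tends to 1. *)
Lemma gauss_second_moment (a : R) : 0 < a ->
  (\int[m]_x (d x ^+ 2 * gauss a x)%:E = (N / (2 * a) * z a)%:E)%E.
Proof.
move=> a0; rewrite -/(M a).
have Mge : (0 <= M a)%E by apply: integral_ge0 => x _; exact: M0.
have Mf : M a = (fine (M a))%:E.
  have h0 : 0 < a / 2 by rewrite divr_gt0.
  have h1 : a / 2 < a by lra.
  have [+ _] := gauss_int_increment h0 h1.
  case: (M a) Mge => [y| |]// _; rewrite gt0_muley ?lte_fin ?subr_gt0//.
have q0 : 0 <= N / 2 by rewrite divr_ge0// ltW.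
have q1 : 1 <= N / 2 + 1 by rewrite lerDr.
pose g c := N / (2 * c) * z c.
have gE c : 0 < c -> g c = N / 2 * z 1 * c `^ (- (N / 2 + 1)).
  move=> c0; rewrite /g gauss_intP// opprD powRD ?(gt_eqF c0) ?implybT//.
  rewrite powR_inv1 ?(ltW c0)//; field; rewrite gt_eqF//.
have gscale c e : 0 < c -> 0 < e -> g (e * c) = e `^ (- (N / 2 + 1)) * g c.
  move=> c0 e0; rewrite !gE ?mulr_gt0// powRM ?(ltW c0) ?(ltW e0)//; ring.
have tang b c : 0 < b -> 0 < c -> z b - (c - b) * g b <= z c.
  move=> b0 c0; rewrite /g (gauss_intP b0) (gauss_intP c0).
  have cb : 0 < c / b by rewrite divr_gt0.
  have -> : c `^ (- (N / 2)) = b `^ (- (N / 2)) * (c / b) `^ (- (N / 2)).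
    by rewrite -powRM ?(ltW b0) ?(ltW cb)// [b * _]mulrC divfK// gt_eqF.
  have : 1 - N / 2 * (c / b - 1) <= (c / b) `^ (- (N / 2)).
    rewrite /powR gt_eqF//; apply: le_trans (expR_ge1Dx _).
    rewrite lerD2l mulNr lerN2 ler_wpM2l//.
    have := @le_ln1Dx R (c / b - 1); rewrite addrCA subrr addr0; apply.
    by rewrite ltrBrDr addrC subrr.
  have P : 0 <= b `^ (- (N / 2)) * z 1 by rewrite mulr_ge0 ?powR_ge0// ltW// gauss_int_gt0.
  move=> /(ler_wpM2l P); congr (_ <= _); last by ring.
  by field; rewrite gt_eqF.
have g0 c : 0 < c -> 0 < g c.
  by move=> c0; rewrite mulr_gt0 ?gauss_int_gt0// divr_gt0// mulr_gt0.
have y0 : 0 <= fine (M a) by rewrite fine_ge0.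
set y := fine (M a) in Mf y0.
rewrite Mf; congr EFin; apply/eqP; rewrite eq_le; apply/andP; split.
  apply: (powR_le_limit q1) => //.
  move=> e /andP[e0 e1].
  have ea0 : 0 < e * a by rewrite mulr_gt0.
  have eaa : e * a < a by rewrite gtr_pMl.
  have [+ _] := gauss_int_increment ea0 eaa.
  rewrite Mf -EFinM -EFinD lee_fin; have := tang _ _ ea0 a0.
  rewrite gscale// powRN => h1 h2.
  have eN : 0 < e `^ (N / 2 + 1) by rewrite powR_gt0.
  have ba : 0 < a - e * a by rewrite subr_gt0.
  have : (a - e * a) * y <= (a - e * a) * ((e `^ (N / 2 + 1))^-1 * g a) by lra.
  by rewrite ler_pM2l// -(ler_pM2l eN) mulVKf ?gt_eqF.
apply: (powR_le_limit q1); first exact: ltW (g0 _ a0).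
move=> e /andP[e0 e1].
have ea0 : 0 < e^-1 * a by rewrite mulr_gt0 ?invr_gt0.
have eaa : a < e^-1 * a by rewrite ltr_pMl// invf_gt1.
have [_ +] := gauss_int_increment a0 eaa.
rewrite Mf -EFinM -EFinD lee_fin; have := tang _ _ ea0 a0.
rewrite gscale ?invr_gt0//.
have -> : e^-1 `^ (- (N / 2 + 1)) = e `^ (N / 2 + 1).
  by rewrite -(powR_inv1 (ltW e0)) -powRrM mulrNN mul1r.
move=> h1 h2.
have ba : 0 < e^-1 * a - a by rewrite subr_gt0.
rewrite -(ler_pM2l ba) -/(g a); lra.
Qed.

End gaussian_integrals.

(** * Couplings supported on a relation *)

Section finite_strassen.
Context {R : realType} {I J : finType}.
Variables (a : I -> R) (b : J -> R) (E : I -> J -> bool) (zeta : R).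
Hypotheses (a0 : forall i, 0 <= a i) (b0 : forall j, 0 <= b j).
Hypotheses (a1 : \sum_i a i = 1) (b1 : \sum_j b j = 1).

Let feasible (f : I -> J -> R) :=
  (forall i j, 0 <= f i j <= (if E i j then a i else 0)) /\
  (forall i, \sum_j f i j <= a i).

Let defect (f : I -> J -> R) j := \sum_i f i j - b j.

(* First-order condition for a flow minimizing the squared distance of its column
   sums to [b]: its underfull columns are those for which [hall] is sharp. *)
Let minimal_flow : exists2 f, feasible f &
  forall g, feasible g ->
    0 <= \sum_j defect f j * (\sum_i g i j - \sum_i f i j).
Proof.
pose k := #|{: I * J}|.
pose fn (v : 'rV[R]_k) i j := v ord0 (enum_rank (i, j)).
pose vn (f : I -> J -> R) : 'rV[R]_k := \row_e f (enum_val e).1 (enum_val e).2.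
have fnK f i j : fn (vn f) i j = f i j by rewrite /fn mxE enum_rankK.
pose A := [set v | feasible (fn v)].
have cfn i j : continuous (fun v => fn v i j) by exact: coord_continuous.
have csum (T : Type) (s : seq T) (h : T -> 'rV[R]_k -> R) : (forall x, continuous (h x)) ->
    continuous (fun v => \sum_(x <- s) h x v).
  move=> ch; elim: s => [|x s IH].
    rewrite (_ : (fun v => _) = cst 0); first exact: cst_continuous.
    by apply/funext => v; rewrite big_nil.
  rewrite (_ : (fun v => _) = (fun v => h x v + \sum_(x <- s) h x v)); last first.
    by apply/funext => v; rewrite big_cons.
  by move=> v; apply: continuousD; [exact: ch|exact: IH].
have cA : compact A.
  pose A1 := [set v : 'rV[R]_k | forall e, `[0, if E (enum_val e).1 (enum_val e).2 then a (enum_val e).1 else 0]%classic (v ord0 e)].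
  pose A2 := \bigcap_(i : I) [set v | \sum_j fn v i j <= a i].
  have -> : A = A1 `&` A2.
    apply/seteqP; split => [v [h1 h2]|v [h1 h2]].
      split; last by move=> i _; exact: h2.
      move=> e; rewrite /= in_itv/=; have := h1 (enum_val e).1 (enum_val e).2.
      by rewrite /fn -surjective_pairing enum_valK.
    split; last by move=> i; exact: h2.
    move=> i j; have := h1 (enum_rank (i, j)).
    by rewrite /= in_itv/= enum_rankK.
  apply: compact_closedI.
    apply: (@rV_compact R k (fun e => `[0, if E (enum_val e).1 (enum_val e).2
      then a (enum_val e).1 else 0]%classic)) => e; exact: segment_compact.
  apply: closed_bigI => i _.
  rewrite (_ : [set v | _] = (fun v => \sum_j fn v i j) @^-1` `]-oo, a i]%classic); last first.
    by apply/seteqP; split => v /=; rewrite in_itv.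
  apply: closed_comp; last exact: closed_le.
  by move=> v _; apply: csum => j; exact: cfn.
have A0 : A !=set0.
  exists 0; split => [i j|i]; first by rewrite /fn mxE; case: ifP; rewrite lexx ?a0.
  by rewrite big1// => j _; rewrite /fn mxE.
pose Phi v := \sum_j defect (fn v) j ^+ 2.
have cPhi : continuous Phi.
  have cdef j : continuous (fun v => defect (fn v) j).
    move=> v; apply: continuousB; last exact: cst_continuous.
    by apply: csum => i; exact: cfn.
  by apply: csum => j v; exact: (cvgM (cdef j v) (cdef j v)).
have [v vA vmin] := EVT_min_rV A0 cA (continuous_subspaceT cPhi).
exists (fn v); first by move: vA; rewrite inE.
move=> g gf; set D := fun j => \sum_i g i j - \sum_i fn v i j.
move: vA; rewrite inE => -[v1 v2]; have [g1 g2] := gf.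
have step s : 0 < s <= 1 -> 0 <= 2 * \sum_j defect (fn v) j * D j + s * \sum_j D j ^+ 2.
  move=> /andP[s0 s1].
  pose w := vn (fun i j => (1 - s) * fn v i j + s * g i j).
  have s1' : 0 <= 1 - s by rewrite subr_ge0.
  have wA : A w.
    split => [i j|i].
      rewrite fnK; have /andP[v10 v11] := v1 i j; have /andP[g10 g11] := g1 i j.
      rewrite addr_ge0 ?mulr_ge0 ?(ltW s0)//=.
      have h1 := ler_wpM2l s1' v11; have h2 := ler_wpM2l (ltW s0) g11.
      lra.
    under eq_bigr do rewrite fnK.
    rewrite big_split/= -!mulr_sumr.
    have h1 := ler_wpM2l s1' (v2 i); have h2 := ler_wpM2l (ltW s0) (g2 i).
    lra.
  have := vmin w; rewrite inE => /(_ wA).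
  have -> : Phi w = \sum_j (defect (fn v) j + s * D j) ^+ 2.
    apply: eq_bigr => j _; congr (_ ^+ 2); rewrite /defect/D.
    under eq_bigr do rewrite fnK.
    by rewrite big_split/= -!mulr_sumr; ring.
  rewrite -subr_ge0 /Phi -sumrB.
  have -> : \sum_j ((defect (fn v) j + s * D j) ^+ 2 - defect (fn v) j ^+ 2) =
     s * (2 * \sum_j defect (fn v) j * D j + s * \sum_j D j ^+ 2).
    rewrite !mulrDr !mulr_sumr -big_split/=; apply: eq_bigr => j _; ring.
  by rewrite pmulr_rge0.
rewrite leNgt; apply/negP => neg.
rewrite -[X in X < 0]/(\sum_j defect (fn v) j * D j) in neg.
set P := \sum_j defect (fn v) j * D j in neg step; set S := \sum_j D j ^+ 2 in step.
have S0 : 0 <= S by apply: sumr_ge0 => j _; exact: sqr_ge0.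
pose s := Num.min 1 (- P / (S + 1)).
have S1 : 0 < S + 1 by rewrite ltr_wpDl.
have s0 : 0 < s by rewrite lt_min ltr01 divr_gt0// oppr_gt0.
have s1 : s <= 1 by rewrite /s ge_min lexx.
have s2 : s * (S + 1) <= - P by rewrite -ler_pdivlMr// /s ge_min lexx orbT.
have := step s; rewrite s0 s1 => /(_ isT); lra.
Qed.

Hypothesis hall : forall S : {set J},
  \sum_(j in S) b j <= \sum_(i | [exists j, (j \in S) && E i j]) a i + zeta.

(** In the minimal flow, each row related to the set [S] of underfull columns spends all its mass in
    [S], so Hall's condition for [S] bounds the total deficit by [zeta]. Overfull columns are scaled
    down, and the residual row and column masses, of common total [D], are matched by a product;
    only this last part may leave the relation. *)
Lemma finite_strassen : exists f : I -> J -> R,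
  [/\ forall i j, 0 <= f i j, forall i, \sum_j f i j = a i,
      forall j, \sum_i f i j = b j &
      \sum_i \sum_(j | ~~ E i j) f i j <= zeta].
Proof.
have [f [f1 f2] fmin] := minimal_flow.
pose L j := \sum_i f i j; pose x j := L j - b j.
have f0 i j : 0 <= f i j by have /andP[] := f1 i j.
have fE i j : ~~ E i j -> f i j = 0.
  move=> nE; have := f1 i j; rewrite (negbTE nE) => fij; apply/eqP.
  by rewrite eq_le andbC.
pose S := [set j | x j < 0]%SET.
have rowS i : [exists j, (j \in S) && E i j] -> a i <= \sum_(j in S) f i j.
  move=> /existsP[j0 /andP[j0S j0E]].
  have [j1 j1E j1min] := @Order.TotalTheory.arg_minP _ _ _ j0 (E i) x j0E.
  have x1 : x j1 < 0 by apply: le_lt_trans (j1min _ j0E) _; move: j0S; rewrite inE.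
  (* Competitor that sends the whole row [i] to its related column of least defect. Minimality
     bounds the sum of x_j f_ij by x_j1 a_i, and division by the negative x_j1 reverses the
     inequality. *)
  pose g k j := if k == i then (if j == j1 then a i else 0) else f k j.
  have gf : feasible g.
    split => [k j|k]; rewrite /g.
      have [->|_] := eqVneq k i; last exact: f1.
      have [->|_] := eqVneq j j1; first by rewrite j1E a0 lexx.
      by case: ifP; rewrite lexx ?a0.
    have [->|_] := eqVneq k i; last exact: f2.
    by rewrite -big_mkcond/= big_pred1_eq.
  have := fmin g gf.
  under eq_bigr => j _.
    rewrite -sumrB (bigD1 i)//= big1 ?addr0; last first.
      by move=> k ki; rewrite /g (negbTE ki) subrr.
    rewrite /g eqxx -/(x j); over.
  under eq_bigr do rewrite mulrBr.
  rewrite sumrB; rewrite (bigD1 j1)//= eqxx big1 ?addr0; last first.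
    by move=> j /negbTE->; rewrite mulr0.
  rewrite subr_ge0 => h1.
  have h2 : x j1 * \sum_(j in S) f i j <= \sum_j x j * f i j.
    rewrite mulr_sumr [leRHS](bigID (mem S))/= -[leLHS]addr0 lerD//.
      apply: ler_sum => j _; have [Ej|nE] := boolP (E i j); last by rewrite fE ?mulr0.
      by rewrite ler_wpM2r// j1min.
    apply: sumr_ge0 => j; rewrite inE -leNgt => xj.
    by rewrite mulr_ge0.
  by have := le_trans h2 h1; rewrite ler_nM2l.
have deficit : \sum_(j in S) (b j - L j) <= zeta.
  rewrite sumrB lerBlDl; apply: le_trans (hall S) _; rewrite lerD2r.
  rewrite /L exchange_big/= big_mkcond/=; apply: ler_sum => i _.
  case: ifP => [/rowS//|_]; exact: sumr_ge0.
have L0 j : 0 <= L j by apply: sumr_ge0.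
pose c j := if j \in S then 1 else b j / L j.
have c0 j : 0 <= c j by rewrite /c; case: ifP => // _; rewrite divr_ge0.
have c1 j : c j <= 1.
  rewrite /c; case: ifPn => //; rewrite inE -leNgt subr_ge0 => bL.
  have [->|Lj] := eqVneq (L j) 0; first by rewrite invr0 mulr0.
  by rewrite ler_pdivrMr ?mul1r// lt_neqAle eq_sym Lj L0.
have cL j : j \notin S -> c j * L j = b j.
  move=> jS; rewrite /c (negbTE jS); move: jS; rewrite inE -leNgt subr_ge0 => bL.
  have [L00|Lj] := eqVneq (L j) 0; last by rewrite divfK.
  by apply/eqP; rewrite L00 mulr0 eq_le b0 -L00 bL.
pose h i j := c j * f i j.
pose r i := a i - \sum_j h i j; pose q j := b j - \sum_i h i j.
have r0 i : 0 <= r i.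
  rewrite subr_ge0; apply: le_trans (f2 i); apply: ler_sum => j _.
  by rewrite ler_piMl.
have qE j : q j = if j \in S then b j - L j else 0.
  rewrite /q /h -mulr_sumr -/(L j); case: ifPn => [jS|/cL ->]; last by rewrite subrr.
  by rewrite /c jS mul1r.
have q0 j : 0 <= q j.
  by rewrite qE; case: ifP => //; rewrite inE => /ltW; rewrite subr_le0 subr_ge0.
pose D := \sum_j q j.
have Dz : D <= zeta.
  rewrite /D; under eq_bigr do rewrite qE.
  by rewrite -big_mkcond.
have D0 : 0 <= D by apply: sumr_ge0.
have rD : \sum_i r i = D.
  by rewrite /D /r /q !sumrB a1 b1 exchange_big.
(* For [D = 0] the quotient is 0 by convention, and all residues vanish. *)
exists (fun i j => h i j + r i * q j / D); split.
- by move=> i j; rewrite addr_ge0 ?mulr_ge0 ?invr_ge0.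
- move=> i; rewrite big_split/= -mulr_suml -mulr_sumr -/D.
  have [D00|DN0] := eqVneq D 0; last by rewrite mulfK// /r addrC subrK.
  rewrite D00 mulr0 mul0r addr0; apply/eqP; rewrite eq_sym -subr_eq0; apply/eqP.
  have /psumr_eq0P : \sum_i r i = 0 by rewrite rD.
  by apply.
- move=> j; rewrite big_split/= -mulr_suml -mulr_suml rD.
  have [D00|DN0] := eqVneq D 0; last by rewrite mulrAC divff// mul1r /q addrC subrK.
  rewrite D00 mul0r mul0r addr0; apply/eqP; rewrite eq_sym -subr_eq0; apply/eqP.
  have /psumr_eq0P : \sum_j q j = 0 by [].
  by apply.
apply: le_trans Dz; apply: (@le_trans _ _ (\sum_i \sum_j r i * q j / D)).
  apply: ler_sum => i _; rewrite big_mkcond/=; apply: ler_sum => j _.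
  case: ifPn => [nE|_]; first by rewrite /h fE// mulr0 add0r.
  by rewrite !mulr_ge0 ?invr_ge0.
under eq_bigr do rewrite -mulr_suml -mulr_sumr -/D.
rewrite -mulr_suml -mulr_suml rD.
have [->|DN0] := eqVneq D 0; first by rewrite !mul0r.
by rewrite mulfK.
Qed.

End finite_strassen.

(** Exhaustion by balls. Unbounded sets occur at the height 0 of the layer cake, where the
    superlevel set of a Gaussian is the whole space. *)
Lemma brunn_minkowski_unbounded (R : realType) (X : completeMetricType R)
    (m : borel_measure X R) (N : R) (x0 : X) (A : set (borel X)) (l dl : R) :
  1 <= N -> metric_measure_space m -> CD0 N m ->
  0 < l < 1 -> 0 < dl -> measurable A ->
  ((l `^ N)%:E * m A <= m (interpolant x0 A l dl))%E.
Proof.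
move=> N1 mms cd l01 dl0 mA.
have mB := @measurable_metric_ball R X x0.
pose F n : set (borel X) := A `&` ball x0 n%:R.
have mF n : measurable (F n) by exact: measurableI.
have AU : \bigcup_n F n = A.
  apply/seteqP; split => [x [n _ []]//|x Ax].
  exists (Num.truncn (mdist x0 x)).+1 => //; split => //.
  by rewrite ballEmdist /=; exact: truncnS_gt.
have Fn : {homo F : n k / (n <= k)%N >-> (n <= k)%O}.
  move=> n k nk; rewrite subsetEset => x [Ax]; rewrite !ballEmdist/= => xn; split => //.
  by rewrite ballEmdist /= (lt_le_trans xn)// ler_nat.
have cv := @nondecreasing_cvg_mu _ _ _ m F mF (bigcup_measurable (fun n _ => mF n)) Fn.
rewrite AU in cv; have := cvgeZl (isT : (l `^ N)%:E \is a fin_num) cv.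
move=> /cvg_lim <-//; apply: lime_le.
  by apply: is_cvgeZl => //; apply/cvg_ex; exists (m A).
apply: nearW => n /=.
apply: le_trans (brunn_minkowski N1 mms cd l01 dl0 (mF n) (@subIsetr _ _ _)) _.
rewrite le_measure ?inE//; try exact: measurable_interpolant.
by move=> y [z [Az _] yz]; exists z.
Qed.

(** * Couplings adapted to finite partitions *)

Section finite_valued.
Context {d : measure_display} {T : measurableType d} {R : realType} {I : finType}.
Variables (P : {measure set T -> \bar R}) (iota : T -> I) (a : I -> R).
Hypotheses (miota : forall i, measurable (iota @^-1` [set i])).
Hypothesis aE : forall i, P (iota @^-1` [set i]) = (a i)%:E.

Let finite_valuedE (h : I -> R) x :
  h (iota x) = \sum_i h i * \1_(iota @^-1` [set i]) x.
Proof.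
rewrite (bigD1 (iota x))//= indicE mem_set// mulr1 big1 ?addr0// => i ix.
by rewrite indicE memNset ?mulr0//= => xi; rewrite xi eqxx in ix.
Qed.

Lemma measurable_finite_valued (h : I -> R) : measurable_fun setT (h \o iota).
Proof.
rewrite (_ : h \o iota = fun x => \sum_i h i * \1_(iota @^-1` [set i]) x); last first.
  by apply/funext => x; exact: finite_valuedE.
apply: measurable_sum => i; apply: measurable_funM => //; exact: measurable_indic.
Qed.

Lemma integral_finite_valued (h : I -> R) : (forall i, 0 <= h i) ->
  (\int[P]_x (h (iota x))%:E = (\sum_i h i * a i)%:E)%E.
Proof.
move=> h0; under eq_integral do rewrite finite_valuedE -sumEFin.
rewrite ge0_integral_sum//; last 2 first.
- move=> i; apply/measurable_EFinP; apply: measurable_funM => //; exact: measurable_indic.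
- by move=> i x _; rewrite lee_fin mulr_ge0.
rewrite -sumEFin; apply: eq_bigr => i _; under eq_integral do rewrite EFinM.
rewrite ge0_integralZl_EFin//; last by apply/measurable_EFinP; exact: measurable_indic.
by rewrite integral_indic// setIT aE -EFinM.
Qed.

Lemma measurable_finite_valued_set (B : pred I) : measurable [set x | B (iota x)].
Proof.
rewrite (_ : [set x | _] = setT `&` ((fun i => (B i)%:R : R) \o iota) @^-1` [set 1]).
  exact: (measurable_finite_valued _ measurableT (measurable_set1 _)).
rewrite setTI; apply/seteqP; split => x /=; case: (B _) => //.
by move/esym/eqP; rewrite oner_eq0.
Qed.

Lemma finite_valued_set (B : pred I) : P [set x | B (iota x)] = (\sum_(i | B i) a i)%:E.
Proof.
rewrite -[X in P X]setIT -integral_indic//; last exact: measurable_finite_valued_set.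
rewrite (eq_integral (fun x => ((B (iota x))%:R : R)%:E)); last first.
  move=> x _; rewrite indicE; case: (boolP (B (iota x))) => Bx; first by rewrite mem_set.
  by rewrite memNset//; exact/negP.
rewrite (integral_finite_valued (h := fun i => (B i)%:R))//; congr EFin.
by rewrite [RHS]big_mkcond/=; apply: eq_bigr => i _; case: (B i); rewrite ?mul1r ?mul0r.
Qed.

Lemma finite_valued_ae : {ae P, forall x, a (iota x) != 0}.
Proof.
exists [set x | a (iota x) == 0]; split.
- exact: (measurable_finite_valued_set (fun i => a i == 0)).
- rewrite [LHS](finite_valued_set (fun i => a i == 0)) big1// => i /eqP //.
- by move=> x /= /negP; rewrite negbK.
Qed.

End finite_valued.

Section block_coupling.
Context {d1 d2 : measure_display} {T1 : measurableType d1} {T2 : measurableType d2}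
  {R : realType} {I J : finType}.
Variables (P1 : {measure set T1 -> \bar R}) (P2 : {measure set T2 -> \bar R}).
Variables (iota1 : T1 -> I) (iota2 : T2 -> J) (a : I -> R) (b : J -> R) (F : I -> J -> R).
Hypotheses (P1T : P1 setT = 1%E) (P2T : P2 setT = 1%E).
Hypotheses (m1 : forall i, measurable (iota1 @^-1` [set i]))
  (m2 : forall j, measurable (iota2 @^-1` [set j])).
Hypotheses (aE : forall i, P1 (iota1 @^-1` [set i]) = (a i)%:E)
  (bE : forall j, P2 (iota2 @^-1` [set j]) = (b j)%:E).
Hypotheses (F0 : forall i j, 0 <= F i j) (Fa : forall i, \sum_j F i j = a i)
  (Fb : forall j, \sum_i F i j = b j).

(** On each block, the product measure rescaled by F i j / (a i b j). Where the denominator is 0 so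
    is [F i j], which makes the convention for division by 0 consistent. *)
Lemma block_coupling : exists Q : {measure set (T1 * T2)%type -> \bar R},
  [/\ forall A, measurable A -> Q (A `*` setT) = P1 A,
      forall B, measurable B -> Q (setT `*` B) = P2 B &
      forall h : I -> J -> R, (forall i j, 0 <= h i j) ->
        (\int[Q]_z (h (iota1 z.1) (iota2 z.2))%:E =
         (\sum_i \sum_j h i j * F i j)%:E)%E].
Proof.
have a0 i : 0 <= a i by rewrite -Fa sumr_ge0.
have b0 j : 0 <= b j by rewrite -Fb sumr_ge0.
have Fa0 i j : a i = 0 -> F i j = 0.
  by rewrite -Fa => /psumr_eq0P; apply.
have Fb0 i j : b j = 0 -> F i j = 0.
  by rewrite -Fb => /psumr_eq0P; apply.
pose c i j := F i j / (a i * b j).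
have c0 i j : 0 <= c i j by rewrite divr_ge0// mulr_ge0.
pose iota (z : T1 * T2) := (iota1 z.1, iota2 z.2).
have iotaE i j : iota @^-1` [set (i, j)] = (iota1 @^-1` [set i]) `*` (iota2 @^-1` [set j]).
  by apply/seteqP; split => -[x y] /=; [case => <- <-|case => <- <-].
have miota k : measurable (iota @^-1` [set k]).
  by case: k => i j; rewrite iotaE; exact: measurableX.
pose w z := c (iota1 z.1) (iota2 z.2).
have w0 z : 0 <= w z by exact: c0.
have mh (h : I -> J -> R) : measurable_fun setT (fun z : T1 * T2 => h (iota1 z.1) (iota2 z.2)).
  exact: (@measurable_finite_valued _ _ _ _ iota miota (fun k => h k.1 k.2)).
have ae1 : {ae P1, forall x, (\int[P2]_y (w (x, y))%:E = 1)%E}.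
  apply: ae_imp (finite_valued_ae m1 aE) => x ax; rewrite /w/=.
  rewrite (integral_finite_valued m2 bE (h := c (iota1 x)))//; congr EFin.
  rewrite -[RHS](divff ax) -{1}Fa mulr_suml; apply: eq_bigr => j _.
  have [bj|bj] := eqVneq (b j) 0; first by rewrite bj mulr0 Fb0// mul0r.
  by rewrite /c invfM mulrA mulfVK.
have ae2 : {ae P2, forall y, (\int[P1]_x (w (x, y))%:E = 1)%E}.
  apply: ae_imp (finite_valued_ae m2 bE) => y iy; rewrite /w/=.
  rewrite (integral_finite_valued m1 aE (h := c^~ (iota2 y)))//; congr EFin.
  rewrite -[RHS](divff iy) -{1}Fb mulr_suml; apply: eq_bigr => i _.
  have [ai|ai] := eqVneq (a i) 0; first by rewrite ai mulr0 Fa0// mul0r.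
  by rewrite /c invfM mulrA mulrAC mulfVK.
have [Q [Q1 Q2 QI]] := density_coupling P1T P2T w0 (mh c) ae1 ae2.
exists Q; split => // h h0.
rewrite QI; first last.
- by move=> z; rewrite lee_fin.
- by apply/measurable_EFinP; exact: mh.
under eq_integral do rewrite -EFinM.
have prE k : (probability_of P1T \x probability_of P2T)%E (iota @^-1` [set k]) =
    (a k.1 * b k.2)%:E.
  by case: k => i j; rewrite iotaE product_measure1E//= EFinM -aE -bE.
rewrite (integral_finite_valued miota prE (h := fun k => h k.1 k.2 * c k.1 k.2)); last first.
  by move=> k; rewrite mulr_ge0.
congr EFin; rewrite pair_bigA/=; apply: eq_bigr => -[i j] _ /=.
have [ai|ai] := eqVneq (a i) 0; first by rewrite ai mul0r mulr0 Fa0// mulr0.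
have [bj|bj] := eqVneq (b j) 0; first by rewrite bj !mulr0 Fb0// mulr0.
by rewrite -mulrA /c divfK// mulf_neq0.
Qed.

End block_coupling.

Lemma measure_decreasing_small (d : measure_display) (T : measurableType d) (R : realType)
    (P : {measure set T -> \bar R}) (F : nat -> set T) (e : R) :
  (P setT < +oo)%E -> (forall n, measurable (F n)) ->
  (forall n k, (n <= k)%N -> F k `<=` F n) -> (forall x, exists n, ~ F n x) ->
  0 < e -> exists n, forall k, (n <= k)%N -> (P (F k) <= e%:E)%E.
Proof.
move=> Pf mF dF F0 e0.
have cap0 : \bigcap_n F n = set0.
  by apply/seteqP; split => // x Fx; have [n] := F0 x; apply; exact: Fx.
have F0f : (P (F 0%N) < +oo)%E by rewrite (le_lt_trans _ Pf)// le_measure ?inE.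
have cv := @nonincreasing_cvg_mu _ _ _ P F F0f mF (bigcapT_measurable mF)
  (fun n k nk => introT (subsetPset _ _) (dF n k nk)).
rewrite cap0 measure0 in cv.
have Ff n : (P (F n))%E = (fine (P (F n)))%:E.
  by rewrite fineK// ge0_fin_numE// (le_lt_trans _ Pf)// le_measure ?inE.
have [n _ Hn] : \forall n \near \oo, fine (P (F n)) < e.
  by move/fine_cvg/cvgr_lt : cv; exact.
by exists n => k nk; rewrite Ff lee_fin; exact: ltW (Hn k nk).
Qed.

(** * Symmetry of the Wasserstein distance and its lower bound by second moments *)

Section wasserstein_symmetry.
Context {R : realType} {X : completeMetricType R}.
Variable p : nat -> X.
Hypothesis p_dense : forall x e, 0 < e -> exists n, mdist (p n) x < e.
Implicit Types mu nu : borel_measure X R.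
Let md2 := measurable_mdist2 p_dense.
Local Notation XX := (borel X * borel X)%type.

Let md2E : measurable_fun setT (fun z : XX => (mdist (z.1 : X) z.2 ^+ 2)%:E).
Proof. by apply/measurable_EFinP; apply: measurable_funX; exact: md2. Qed.

Let cost_pushforward (d : measure_display) (T : measurableType d)
    (P : {measure set T -> \bar R}) (phi : T -> XX) (mphi : measurable_fun setT phi) :
  transport_cost (measure_function_pushforward__canonical__measure_function_Measure P mphi) =
  (\int[P]_x (mdist ((phi x).1 : X) (phi x).2 ^+ 2)%:E)%E.
Proof.
rewrite /transport_cost.
have := @ge0_integral_pushforward _ _ _ _ R phi mphi P setT
  (fun z => (mdist (z.1 : X) z.2 ^+ 2)%:E) measurableT md2E _.
by rewrite preimage_setT; apply => z _; rewrite lee_fin sqr_ge0.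
Qed.

Lemma W2_sym mu nu : W2 mu nu = W2 nu mu.
Proof.
rewrite /W2; congr poweR; apply/eqP; rewrite eq_le.
suff H (mu' nu' : borel_measure X R) :
    (ereal_inf [set transport_cost q | q in coupling mu' nu'] <=
     ereal_inf [set transport_cost q | q in coupling nu' mu'])%E by rewrite !H.
apply: le_ereal_inf_tmp => _ [q qc <-].
pose phi (z : XX) : XX := (z.2, z.1).
have mphi : measurable_fun setT phi.
  exact: measurable_fun_pair measurable_snd measurable_fst.
apply: ereal_inf_lbound.
exists (measure_function_pushforward__canonical__measure_function_Measure q mphi).
  move=> A mA; have [<- <-] := qc A mA; rewrite /= /pushforward; split; congr (q _);
    by apply/seteqP; split => -[x y] /= [].
rewrite cost_pushforward; apply: eq_integral => -[x y] _ /=.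
by rewrite metric_sym.
Qed.

Lemma W2_refl mu : W2 mu mu = 0%E.
Proof.
apply: W2_cost => //; rewrite expr0n/=; apply/eqP; rewrite eq_le; apply/andP; split.
  pose phi (x : borel X) : XX := (x, x).
  have mphi : measurable_fun setT phi by exact: measurable_fun_pair.
  apply: ereal_inf_lbound.
  exists (measure_function_pushforward__canonical__measure_function_Measure mu mphi).
    move=> A mA; rewrite /= /pushforward; split; congr (mu _);
      by apply/seteqP; split => x /=; tauto.
  rewrite cost_pushforward; apply: integral0_eq => x _ /=.
  by rewrite mdistxx expr0n.
by apply: le_ereal_inf_tmp => _ [q _ <-]; exact: transport_cost_ge0.
Qed.

Variable x0 : X.
Local Notation d := (mdist x0).

Let md : measurable_fun [set: borel X] (fun x => (d x ^+ 2)%:E).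
Proof. by apply/measurable_EFinP; apply: measurable_funX; exact: measurable_mdist. Qed.

Let d0 (x : borel X) : (0 <= (d x ^+ 2)%:E)%E.
Proof. by rewrite lee_fin sqr_ge0. Qed.

(** With u, v the distances of x, y to [x0], d(x, y)^2 >= (v - u)^2 >= u^2 + v^2 - k u^2 - v^2 / k.
    Integrated with k = t / s this is (t - s)^2; for s = 0 < t, k = t^2 / e loses only e. *)
Lemma cost_ge_moments mu nu (s t : R) q : 0 <= s <= t ->
  (\int[mu]_x (d x ^+ 2)%:E = (s ^+ 2)%:E)%E ->
  (\int[nu]_x (d x ^+ 2)%:E = (t ^+ 2)%:E)%E ->
  coupling mu nu q -> (((t - s) ^+ 2)%:E <= transport_cost q)%E.
Proof.
move=> /andP[s0 st] muE nuE qc; have t0 : 0 <= t := le_trans s0 st.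
have q1 B : measurable B -> q (B `*` setT) = mu B by move=> /qc[].
have q2 B : measurable B -> q (setT `*` B) = nu B by move=> /qc[].
have md1 : measurable_fun setT (fun z : XX => (d (z.1 : X) ^+ 2)%:E).
  exact: measurableT_comp md measurable_fst.
have md2' : measurable_fun setT (fun z : XX => (d (z.2 : X) ^+ 2)%:E).
  exact: measurableT_comp md measurable_snd.
have key k : 0 < k -> ((s ^+ 2 + t ^+ 2)%:E <=
    transport_cost q + (k * s ^+ 2 + k^-1 * t ^+ 2)%:E)%E.
  move=> k0; have ki0 : 0 < k^-1 by rewrite invr_gt0.
  rewrite (EFinD (s ^+ 2)) (EFinD (k * _)) (EFinM k) (EFinM k^-1) -muE -nuE -(marginal_integral1 q1 md d0) -(marginal_integral2 q2 md d0).
  have c1 : measurable_fun setT (fun z : XX => k%:E * (d (z.1 : X) ^+ 2)%:E)%E.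
    exact: measurable_funeM.
  have c2 : measurable_fun setT (fun z : XX => k^-1%:E * (d (z.2 : X) ^+ 2)%:E)%E.
    exact: measurable_funeM.
  have p1 (z : XX) : (0 <= k%:E * (d (z.1 : X) ^+ 2)%:E)%E by rewrite mule_ge0// lee_fin ltW.
  have p2 (z : XX) : (0 <= k^-1%:E * (d (z.2 : X) ^+ 2)%:E)%E by rewrite mule_ge0// lee_fin ltW.
  have p3 (z : XX) : (0 <= (mdist (z.1 : X) z.2 ^+ 2)%:E)%E by rewrite lee_fin sqr_ge0.
  rewrite -!ge0_integralZl_EFin ?(ltW k0) ?(ltW ki0)//.
  have ID (f g : XX -> \bar R) : measurable_fun setT f -> (forall z, 0 <= f z)%E ->
      measurable_fun setT g -> (forall z, 0 <= g z)%E ->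
      (\int[q]_z f z + \int[q]_z g z = \int[q]_z (f z + g z))%E.
    by move=> mf f0 mg g0; rewrite ge0_integralD.
  rewrite /transport_cost !ID//; try exact: emeasurable_funD;
    try (by move=> z; exact: adde_ge0); try (by move=> z; rewrite lee_fin sqr_ge0).
  apply: ge0_le_integral => //.
  - by move=> z _; rewrite adde_ge0.
  - exact: emeasurable_funD.
  - by apply: emeasurable_funD => //; exact: emeasurable_funD.
  move=> [x y] _ /=; rewrite -!EFinM -!EFinD lee_fin.
  have := metric_triangle x0 x y; have := metric_triangle x0 y x.
  rewrite (metric_sym y x).
  set u := d x; set v := d y; set w := mdist x y => h1 h2.
  have : (v - u) ^+ 2 <= w ^+ 2.
    by rewrite -real_normK ?num_real// lerXn2r ?nnegrE ?mdist_ge0// ler_norml; apply/andP; split; lra.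
  have : 0 <= k^-1 * (k * u - v) ^+ 2 by rewrite mulr_ge0 ?sqr_ge0 ?(ltW ki0).
  have -> : k^-1 * (k * u - v) ^+ 2 = k * u ^+ 2 - 2 * (u * v) + k^-1 * v ^+ 2.
    by field; rewrite gt_eqF.
  lra.
have := transport_cost_ge0 q; case: (transport_cost q) key => [c| |]// key _; last exact: leey.
have {}key k : 0 < k -> s ^+ 2 + t ^+ 2 <= c + (k * s ^+ 2 + k^-1 * t ^+ 2).
  by move=> /key; rewrite -EFinD lee_fin.
rewrite lee_fin.
move: s0; rewrite le_eqVlt => /orP[/eqP s0|s0]; last first.
  have {}t0 : 0 < t := lt_le_trans s0 st.
  have := key (t / s) (divr_gt0 t0 s0).
  have -> : t / s * s ^+ 2 + (t / s)^-1 * t ^+ 2 = 2 * (s * t).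
    by field; rewrite !gt_eqF.
  lra.
rewrite -s0 subr0; apply/ler_addgt0Pr => e e0.
move: t0; rewrite le_eqVlt => /orP[/eqP t0|t0].
  have := key 1 ltr01; rewrite -s0 -t0 !expr0n/= !mulr0 !addr0 => c0.
  by rewrite addr_ge0// ltW.
have := key (t ^+ 2 / e) (divr_gt0 (exprn_gt0 _ t0) e0).
rewrite -s0 expr0n/= mulr0 !add0r invf_div divfK// gt_eqF// exprn_gt0//.
Qed.

Lemma W2_moments mu nu (s t : R) : 0 <= s <= t ->
  (\int[mu]_x (d x ^+ 2)%:E = (s ^+ 2)%:E)%E ->
  (\int[nu]_x (d x ^+ 2)%:E = (t ^+ 2)%:E)%E ->
  (forall e, 0 < e -> exists2 q, coupling mu nu q &
     (transport_cost q <= ((t - s) ^+ 2 + e)%:E)%E) ->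
  W2 mu nu = (t - s)%:E.
Proof.
move=> st muE nuE H; apply: W2_cost; first by rewrite subr_ge0; case/andP: st.
apply/eqP; rewrite eq_le; apply/andP; split.
  apply/lee_addgt0Pr => e e0; have [q qc qe] := H e e0.
  by apply: le_trans qe; apply: ereal_inf_lbound; exists q.
by apply: le_ereal_inf_tmp => _ [q qc <-]; exact: cost_ge_moments muE nuE qc.
Qed.

End wasserstein_symmetry.

(** * The curve of Gaussian measures *)

Section gaussian_curve.
Context {R : realType} {X : completeMetricType R}.
Variables (m : borel_measure X R) (x0 : X) (N C : R).
Hypotheses (N1 : 1 <= N) (mms : metric_measure_space m) (cd : CD0 N m) (C0 : 0 < C).
Hypothesis volume : forall r, 0 < r -> m (ball x0 r) = (C * r `^ N)%:E.

Local Notation d := (mdist x0).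
Local Notation gauss := (gauss x0).
Local Notation z := (gauss_int m x0).

Let ms : sigma_finite setT m. Proof. by have [] := mms. Qed.

Let N0 : 0 < N. Proof. exact: lt_le_trans ltr01 N1. Qed.

Let md : measurable_fun [set: borel X] d.
Proof. exact: measurable_mdist. Qed.

Let mg a : measurable_fun [set: borel X] (gauss a).
Proof. exact: measurable_gauss. Qed.

(** The exponent 1 / (4 T) at T = t^2 / (2 N); a Gaussian of rate a has second moment N / (2 a),
    which is t^2 here. *)
Definition rate (t : R) : R := N / (2 * t ^+ 2).

Definition gaussian_curve (t : R) : borel_measure X R := mu_hat m x0 (t ^+ 2 / (2 * N)).
Local Notation mut := gaussian_curve.

Lemma rate_gt0 t : 0 < t -> 0 < rate t.
Proof. by move=> t0; rewrite divr_gt0// mulr_gt0// exprn_gt0. Qed.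

Let z0 t : 0 < t -> 0 < z (rate t).
Proof. by move=> t0; apply: (gauss_int_gt0 N1 C0 ms volume); exact: rate_gt0. Qed.

Let zE a : 0 < a -> (\int[m]_x (gauss a x)%:E = (z a)%:E)%E.
Proof. exact: (gauss_intE N1 ms volume). Qed.

Lemma gaussian_curveE t (A : set (borel X)) : 0 < t -> measurable A ->
  mut t A = (\int[m]_(x in A) ((z (rate t))^-1 * gauss (rate t) x)%:E)%E.
Proof.
move=> t0 mA; have T0 : 0 < t ^+ 2 / (2 * N) by rewrite divr_gt0 ?exprn_gt0// mulr_gt0.
have wE : gauss_weight x0 (t ^+ 2 / (2 * N)) = gauss (rate t).
  apply/funext => x; congr (expR (- _)); rewrite /rate; field.
  by rewrite !gt_eqF.
rewrite /gaussian_curve /mu_hat T0 /= /gauss_measure.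
by apply: eq_integral => x _; rewrite /gauss_density /partition_fun wE.
Qed.

Let density_ge0 t x : 0 < t -> 0 <= (z (rate t))^-1 * gauss (rate t) x.
Proof. by move=> t0; rewrite mulr_ge0 ?gauss_ge0// invr_ge0 ltW// z0. Qed.

Lemma gaussian_curve_mass t : 0 <= t -> mut t setT = 1%E.
Proof.
rewrite le_eqVlt => /orP[/eqP <-|t0].
  by rewrite /gaussian_curve /mu_hat expr0n/= mul0r ltxx/= diracT.
rewrite gaussian_curveE//; under eq_integral do rewrite EFinM.
rewrite ge0_integralZl_EFin//; last 3 first.
- by move=> x _; rewrite lee_fin gauss_ge0.
- exact/measurable_EFinP.
- by rewrite invr_ge0 ltW// z0.
by rewrite zE ?rate_gt0// -EFinM mulVf// gt_eqF// z0.
Qed.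

Lemma gaussian_curve_moment t : 0 <= t ->
  (\int[mut t]_x (d x ^+ 2)%:E = (t ^+ 2)%:E)%E.
Proof.
rewrite le_eqVlt => /orP[/eqP <-|t0].
  rewrite /gaussian_curve /mu_hat expr0n/= mul0r ltxx integral_dirac//; last first.
    by apply/measurable_EFinP; exact: measurable_funX.
  by rewrite mdistxx expr0n diracT mul1e.
rewrite (@ge0_integral_density _ (borel X) R m _ (fun x => density_ge0 x t0) _ (mut t)
  (fun A => @gaussian_curveE t A t0)); last 3 first.
- by apply: measurable_funM.
- by apply/measurable_EFinP; exact: measurable_funX.
- by move=> x; rewrite lee_fin sqr_ge0.
rewrite (eq_integral (fun x : borel X => ((z (rate t))^-1)%:E * (d x ^+ 2 * gauss (rate t) x)%:E)%E); last first.
  by move=> x _; rewrite -!EFinM mulrCA.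
rewrite ge0_integralZl_EFin//; last 3 first.
- by move=> x _; rewrite lee_fin mulr_ge0 ?sqr_ge0 ?gauss_ge0.
- by apply/measurable_EFinP; apply: measurable_funM => //; exact: measurable_funX.
- by rewrite invr_ge0 ltW// z0.
rewrite (gauss_second_moment N1 C0 ms volume) ?rate_gt0// -EFinM; congr EFin.
have := z0 t0; set zt := z _ => zt0; rewrite /rate; field.
by rewrite !gt_eqF.
Qed.

Lemma gaussian_curve_P2 t : 0 <= t -> P2 (mut t).
Proof.
move=> t0; split; first exact: gaussian_curve_mass.
by exists x0; rewrite gaussian_curve_moment// ltry.
Qed.

(** If y is an intermediate point of w up to [dl], then d(w) >= (d(y) - dl)_+ / l, so the Gaussian
    at w is at most this function at y. *)
Let shift_gauss (a l dl : R) (x : X) : R :=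
  expR (- (a * (Num.max 0 (d x - dl) / l) ^+ 2)).

(** For d >= dl, (d - dl)^2 = (1 - dl) d^2 - dl + dl (d - 1)^2 + dl^2: the shift costs a factor
    exp(a dl) and a slightly smaller rate. *)
Let shift_gauss_le (a dl : R) x : 0 <= a -> 0 < dl <= 1 ->
  expR (- (a * Num.max 0 (d x - dl) ^+ 2)) <= expR (a * dl) * gauss (a * (1 - dl)) x.
Proof.
move=> a0 /andP[dl0 dl1]; rewrite /gauss -expRD ler_expR -mulrA -mulrBr -mulrN ler_wpM2l//.
have d0 := mdist_ge0 x0 x; have [h|h] := leP 0 (d x - dl).
  by have := mulr_ge0 (ltW dl0) (sqr_ge0 (d x - 1)); have := sqr_ge0 dl; lra.
rewrite expr0n/= oppr0 subr_ge0.
have : d x ^+ 2 <= 1 by rewrite expr_le1// ltW//; lra.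
have h2 : d x ^+ 2 <= dl.
  rewrite (@le_trans _ _ (dl ^+ 2))//; last by rewrite expr2 ler_piMl// ltW.
  by rewrite lerXn2r ?nnegrE ?(ltW dl0)//; lra.
have : (1 - dl) * d x ^+ 2 <= d x ^+ 2 by rewrite ler_piMl ?sqr_ge0//; lra.
lra.
Qed.

(* Hall's condition, up to an error tending to 0 with [dl], for the relation [x] is
   an approximate [s/t]-intermediate point between [x0] and [y]. *)
Lemma gaussian_curve_interpolant (s t dl : R) (A : set (borel X)) :
  0 < s < t -> 0 < dl <= 2^-1 -> measurable A ->
  (mut t A <= mut s (interpolant x0 A (s / t) dl) + (expR ((rate s + N) * dl) - 1)%:E)%E.
Proof.
move=> /andP[s0 st] /andP[dl0 dl2] mA; have t0 : 0 < t := lt_trans s0 st.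
set l := s / t; have l0 : 0 < l by rewrite divr_gt0.
have l1 : l < 1 by rewrite ltr_pdivrMr// mul1r.
have l01 : 0 < l < 1 by rewrite l0.
have rts : rate t / l ^+ 2 = rate s by rewrite /rate /l; field; rewrite !gt_eqF.
have dl1 : dl < 1 by rewrite (le_lt_trans dl2)// invf_lt1// ltr1n.
set S := interpolant x0 A l dl.
have mS : measurable (S : set (borel X)) by exact: measurable_interpolant.
pose g := shift_gauss (rate t) l dl.
have mgs : measurable_fun [set: borel X] g.
  apply: measurableT_comp => //; apply: measurable_funN; apply: measurable_funM => //.
  apply: measurable_funX; apply: measurable_funM => //; apply: measurable_maxr => //.
  exact: measurable_funB.
have step1 : ((l `^ N)%:E * \int[m]_(x in A) (gauss (rate t) x)%:E <= \int[m]_(x in S) (g x)%:E)%E.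
  apply: (layer_cake_le ms) => //; first exact: powR_ge0.
  - by move=> x; exact: gauss_ge0.
  - by move=> x; exact: expR_ge0.
  move=> c c0; pose A' := A `&` [set x | c < gauss (rate t) x].
  have mA' : measurable A' by apply: measurableI => //; exact: measurable_superlevel.
  apply: le_trans (brunn_minkowski_unbounded x0 N1 mms cd l01 dl0 mA') _.
  rewrite le_measure ?inE//.
  - exact: measurable_interpolant.
  - by apply: measurableI => //; exact: measurable_superlevel.
  move=> y [w [Aw cw] [yw1 yw2]]; split; first by exists w.
  rewrite /=; apply: (lt_le_trans cw); rewrite ler_expR lerN2 ler_wpM2l ?(ltW (rate_gt0 t0))//.
  have w0 := mdist_ge0 x0 w.
  have h : Num.max 0 (d y - dl) / l <= d w.
    rewrite ler_pdivrMr// ge_max mulr_ge0 ?(ltW l0)//=.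
    by rewrite mulrC; lra.
  by rewrite lerXn2r ?nnegrE// divr_ge0 ?(ltW l0)// le_max lexx.
(* A common majorant of [g] and of the Gaussian at time s. Since it lies above the latter
   everywhere, its excess over it on [S] is at most its excess on the whole space, which scaling
   computes. *)
pose h x := expR (rate s * dl) * gauss (rate s * (1 - dl)) x.
have mh : measurable_fun [set: borel X] h by exact: measurable_funM.
have h0 x : 0 <= h x by rewrite mulr_ge0 ?expR_ge0 ?gauss_ge0.
have rs0 := rate_gt0 s0.
have gh x : g x <= h x.
  rewrite /g /shift_gauss expr_div_n mulrA mulrAC rts.
  by apply: shift_gauss_le; [exact: ltW|rewrite dl0 ltW].
have gsh x : gauss (rate s) x <= h x.
  rewrite /h /gauss -expRD ler_expR -subr_ge0.
  have -> : rate s * dl - rate s * (1 - dl) * d x ^+ 2 - - (rate s * d x ^+ 2) =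
     rate s * dl * (1 + d x ^+ 2) by ring.
  by apply: mulr_ge0; [rewrite mulr_ge0// ltW|rewrite addr_ge0 ?sqr_ge0].
pose H := expR ((rate s + N) * dl) * z (rate s).
have dl1' : 0 < 1 - dl by rewrite subr_gt0.
have rd0 : 0 < rate s * (1 - dl) by rewrite mulr_gt0.
(* The change of rate contributes (1 - dl)^(-N/2), at most exp(N dl) because 1 / (1 - dl) <= 1 + 2
   dl for dl <= 1/2. *)
have HI : (\int[m]_x (h x)%:E <= H%:E)%E.
  under eq_integral do rewrite EFinM.
  rewrite ge0_integralZl_EFin ?expR_ge0//; last 2 first.
  - by move=> x _; rewrite lee_fin gauss_ge0.
  - exact/measurable_EFinP.
  rewrite zE// -EFinM lee_fin /H mulrDl expRD -mulrA ler_wpM2l ?expR_ge0//.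
  have -> : z (rate s * (1 - dl)) = (1 - dl) `^ (- (N / 2)) * z (rate s).
    rewrite (gauss_intP N1 C0 ms volume)// [in RHS](gauss_intP N1 C0 ms volume)//.
    by rewrite powRM ?(ltW rs0) ?(ltW dl1')// [_ `^ _ * _]mulrC mulrA.
  rewrite ler_wpM2r ?(ltW (z0 s0))//.
  rewrite /powR gt_eqF// ler_expR mulNr -mulrN -mulrA ler_wpM2l ?(ltW N0)//.
  rewrite mulrC ler_pdivrMr//.
  have di0 : 0 < (1 - dl)^-1 by rewrite invr_gt0.
  have := le_ln1Dx (_ : -1 < (1 - dl)^-1 - 1); rewrite addrCA subrr addr0 lnV ?posrE//.
  rewrite ltrBrDr addrC subrr => /(_ di0) h1.
  have h2 : (1 - dl)^-1 - 1 <= 2 * dl.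
    rewrite lerBlDr -(ler_pM2r dl1') mulVf ?gt_eqF//.
    by have := mulr_ge0 (ltW dl0) (_ : 0 <= 2^-1 - dl); rewrite subr_ge0 => /(_ dl2); lra.
  lra.
have split_int (f : X -> R) : measurable_fun [set: borel X] f -> (forall x, 0 <= f x) ->
    (\int[m]_x (f x)%:E = \int[m]_(x in S) (f x)%:E + \int[m]_(x in ~` S) (f x)%:E)%E.
  move=> mf f0; rewrite -ge0_integral_setU//; first by rewrite setUv.
  - exact: measurableC.
  - by apply: measurable_funTS; exact/measurable_EFinP.
  - by move=> x _; rewrite lee_fin.
  - by apply/disj_setPS; rewrite setICr.
have hS : (\int[m]_(x in S) (g x)%:E <= \int[m]_(x in S) (h x)%:E)%E.
  apply: ge0_le_integral => //.
  - by move=> x _; rewrite lee_fin expR_ge0.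
  - by apply: measurable_funTS; exact/measurable_EFinP.
  - by apply: measurable_funTS; exact/measurable_EFinP.
  - by move=> x _; rewrite lee_fin.
have hC : (\int[m]_(x in ~` S) (gauss (rate s) x)%:E <= \int[m]_(x in ~` S) (h x)%:E)%E.
  apply: ge0_le_integral => //.
  - exact: measurableC.
  - by move=> x _; rewrite lee_fin gauss_ge0.
  - by apply: measurable_funTS; exact/measurable_EFinP.
  - by apply: measurable_funTS; exact/measurable_EFinP.
  - by move=> x _; rewrite lee_fin.
have zsE : z (rate s) = l `^ N * z (rate t).
  by rewrite (gauss_int_scale N1 C0 ms volume l0 (rate_gt0 t0)) rts.
have lN0 : 0 < l `^ N by rewrite powR_gt0.
have i0 (f : X -> R) (B : set (borel X)) : (forall x, 0 <= f x) -> (0 <= \int[m]_(x in B) (f x)%:E)%E.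
  by move=> f0; apply: integral_ge0 => x _; rewrite lee_fin.
have massE r (B : set (borel X)) : 0 < r -> measurable B ->
    mut r B = ((z (rate r))^-1%:E * \int[m]_(x in B) (gauss (rate r) x)%:E)%E.
  move=> r0 mB; rewrite gaussian_curveE//; under eq_integral do rewrite EFinM.
  rewrite ge0_integralZl_EFin//.
  - by move=> x _; rewrite lee_fin gauss_ge0.
  - by apply: measurable_funTS; exact/measurable_EFinP.
  - by rewrite invr_ge0 ltW// z0.
rewrite !massE//; move: HI; have := zE rs0.
rewrite (split_int _ (mg _))//; last by move=> x; exact: gauss_ge0.
rewrite (split_int _ mh h0); move: step1 hS hC.
have := i0 _ A (gauss_ge0 x0 (rate t)); have := i0 _ S (gauss_ge0 x0 (rate s)).
have := i0 _ (~` S) (gauss_ge0 x0 (rate s)).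
have := i0 _ S h0; have := i0 _ (~` S) h0.
have := i0 g S (fun=> expR_ge0 _).
set IA := (\int[m]_(x in A) _)%E; set IS := (\int[m]_(x in S) (gauss _ _)%:E)%E.
set IC := (\int[m]_(x in ~` S) (gauss _ _)%:E)%E.
set HS := (\int[m]_(x in S) (h x)%:E)%E; set HC := (\int[m]_(x in ~` S) (h x)%:E)%E.
set G := (\int[m]_(x in S) (g x)%:E)%E.
have fin (u v : \bar R) : (0 <= u)%E -> (u <= v)%E -> (v < +oo)%E -> u \is a fin_num.
  by move=> u0 uv vf; rewrite ge0_fin_numE// (le_lt_trans uv).
move=> G0 HC0 HS0 IC0 IS0 IA0 step1 GHS ICHC sumI sumH.
have HHf : (HS + HC < +oo)%E by rewrite (le_lt_trans sumH)// ltry.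
have HSlt : (HS < +oo)%E by rewrite (le_lt_trans _ HHf)// leeDl.
have HClt : (HC < +oo)%E by rewrite (le_lt_trans _ HHf)// leeDr.
have HSf := fin HS HS HS0 (lexx _) HSlt; have HCf := fin HC HC HC0 (lexx _) HClt.
have Gf := fin G HS G0 GHS HSlt; have ICf := fin IC HC IC0 ICHC HClt.
have ISz : (IS <= (z (rate s))%:E)%E by rewrite -sumI leeDl.
have ISf := fin IS _ IS0 ISz (ltry _).
have IAf : IA \is a fin_num.
  rewrite ge0_fin_numE// ltNge leye_eq; apply/negP => /eqP IAoo.
  by move: step1; rewrite IAoo gt0_muley ?lte_fin// leye_eq => /eqP GE; rewrite GE in Gf.
move: sumI sumH step1 GHS ICHC.
rewrite -(fineK IAf) -(fineK ISf) -(fineK ICf) -(fineK HSf) -(fineK HCf) -(fineK Gf).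
rewrite -!EFinM -!EFinD !lee_fin => -[sumI] sumH step1 GHS ICHC.
have zs0 := z0 s0; have zt0 := z0 t0.
have -> : (z (rate t))^-1 = l `^ N / z (rate s).
  by rewrite zsE invfM mulrA divff ?mul1r// gt_eqF.
rewrite mulrAC ler_pdivrMr// mulrDl mulrAC mulVf ?gt_eqF// mul1r mulrBl mul1r -/H.
apply: (le_trans step1); apply: (le_trans GHS); rewrite -sumI.
have -> : fine IS + (H - (fine IS + fine IC)) = H - fine IC by ring.
by rewrite lerBrDr (le_trans _ sumH)// lerD2l.
Qed.

End gaussian_curve.

Lemma sqr_affine_le (R : realFieldType) (w u c : R) : 0 <= w -> 0 <= u -> 0 <= c ->
  w <= u + c -> w ^+ 2 <= (1 + c) * u ^+ 2 + c + c ^+ 2.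
Proof.
move=> w0 u0 c0 wuc; have : w ^+ 2 <= (u + c) ^+ 2 by rewrite lerXn2r// nnegrE addr_ge0.
by have := mulr_ge0 c0 (sqr_ge0 (u - 1)); lra.
Qed.

(** * Nearly optimal couplings between Gaussian measures *)

Section gaussian_coupling.
Context {R : realType} {X : completeMetricType R}.
Variables (m : borel_measure X R) (x0 : X) (N C : R).
Hypotheses (N1 : 1 <= N) (mms : metric_measure_space m) (cd : CD0 N m) (C0 : 0 < C).
Hypothesis volume : forall r, 0 < r -> m (ball x0 r) = (C * r `^ N)%:E.
Variable p : nat -> X.
Hypothesis p_dense : forall x e, 0 < e -> exists n, mdist (p n) x < e.

Local Notation d := (mdist x0).
Local Notation mut := (gaussian_curve m x0 N).
Local Notation XX := (borel X * borel X)%type.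

Let md2 := measurable_mdist2 p_dense.

Let N0 : 0 < N. Proof. exact: lt_le_trans ltr01 N1. Qed.

Let mass t : 0 <= t -> mut t setT = 1%E.
Proof. exact: (gaussian_curve_mass N1 mms C0 volume). Qed.

Let moment t : 0 <= t -> (\int[mut t]_x (d x ^+ 2)%:E = (t ^+ 2)%:E)%E.
Proof. exact: (gaussian_curve_moment N1 mms C0 volume). Qed.

Let mdsq : measurable_fun [set: borel X] (fun x => d x ^+ 2).
Proof. by apply: measurable_funX; exact: measurable_mdist. Qed.

Let far (k : nat) : set (borel X) := [set x | k%:R <= d x].

Let measurable_far k : measurable (far k).
Proof.
rewrite (_ : far k = d @^-1` `[k%:R, +oo[%classic); last first.
  by apply/seteqP; split => x /=; rewrite in_itv/= andbT.
rewrite -[X in measurable X]setTI; exact: measurable_mdist.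
Qed.

(** The second moment is the total mass of the finite measure of density d^2, and the sets [far k]
    decrease to the empty set. *)
Let second_moment_tail t e : 0 <= t -> 0 < e -> exists n, forall k, (n <= k)%N ->
  (\int[mut t]_(x in far k) (d x ^+ 2)%:E <= e%:E)%E.
Proof.
move=> t0 e0; pose nu := density_measure_pack (mut t) (fun x : borel X => sqr_ge0 (d x)) mdsq.
apply: (@measure_decreasing_small _ _ _ nu far e) => //.
- by rewrite /= /density_measure moment// ltry.
- by move=> n k nk x /=; apply: le_trans; rewrite ler_nat.
- move=> x; exists (Num.truncn (d x)).+1 => /=; apply/negP; rewrite -ltNge.
  exact: truncnS_gt.
Qed.

Section partition.
Variables (dl : R) (dl0 : 0 < dl) (n : nat).

(** All cells of index at least [n] are merged into the class [ord_max], the only one whose diameter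
    is not controlled. *)
Let iota (x : borel X) : 'I_n.+1 := inord (minn (ball_index p_dense dl0 x) n).

Let measurable_iota i : measurable (iota @^-1` [set i]).
Proof.
pose B := [set k : nat | inord (minn k n) = i].
rewrite (_ : _ @^-1` _ = setT `&` ball_index p_dense dl0 @^-1` B); last by rewrite setTI.
exact: measurable_ball_index.
Qed.

Let iota_near x y : iota x = iota y -> iota x != ord_max -> mdist x y < 2 * dl.
Proof.
move=> xy xn; have val u : iota u != ord_max -> nat_of_ord (iota u) = ball_index p_dense dl0 u.
  rewrite -val_eqE/= /iota inordK ?ltnS ?geq_minr// => un; apply/minn_idPl.
  by rewrite leqNgt; apply: contra un => nu; apply/eqP/minn_idPr/ltnW.
have := val _ xn; have := val y; rewrite -xy => /(_ xn) -> E.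
have nx := cell_near (erefl : cell p_dense dl0 (ball_index p_dense dl0 x) x).
have ny := cell_near (erefl : cell p_dense dl0 (ball_index p_dense dl0 y) y).
set px := p _ in nx; set py := p _ in ny; have pE : px = py by rewrite /px /py E.
have := metric_triangle x px y; rewrite (metric_sym x px).
by rewrite -pE in ny; lra.
Qed.

Let rest r : mut r (iota @^-1` [set ord_max]) = mut r [set x | (n <= ball_index p_dense dl0 x)%N].
Proof.
congr (mut r _); apply/seteqP; split => x /=.
  move=> /(congr1 val); rewrite /= /iota inordK ?ltnS ?geq_minr// => /minn_idPr.
  exact.
move=> nx; apply: val_inj; rewrite /= /iota inordK ?ltnS ?geq_minr//.
exact/minn_idPr.
Qed.

(** [h] is a penalty of at least [k] on bad pairs, those that meet the merged class or whose classes
    are unrelated. As it depends only on the two classes, [block_coupling] computes its integral: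
    each marginal contributes [eta] and Hall's error the rest. *)
Lemma gaussian_block_coupling (s t k eta : R) : 0 < s < t -> dl <= 2^-1 -> 0 <= k ->
  (mut s [set x | (n <= ball_index p_dense dl0 x)%N] <= eta%:E)%E ->
  (mut t [set x | (n <= ball_index p_dense dl0 x)%N] <= eta%:E)%E ->
  exists (Q : {measure set XX -> \bar R}) (h : XX -> R), [/\ coupling (mut s) (mut t) Q,
    measurable_fun setT h, forall z, 0 <= h z,
    forall x y, mdist x y <= (1 - s / t) * d y + 7 * dl \/ k <= h (x, y) &
    (\int[Q]_z (h z)%:E <= (k * (2 * eta + (expR ((rate N s + N) * dl) - 1)))%:E)%E].
Proof.
move=> /andP[s0 st] dl2 k0 etas etat; have t0 : 0 < t := lt_trans s0 st.
have [s00 t00] : 0 <= s /\ 0 <= t by split; exact: ltW.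
set l := s / t; have l0 : 0 < l by rewrite divr_gt0.
have l1 : l < 1 by rewrite ltr_pdivrMr// mul1r.
have fin_mut r (A : set (borel X)) : 0 <= r -> measurable A -> mut r A = (fine (mut r A))%:E.
  move=> r0 mA; rewrite fineK// ge0_fin_numE//.
  apply: (@le_lt_trans _ _ (mut r setT)); first by rewrite le_measure ?inE.
  by rewrite mass// ltry.
pose w r i := fine (mut r (iota @^-1` [set i])).
have wE r i : 0 <= r -> mut r (iota @^-1` [set i]) = (w r i)%:E by move=> r0; exact: fin_mut.
have w0 r i : 0 <= w r i by exact: fine_ge0.
have w1 r : 0 <= r -> \sum_i w r i = 1.
  move=> r0; have := mass r0.
  have -> : setT = [set x | predT (iota x)] by apply/seteqP; split.
  by rewrite (finite_valued_set measurable_iota (wE r ^~ r0)) => -[].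
(* Classes are related as soon as they contain one pair of points in the relation, so that the
   interpolant of a union of classes is covered by the related classes. *)
pose E i j := `[< exists x y, [/\ iota x = i, iota y = j & d x < l * d y + dl /\
  mdist x y < (1 - l) * d y + dl] >].
have hall (S : {set 'I_n.+1}) : \sum_(j in S) w t j <=
    \sum_(i | [exists j, (j \in S) && E i j]) w s i + (expR ((rate N s + N) * dl) - 1).
  rewrite -lee_fin EFinD -(finite_valued_set measurable_iota (wE s ^~ s00)).
  rewrite -(finite_valued_set measurable_iota (wE t ^~ t00)).
  have mS := measurable_finite_valued_set (R := R) measurable_iota (mem S).
  have dl12 : 0 < dl <= 2^-1 by rewrite dl0.
  have s0t : 0 < s < t by rewrite s0.
  apply: le_trans (gaussian_curve_interpolant N1 mms cd C0 volume s0t dl12 mS) _.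
  rewrite leeD2r// le_measure ?inE//; first exact: measurable_interpolant.
    exact: (measurable_finite_valued_set (R := R) measurable_iota
      (fun i => [exists j, (j \in S) && E i j])).
  move=> x [y yS [xy1 xy2]]; have {}yS : iota y \in S by [].
  apply/existsP; exists (iota y); rewrite yS/=.
  by apply/asboolP; exists x, y.
have [F [F0 Fa Fb FE]] := finite_strassen (w0 s) (w0 t) (w1 s s00) (w1 t t00) hall.
have [Q [Q1 Q2 QI]] := block_coupling (mass s00) (mass t00) measurable_iota measurable_iota
  (wE s ^~ s00) (wE t ^~ t00) F0 Fa Fb.
pose bad i j : R := (i == ord_max)%:R + (j == ord_max)%:R + (~~ E i j)%:R.
have bad0 i j : 0 <= k * bad i j by rewrite mulr_ge0// !addr_ge0.
exists Q, (fun z => k * bad (iota z.1) (iota z.2)); split.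
- by move=> A mA; split; [exact: Q1|exact: Q2].
- pose iota2 (z : XX) := (iota z.1, iota z.2).
  have mi2 e : measurable (iota2 @^-1` [set e]).
    case: e => i j.
    rewrite (_ : _ @^-1` _ = (iota @^-1` [set i]) `*` (iota @^-1` [set j])).
      exact: measurableX.
    by apply/seteqP; split => -[x y] /=; [case => <- <-|case => <- <-].
  exact: (measurable_finite_valued mi2 (fun e => k * bad e.1 e.2)).
- by move=> z; exact: bad0.
- move=> x y; rewrite /bad/=.
  have [xn|xn] := eqVneq (iota x) ord_max.
    by right; rewrite ler_peMr// -addrA lerDl addr_ge0.
  have [yn|yn] := eqVneq (iota y) ord_max.
    by right; rewrite ler_peMr// add0r lerDl.
  have [exy|] := boolP (E (iota x) (iota y)); last first.
    by right; rewrite ler_peMr// !add0r.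
  (* The constant 7: moving x' to x and y' to y costs 2 dl each, replacing d(y') by d(y) another 2
     dl, and the tolerance is dl. *)
  left; move/asboolP: exy => [x' [y' [xx yy [_ xy]]]].
  have xx' : mdist x x' < 2 * dl by apply: iota_near => //; rewrite -xx.
  have yy' : mdist y y' < 2 * dl by apply: iota_near => //; rewrite -yy.
  have h1 := metric_triangle x x' y; have h2 := metric_triangle x' y' y.
  have h3 := metric_triangle x0 y y'; rewrite (metric_sym y' y) in h2.
  have l1' : 0 <= 1 - l by rewrite subr_ge0 ltW.
  have h4 : (1 - l) * d y' <= (1 - l) * (d y + 2 * dl) by rewrite ler_wpM2l//; lra.
  have h5 : (1 - l) * (2 * dl) <= 2 * dl by rewrite ler_piMl ?mulr_ge0 ?(ltW dl0)//; lra.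
  lra.
rewrite (QI (fun i j => k * bad i j))// lee_fin.
under eq_bigr do under eq_bigr do rewrite -mulrA.
under eq_bigr do rewrite -mulr_sumr.
rewrite -mulr_sumr ler_wpM2l//.
under eq_bigr do under eq_bigr do rewrite /bad !mulrDl.
under eq_bigr do rewrite !big_split/=.
rewrite !big_split/=.
have -> : \sum_i \sum_j (i == ord_max)%:R * F i j = w s ord_max.
  rewrite (bigD1 ord_max)//= eqxx; under eq_bigr do rewrite mul1r.
  rewrite Fa big1 ?addr0// => i /negbTE ->.
  by rewrite big1// => j _; rewrite mul0r.
have -> : \sum_i \sum_j (j == ord_max)%:R * F i j = w t ord_max.
  rewrite exchange_big/= (bigD1 ord_max)//= eqxx; under eq_bigr do rewrite mul1r.
  rewrite Fb big1 ?addr0// => i /negbTE ->.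
  by rewrite big1// => j _; rewrite mul0r.
have -> : \sum_i \sum_j (~~ E i j)%:R * F i j = \sum_i \sum_(j | ~~ E i j) F i j.
  apply: eq_bigr => i _; rewrite [RHS]big_mkcond/=; apply: eq_bigr => j _.
  by case: (E i j); rewrite ?mul0r ?mul1r.
rewrite lerD// (_ : 2 * eta = eta + eta); last by ring.
by rewrite lerD// -lee_fin -wE// rest.
Qed.

End partition.

(** Four errors of size e/4: the enlargement of (1 - s/t) d(y) by 7 dl, the merged classes, Hall's
    error, and the tails. On bad pairs d(x, y)^2 <= 2 d(x)^2 + 2 d(y)^2, which is at most the
    penalty k = 4 r^2 plus the parts beyond radius r. *)
Lemma gaussian_near_coupling (s t e : R) : 0 < s < t -> 0 < e ->
  exists2 q, coupling (mut s) (mut t) q & (transport_cost q <= ((t - s) ^+ 2 + e)%:E)%E.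
Proof.
move=> /andP[s0 st] e0; have t0 : 0 < t := lt_trans s0 st.
have s0t : 0 < s < t by rewrite s0.
have [s00 t00] : 0 <= s /\ 0 <= t by split; exact: ltW.
have e16 : 0 < e / 16 by rewrite divr_gt0.
have [ks Hs] := second_moment_tail s00 e16; have [kt Ht] := second_moment_tail t00 e16.
pose n0 := (maxn ks kt).+1; pose r : R := n0%:R; have r0 : 0 < r by rewrite ltr0n.
have {}Hs := Hs n0 (leqW (leq_maxl _ _)); have {}Ht := Ht n0 (leqW (leq_maxr _ _)).
pose k := 4 * r ^+ 2; have k0 : 0 < k by rewrite mulr_gt0// exprn_gt0.
pose zeta := e / (4 * k); have zeta0 : 0 < zeta by rewrite divr_gt0// mulr_gt0.
pose eta := e / (8 * k); have eta0 : 0 < eta by rewrite divr_gt0// mulr_gt0.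
pose K := rate N s + N; have K0 : 0 < K by rewrite addr_gt0// rate_gt0.
(* From 7 dl (t - s)^2 + 7 dl + 49 dl^2, with dl^2 <= dl. *)
pose K1 := 7 * (t - s) ^+ 2 + 56; have K10 : 0 < K1 by rewrite ltr_wpDl// mulr_ge0// sqr_ge0.
have lz : 0 < ln (1 + zeta) by rewrite ln_gt0// ltrDl.
pose dl := Num.min 2^-1 (Num.min (e / (4 * K1)) (ln (1 + zeta) / K)).
have dl0 : 0 < dl by rewrite !lt_min invr_gt0 ltr0n !divr_gt0// mulr_gt0.
have dl2 : dl <= 2^-1 by rewrite /dl ge_min lexx.
have dlK1 : dl * (4 * K1) <= e.
  by rewrite -ler_pdivlMr ?mulr_gt0// /dl !ge_min lexx !orbT.
have dlK : expR (K * dl) - 1 <= zeta.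
  rewrite lerBlDl -[leRHS]lnK ?posrE ?addr_gt0// ler_expR mulrC -ler_pdivlMr//.
  by rewrite /dl !ge_min lexx !orbT.
pose G n : set (borel X) := [set x | (n <= ball_index p_dense dl0 x)%N].
have mG n : measurable (G n).
  rewrite (_ : G n = setT `&` ball_index p_dense dl0 @^-1` [set j | (n <= j)%N]).
    exact: measurable_ball_index.
  by rewrite setTI.
have Gsmall u : 0 <= u -> exists n, forall j, (n <= j)%N -> (mut u (G j) <= eta%:E)%E.
  move=> u0; apply: measure_decreasing_small => //.
  - by rewrite mass// ltry.
  - by move=> i j ij x /=; exact: leq_trans.
  - by move=> x; exists (ball_index p_dense dl0 x).+1; rewrite /G/= ltnn.
have [ns Ns] := Gsmall s s00; have [nt Nt] := Gsmall t t00.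
have [Q [h [qc mh h0 Qh Ih]]] := @gaussian_block_coupling dl dl0 (maxn ns nt) s t k eta s0t dl2
  (ltW k0) (Ns _ (leq_maxl _ _)) (Nt _ (leq_maxr _ _)).
exists Q => //; set l := s / t in Qh.
have l1 : 0 < 1 - l by rewrite subr_gt0 ltr_pdivrMr// mul1r.
pose c1 := (1 + 7 * dl) * (1 - l) ^+ 2; pose c2 := 7 * dl + 49 * dl ^+ 2.
have c10 : 0 <= c1 by rewrite mulr_ge0 ?sqr_ge0// addr_ge0 ?mulr_ge0// ltW.
have c20 : 0 <= c2 by rewrite addr_ge0 ?mulr_ge0 ?sqr_ge0// ltW.
pose tl (x : borel X) : \bar R := (2 * (d x ^+ 2 * \1_(far n0) x))%:E.
have tl0 x : (0 <= tl x)%E by rewrite lee_fin mulr_ge0// mulr_ge0 ?sqr_ge0.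
have mtl : measurable_fun [set: borel X] tl.
  apply/measurable_EFinP; do 2!apply: measurable_funM => //; exact: measurable_indic.
pose bulk (x : borel X) : \bar R := (c1 * d x ^+ 2 + c2)%:E.
have bulk0 x : (0 <= bulk x)%E by rewrite lee_fin addr_ge0// mulr_ge0 ?sqr_ge0.
have mbulk : measurable_fun [set: borel X] bulk.
  by apply/measurable_EFinP; apply: measurable_funD => //; exact: measurable_funM.
have Q1 B : measurable B -> Q (B `*` setT) = mut s B by move=> /qc[].
have Q2 B : measurable B -> Q (setT `*` B) = mut t B by move=> /qc[].
have tlI u : 0 <= u -> (\int[mut u]_(x in far n0) (d x ^+ 2)%:E <= (e / 16)%:E)%E ->
    (\int[mut u]_x tl x <= (e / 8)%:E)%E.
  move=> u0 H; rewrite /tl; under eq_integral do rewrite EFinM.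
  rewrite ge0_integralZl_EFin//; last 2 first.
  - by move=> x _; rewrite lee_fin mulr_ge0// sqr_ge0.
  - apply/measurable_EFinP; apply: measurable_funM => //; exact: measurable_indic.
  rewrite (_ : e / 8 = 2 * (e / 16)); last by field.
  rewrite [leRHS]EFinM; apply: lee_wpmul2l; first by [].
  apply: (@le_trans _ _ (\int[mut u]_(x in far n0) (d x ^+ 2)%:E)%E); last exact: H.
  rewrite [leRHS]integral_mkcond.
  rewrite le_eqVlt; apply/orP; left; apply/eqP; apply: eq_integral => x _.
  by rewrite patchE indicE; case: ifP => _; rewrite ?mulr1 ?mulr0.
have bulkI : (\int[mut t]_x bulk x = (c1 * t ^+ 2 + c2)%:E)%E.
  rewrite /bulk; under eq_integral do rewrite EFinD EFinM.
  have mdE : measurable_fun [set: borel X] (fun x => (d x ^+ 2)%:E) by exact/measurable_EFinP.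
  have d0 (x : borel X) : (0 <= (d x ^+ 2)%:E)%E by rewrite lee_fin sqr_ge0.
  rewrite ge0_integralD//; last 2 first.
  - by move=> x _; rewrite mule_ge0.
  - exact: measurable_funeM.
  rewrite ge0_integralZl_EFin//.
  by rewrite moment// integral_cst// mass// mule1.
have mhE : measurable_fun setT (fun z => (h z)%:E) by exact/measurable_EFinP.
have h0E z : (0 <= (h z)%:E)%E by rewrite lee_fin.
have m1 : measurable_fun setT (fun z : XX => tl z.1) by exact: measurableT_comp mtl measurable_fst.
have m2 : measurable_fun setT (fun z : XX => tl z.2) by exact: measurableT_comp mtl measurable_snd.
have m3 : measurable_fun setT (fun z : XX => bulk z.2).
  exact: measurableT_comp mbulk measurable_snd.
have ID (f g : XX -> \bar R) : measurable_fun setT f -> (forall z, 0 <= f z)%E ->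
    measurable_fun setT g -> (forall z, 0 <= g z)%E ->
    (\int[Q]_z (f z + g z) = \int[Q]_z f z + \int[Q]_z g z)%E.
  by move=> mf f0 mg' g0; rewrite ge0_integralD.
apply: (@le_trans _ _ (\int[Q]_z ((bulk z.2 + (h z)%:E) + (tl z.1 + tl z.2)))%E).
  apply: ge0_le_integral => //.
  - by move=> z _; rewrite lee_fin sqr_ge0.
  - by apply/measurable_EFinP; apply: measurable_funX; exact: md2.
  - by apply: emeasurable_funD; exact: emeasurable_funD.
  move=> [x y] _ /=; rewrite /bulk /tl -!EFinD lee_fin !indicE.
  have tail u : d u ^+ 2 <= r ^+ 2 + d u ^+ 2 * (u \in far n0)%:R.
    have [_|] := boolP (u \in far n0); first by rewrite mulr1 lerDr sqr_ge0.
    rewrite notin_setE /= => /negP; rewrite -ltNge mulr0 addr0 => /ltW ur.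
    by rewrite lerXn2r ?nnegrE ?mdist_ge0// ltW.
  have tp u : 0 <= d u ^+ 2 * (u \in far n0)%:R by rewrite mulr_ge0 ?sqr_ge0.
  have := tp x; have := tp y; have := tail x; have := tail y; have := h0 (x, y).
  set tx := d x ^+ 2 * _; set ty := d y ^+ 2 * _ => hxy dy2 dx2 ty0 tx0.
  have mxy := mdist_ge0 x y; have dx := mdist_ge0 x0 x; have dy := mdist_ge0 x0 y.
  have dysq := sqr_ge0 (d y).
  have [xy|xy] := Qh x y.
    set u := (1 - l) * d y in xy.
    have u0 : 0 <= u by rewrite mulr_ge0// ltW.
    have dl7 : 0 <= 7 * dl by rewrite mulr_ge0// ltW.
    have -> : c1 * d y ^+ 2 + c2 = (1 + 7 * dl) * u ^+ 2 + 7 * dl + (7 * dl) ^+ 2.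
      by rewrite /c1 /c2 /u; ring.
    apply: le_trans (sqr_affine_le mxy u0 dl7 xy) _.
    by rewrite -[leRHS]addrA lerDl !addr_ge0// mulr_ge0.
  have tri := metric_triangle x x0 y; rewrite (metric_sym x x0) in tri.
  have h1 : mdist x y ^+ 2 <= (d x + d y) ^+ 2.
    by rewrite lerXn2r// nnegrE// addr_ge0.
  have h2 := sqr_ge0 (d x - d y); have h3 : 0 <= c1 * d y ^+ 2 by rewrite mulr_ge0.
  rewrite /k in xy; lra.
rewrite !ID//; try exact: emeasurable_funD; try (by move=> z; exact: adde_ge0).
rewrite (marginal_integral2 Q2 mbulk bulk0) bulkI (marginal_integral1 Q1 mtl tl0).
rewrite (marginal_integral2 Q2 mtl tl0).
apply: le_trans (leeD (leeD (lexx _) Ih) (leeD (tlI s s00 Hs) (tlI t t00 Ht))) _.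
rewrite -!EFinD lee_fin -/K.
have E1 : c1 * t ^+ 2 = (1 + 7 * dl) * (t - s) ^+ 2.
  by rewrite /c1 /l; field; rewrite gt_eqF.
have E2 : k * (2 * eta) = e / 4 by rewrite /eta; field; rewrite gt_eqF.
have E3 : k * zeta = e / 4 by rewrite /zeta; field; rewrite gt_eqF.
have h1 : k * (expR (K * dl) - 1) <= k * zeta by rewrite ler_pM2l.
have h2 : dl ^+ 2 <= dl by rewrite expr2 ler_piMl ?(ltW dl0)//; lra.
rewrite E1 mulrDr E2 /c2; rewrite /K1 in dlK1; lra.
Qed.

(** Here the first measure is a Dirac mass at [x0], with second moment 0, so any coupling will do:
    the weight k = t^2 / e in [cost_le_moments] gives exactly t^2 + e. *)
Lemma gaussian_origin_coupling (t e : R) : 0 < t -> 0 < e ->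
  exists2 q, coupling (mut 0) (mut t) q & (transport_cost q <= ((t - 0) ^+ 2 + e)%:E)%E.
Proof.
move=> t0 e0; have [q qc] := product_coupling (mass (lexx 0)) (mass (ltW t0)).
exists q => //; have k0 : 0 < t ^+ 2 / e by rewrite divr_gt0// exprn_gt0.
apply: le_trans (cost_le_moments p_dense x0 k0 qc) _.
rewrite (moment (lexx 0)) (moment (ltW t0)) -!EFinM -EFinD lee_fin.
rewrite expr0n/= mulr0 add0r subr0 le_eqVlt.
by apply/orP; left; apply/eqP; field; rewrite !gt_eqF.
Qed.

Lemma W2_gaussian_curve (s t : R) : 0 <= s -> s < t -> W2 (mut s) (mut t) = (t - s)%:E.
Proof.
move=> s0 st; have t0 : 0 < t := le_lt_trans s0 st.
apply: (W2_moments p_dense (x0 := x0)); first by rewrite s0 ltW.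
- exact: moment.
- exact: moment (ltW t0).
move=> e e0; move: s0 st; rewrite le_eqVlt => /orP[/eqP <- _|s0 st].
  exact: gaussian_origin_coupling.
by apply: gaussian_near_coupling => //; rewrite s0.
Qed.

End gaussian_coupling.

Theorem proposition5p1 (R : realType) (X : completeMetricType R)
    (m : borel_measure X R) (N : R) (x0 : X) :
  1 <= N ->
  metric_measure_space m ->
  RCD0 N m ->
  (forall f : X -> R,
     dom_cheeger m f -> f \in Lfun m 1%E ->
     (fun x => mdist x0 x * f x) \in Lfun m 1%E ->
     (fun x => mdist x0 x * mgrad m f x) \in Lfun m 1%E ->
     (- (\int[m]_x
           (local_grad_inner m x0 (fun y => (mdist x0 y ^+ 2)%R) f x)%:E) =
      (2 * N)%:E * \int[m]_x (f x)%:E)%E) ->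
  (forall t : R, 0 <= t -> P2 (mu_hat m x0 (t ^+ 2 / (2 * N)))) /\
  (forall s t : R, 0 <= s -> 0 <= t ->
     W2 (mu_hat m x0 (s ^+ 2 / (2 * N))) (mu_hat m x0 (t ^+ 2 / (2 * N))) =
     (`|t - s|)%:E).
Proof.
move=> N1 mms [_ cd] laplacian.
have [sep _ _ _] := mms; have [p p_dense] := dense_sequence x0 sep.
have volume := volume_cone N1 mms cd laplacian.
have C0 := ball_volume_gt0 x0 mms (ltr01 : 0 < 1).
split=> [t t0|s t s0 t0]; first exact: (gaussian_curve_P2 N1 mms C0 volume).
wlog st : s t s0 t0 / s <= t.
  move=> H; have [st|/ltW ts] := leP s t; first exact: H.
  by rewrite (W2_sym p_dense) distrC; exact: H.
rewrite ger0_norm ?subr_ge0//.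
move: st; rewrite le_eqVlt => /orP[/eqP <-|st].
  by rewrite subrr (W2_refl p_dense).
exact: (W2_gaussian_curve N1 mms cd C0 volume p_dense).
Qed.
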